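(* Let $M$ be a Frölicher space that is microlinear and Weil exponentiable. Let $\xi_1$ be a $(1,p)$-icon on $M$, $\xi_2$ a $(1,q)$-icon on $M$, and $\xi_3$ a $(1,r)$-icon on $M$. Then the following Jacobi identity holds: $$[\xi_1,[\xi_2,\xi_3]_L]_L+\left([\xi_2,[\xi_3,\xi_1]_L]_L\right)^{\sigma_{p,q+r}}+\left([\xi_3,[\xi_1,\xi_2]_L]_L\right)^{\sigma_{p+q,r}}=0 ,$$ where for natural numbers $a,b$ the permutation $\sigma_{a,b}\in\mathbb{S}_{a+b}$ is given by $\sigma_{a,b}(i)=b+i$ for $1\le i\le a$ and $\sigma_{a,b}(a+j)=j$ for $1\le j\le b$.
   Context: Frölicher spaces and Weil prolongations. $\mathbf{FS}$ is the cartesian closed category of Frölicher spaces and smooth maps; $[X\to Y]=Y^X$ is the Frölicher space of smooth maps. A Weil algebra is a finite-dimensional commutative unital local $\mathbb{R}$-algebra with residue field $\mathbb{R}$. The Weil prolongation $X\otimes W$ of a Frölicher space $X$ by $W=C^\infty(\mathbb{R}^n)/I$ is the set of classes of smooth maps $f:\mathbb{R}^n\to X$, where $f\sim g$ iff $f(0)=g(0)$ and $h\circ f-h\circ g\in I$ for all smooth $h:X\to\mathbb{R}$, with the initial Frölicher structure for the induced maps $X\otimes W\to\mathbb{R}\otimes W=W$; this is a bifunctor and $\cdot\otimes W$ preserves products. Weil algebras are named by ''infinitesimal objects'': $D=\{d: d^2=0\}$, $D^n$, $D(2)=\{(d_1,d_2)\in D^2: d_1d_2=0\}$, $D^2\oplus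 D=\{(d_1,d_2,e)\in D^3: d_1e=d_2e=0\}$, with $\mathcal{W}_{D^n}=\mathbb{R}[X_1,\dots,X_n]/(X_1^2,\dots,X_n^2)$ ($\mathcal W_{D^0}=\mathbb R$), $\mathcal{W}_{D(2)}=\mathbb{R}[X,Y]/(X^2,Y^2,XY)$, $\mathcal{W}_{D^2\oplus D}=\mathbb{R}[X,Y,Z]/(X^2,Y^2,Z^2,XZ,YZ)$. A polynomial map $f:E\to E'$ of these objects induces contravariantly $\mathcal{W}_f:\mathcal{W}_{E'}\to\mathcal{W}_E$, hence $\mathrm{id}_X\otimes\mathcal{W}_f:X\otimes\mathcal{W}_{E'}\to X\otimes\mathcal{W}_E$ (pullback along $f$). $\otimes_\infty$ is the tensor product of Weil algebras; $\mathcal{W}_{D^{m+n}}=\mathcal{W}_{D^m}\otimes_\infty\mathcal{W}_{D^n}$. $X$ is microlinear if every finite limit diagram $\mathbb{D}$ of Weil algebras yields a limit diagram $X\otimes\mathbb{D}$ in $\mathbf{FS}$. $X$ is Weil exponentiable if $(X\otimes(W_1\otimes_\infty W_2))^Y=(X\otimes W_1)^Y\otimes W_2$ naturally for all Frölicher spaces $Y$ and Weil algebras $W_1,W_2$. Such spaces form a cartesian closed category. $\pi:X\otimes W\to X$ is the canonical projection. For $X$ microlinear, tangent vectors $t_1,t_2\in X\otimes\mathcal{W}_D$ with the same foot point $\pi(t_1)=\pi(t_2)$ are added as follows: there is a unique $\gamma\in X\otimes\mathcal{W}_{D(2)}$ with pullbacks $t_1,t_2$ along $d\mapsto(d,0)$,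 $d\mapsto(0,d)$, and $t_1+t_2$ is its pullback along $d\mapsto(d,d)$; $0$ denotes the zero tangent vector at the given foot point. Strong difference. Let $X$ be microlinear and $\gamma_1,\gamma_2\in X\otimes\mathcal{W}_{D^2}$ have the same pullback along the inclusion $D(2)\to D^2$. Let $\varphi(d_1,d_2)=(d_1,d_2,0)$, $\psi(d_1,d_2)=(d_1,d_2,d_1d_2)$ be maps $D^2\to D^2\oplus D$. There is a unique $\gamma\in X\otimes\mathcal{W}_{D^2\oplus D}$ with $(\mathrm{id}_X\otimes\mathcal{W}_\psi)(\gamma)=\gamma_1$, $(\mathrm{id}_X\otimes\mathcal{W}_\varphi)(\gamma)=\gamma_2$; define $\gamma_1\overset{\cdot}{-}\gamma_2\in X\otimes\mathcal{W}_D$ as the pullback of $\gamma$ along $d\mapsto(0,0,d)$. Icons. $\delta_M^p:M\otimes\mathcal{W}_{D^p}\to M$ is the canonical projection. A $(1,p)$-icon on $M$ is an element $\xi\in[M\otimes\mathcal{W}_{D^p}\to M]\otimes\mathcal{W}_D$ with foot point $\pi(\xi)=\delta_M^p$. For $\sigma\in\mathbb{S}_p$ and $\gamma\in M\otimes\mathcal{W}_{D^p}$ let $\gamma^\sigma$ be the pullback of $\gamma$ along $(d_1,\dots,d_p)\mapsto(d_{\sigma(1)},\dots,d_{\sigma(p)})$; for $\eta\in[M\otimes\mathcal{W}_{D^p}\to M]$ let $\eta^\sigma(\gamma)=\eta(\gamma^\sigma)$; for $\xi\in[M\otimes\mathcal{W}_{D^p}\to M]\otimes\mathcal{W}_D$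 let $\xi^\sigma$ be the image of $\xi$ under $((\ )^\sigma)\otimes\mathrm{id}_{\mathcal{W}_D}$. Lie bracket. For $\eta_1\in[M\otimes\mathcal{W}_{D^p}\to M]$, $\eta_2\in[M\otimes\mathcal{W}_{D^q}\to M]$: $\eta_1*\eta_2\in[M\otimes\mathcal{W}_{D^{p+q}}\to M]$ is $M\otimes\mathcal{W}_{D^{p+q}}=M\otimes(\mathcal{W}_{D^q}\otimes_\infty\mathcal{W}_{D^p})=(M\otimes\mathcal{W}_{D^q})\otimes\mathcal{W}_{D^p}\xrightarrow{\eta_2\otimes\mathrm{id}}M\otimes\mathcal{W}_{D^p}\xrightarrow{\eta_1}M$ (the first $p$ coordinates of $D^{p+q}$ being the $\mathcal{W}_{D^p}$ factor, the last $q$ the $\mathcal{W}_{D^q}$ factor), and $\eta_1\widetilde{*}\eta_2$ is $M\otimes\mathcal{W}_{D^{p+q}}=(M\otimes\mathcal{W}_{D^p})\otimes\mathcal{W}_{D^q}\xrightarrow{\eta_1\otimes\mathrm{id}}M\otimes\mathcal{W}_{D^q}\xrightarrow{\eta_2}M$. For a $(1,p)$-icon $\xi_1$ and a $(1,q)$-icon $\xi_2$, let $\xi_1\circledast\xi_2$ and $\xi_1\widetilde{\circledast}\xi_2$ in $[M\otimes\mathcal{W}_{D^{p+q}}\to M]\otimes\mathcal{W}_{D^2}$ be obtained by pulling $\xi_1$ back along $(d_1,d_2)\mapsto d_1$, $\xi_2$ along $(d_1,d_2)\mapsto d_2$, and applying $*\otimes\mathrm{id}_{\mathcal{W}_{D^2}}$,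 resp. $\widetilde{*}\otimes\mathrm{id}_{\mathcal{W}_{D^2}}$. These agree on $D(2)$, and the Lie bracket is $[\xi_1,\xi_2]_L=\xi_1\widetilde{\circledast}\xi_2\overset{\cdot}{-}\xi_1\circledast\xi_2$, which is a $(1,p+q)$-icon. *)

(* Defs.v *)
From HB Require Import structures.
From mathcomp Require Import all_boot all_order all_algebra.
From mathcomp Require Import fingroup perm.
From mathcomp Require Import all_classical all_reals all_analysis.
From mathcomp Require Import generic_quotient ring_quotient.

Set Implicit Arguments.
Unset Strict Implicit.
Unset Printing Implicit Defensive.

Import Order.TTheory GRing.Theory Num.Theory.
Import numFieldNormedType.Exports.

Local Open Scope classical_set_scope.
Local Open Scope ring_scope.
Local Open Scope quotient_scope.

Section Smooth.
Variable R : realType.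
Implicit Types f g : R -> R.

Definition smooth f := forall n x, derivable (derive1n n f) x 1.

Fixpoint ndiff n f : Prop :=
  if n is m.+1 then (forall x, derivable f x 1) /\ ndiff m (derive1 f) else True.

Lemma ndiffP f : smooth f <-> forall n, ndiff n f.
Proof.
have E k h : derive1n k (derive1 h) = derive1n k.+1 h.
  by rewrite /derive1n iterSr.
split=> [sf n|H n x].
- elim: n f sf => //= n IHn f sf; split=> [x|]; first exact: (sf 0).
  by apply: IHn => k x; rewrite E; apply: sf.
- elim: n f H => [|n IHn] f H; first by have [] := H 1.
  by rewrite -E; apply: IHn => k; have [] := H k.+1.
Qed.

Lemma ndiffW n f : ndiff n.+1 f -> ndiff n f.
Proof.
elim: n f => //= n IHn f [d H]; split=> //.
exact: IHn.
Qed.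

Lemma ndiffD n f g : ndiff n f -> ndiff n g -> ndiff n (f \+ g).
Proof.
elim: n f g => //= n IHn f g [df Hf] [dg Hg]; split=> [x|].
  exact: derivableD.
rewrite (_ : derive1 (f \+ g) = derive1 f \+ derive1 g); first exact: IHn.
by apply/funext => x; rewrite /= !derive1E deriveD.
Qed.

Lemma ndiffM n f g : ndiff n f -> ndiff n g -> ndiff n (f \* g).
Proof.
elim: n f g => //= n IHn f g [df Hf] [dg Hg]; split=> [x|].
  exact: derivableM.
rewrite (_ : derive1 (f \* g) = (f \* derive1 g) \+ (g \* derive1 f)); last first.
  by apply/funext => x; rewrite /= !derive1E deriveM.
apply: ndiffD; apply: IHn => //; apply: ndiffW; exact: conj.
Qed.

Lemma smoothD f g : smooth f -> smooth g -> smooth (f \+ g).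
Proof.
by move=> /ndiffP sf /ndiffP sg; apply/ndiffP => n; apply: ndiffD.
Qed.

Lemma smoothM f g : smooth f -> smooth g -> smooth (f \* g).
Proof.
by move=> /ndiffP sf /ndiffP sg; apply/ndiffP => n; apply: ndiffM.
Qed.

Lemma smooth_cst a : smooth (fun=> a).
Proof.
apply/ndiffP => n; elim: n a => //= n IHn a; split=> //.
rewrite (_ : derive1 (fun=> a) = (fun=> 0)); first exact: IHn.
by apply/funext => x; rewrite derive1E derive_cst.
Qed.

End Smooth.

Section Frolicher.
Variable R : realType.

Record frolicher := Frolicher {
  fcarrier :> Type ;
  curves : set (R -> fcarrier) ;
  funs : set (fcarrier -> R) ;
  curvesP : forall c, curves c <-> forall f, funs f -> smooth (f \o c) ;
  funsP : forall f, funs f <-> forall c, curves c -> smooth (f \o c) }.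

Section Generated.
Variable T : Type.

Section Initial.
Variable G : set (T -> R).

Definition initial_curves : set (R -> T) :=
  fun c => forall g, G g -> smooth (g \o c).
Definition initial_funs : set (T -> R) :=
  fun f => forall c, initial_curves c -> smooth (f \o c).

Fact initial_curvesP c :
  initial_curves c <-> forall f, initial_funs f -> smooth (f \o c).
Proof. by split=> [Cc f|H g Gg]; [apply|apply: H => d; apply]. Qed.
Fact initial_funsP f :
  initial_funs f <-> forall c, initial_curves c -> smooth (f \o c).
Proof. by []. Qed.
Definition initial := Frolicher initial_curvesP initial_funsP.
End Initial.

Section Final.
Variable C : set (R -> T).

Definition final_funs : set (T -> R) :=
  fun f => forall c, C c -> smooth (f \o c).
Definition final_curves : set (R -> T) :=
  fun c => forall f, final_funs f -> smooth (f \o c).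

Fact final_curvesP c :
  final_curves c <-> forall f, final_funs f -> smooth (f \o c).
Proof. by []. Qed.
Fact final_funsP f :
  final_funs f <-> forall c, final_curves c -> smooth (f \o c).
Proof. by split=> [Ff c|H c Cc]; [apply|apply: H => g; apply]. Qed.
Definition final := Frolicher final_curvesP final_funsP.
End Final.

End Generated.

Definition smooth_map (X Y : frolicher) (f : X -> Y) :=
  forall c, curves c -> curves (f \o c).

Record smap (X Y : frolicher) := Smap {
  smap_fun :> X -> Y ;
  smap_smooth : smooth_map smap_fun }.

HB.instance Definition _ X Y := gen_eqMixin (smap X Y).
HB.instance Definition _ X Y := gen_choiceMixin (smap X Y).

Lemma smap_eq X Y (f g : smap X Y) : f =1 g -> f = g.
Proof.
case: f g => [f pf] [g pg] /= /funext fg; rewrite fg in pf *.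
by rewrite (Prop_irrelevance pf pg).
Qed.

Definition line : frolicher := initial [set id : R -> R].

Definition euclid n : frolicher :=
  initial [set (fun v : 'rV[R]_n => v 0 i) | i in [set: 'I_n]].

Definition fprod (X Y : frolicher) : frolicher :=
  initial ([set (fun z : X * Y => f z.1) | f in @funs X] `|`
           [set (fun z : X * Y => g z.2) | g in @funs Y]).

(* [fhom X Y] is the exponential Y^X.  Cartesian closedness of the category
   says that the set of generating curves is already saturated. *)
Definition fhom (X Y : frolicher) : frolicher :=
  final [set c : R -> smap X Y |
    @smooth_map (fprod line X) Y (fun z => c z.1 z.2)].

Lemma smooth_map_comp X Y Z (g : smap Y Z) (f : smap X Y) :
  @smooth_map X Z (g \o f).
Proof. by move=> c cc; apply: (smap_smooth g); apply: (smap_smooth f). Qed.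
Definition scomp X Y Z (g : smap Y Z) (f : smap X Y) : smap X Z :=
  Smap (smooth_map_comp g f).

Lemma smooth_map_cst (X Y : frolicher) (y : Y) : @smooth_map X Y (fun=> y).
Proof. by move=> c _; apply: (curvesP _).2 => f _; exact: (@smooth_cst R (f y)). Qed.
Definition scst (X Y : frolicher) (y : Y) : smap X Y :=
  Smap (@smooth_map_cst X Y y).

(* [smoothen f0 g] is [g] as a smooth map; [f0] is a junk value for the case
   where [g] is not smooth. *)
Definition smoothen (X Y : frolicher) (f0 : smap X Y) (g : X -> Y) : smap X Y :=
  if pselect (smooth_map g) is left pg then Smap pg else f0.

End Frolicher.


Section Ring.
Variable R : realType.

(* C^oo(R^n): by Boman's theorem, the maps R^n -> R that are smooth along
   smooth curves are the C^oo functions in the usual sense. *)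
Definition Cinf n := smap (euclid R n) (line R).

HB.instance Definition _ n := Choice.on (Cinf n).

Section CinfRing.
Variable n : nat.
Implicit Types f g h : Cinf n.

Lemma CinfP (f : 'rV[R]_n -> R) :
  @smooth_map R (euclid R n) (line R) f <->
  forall c : R -> 'rV[R]_n, @curves R (euclid R n) c -> smooth (f \o c).
Proof.
split=> [sf c cc|H c cc]; first exact: (sf _ cc id).
by move=> _ ->; apply: H.
Qed.

Lemma Cinf_smooth f c : @curves R (euclid R n) c -> smooth (f \o c).
Proof. exact: (CinfP f).1 (smap_smooth f) c. Qed.

Definition Cinf_mk (f : 'rV[R]_n -> R) H : Cinf n := Smap ((CinfP f).2 H).

Definition Cinf_cst (a : R) : Cinf n := scst (euclid R n) (a : line R).

Lemma Cinf_add_subproof f g c :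
  @curves R (euclid R n) c -> smooth ((fun v => f v + g v : R) \o c).
Proof. by move=> cc; apply: smoothD; apply: Cinf_smooth. Qed.
Definition Cinf_add f g := Cinf_mk (@Cinf_add_subproof f g).

Lemma Cinf_mul_subproof f g c :
  @curves R (euclid R n) c -> smooth ((fun v => f v * g v : R) \o c).
Proof. by move=> cc; apply: smoothM; apply: Cinf_smooth. Qed.
Definition Cinf_mul f g := Cinf_mk (@Cinf_mul_subproof f g).

Definition Cinf_opp f := Cinf_mul (Cinf_cst (-1)) f.

Fact Cinf_addA : associative Cinf_add.
Proof. by move=> f g h; apply: smap_eq => v /=; rewrite addrA. Qed.
Fact Cinf_addC : commutative Cinf_add.
Proof. by move=> f g; apply: smap_eq => v /=; rewrite addrC. Qed.
Fact Cinf_add0 : left_id (Cinf_cst 0) Cinf_add.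
Proof. by move=> f; apply: smap_eq => v /=; rewrite add0r. Qed.
Fact Cinf_addN : left_inverse (Cinf_cst 0) Cinf_opp Cinf_add.
Proof. by move=> f; apply: smap_eq => v /=; rewrite mulN1r addNr. Qed.

HB.instance Definition _ :=
  GRing.isZmodule.Build (Cinf n) Cinf_addA Cinf_addC Cinf_add0 Cinf_addN.

Fact Cinf_mulA : associative Cinf_mul.
Proof. by move=> f g h; apply: smap_eq => v /=; rewrite mulrA. Qed.
Fact Cinf_mulC : commutative Cinf_mul.
Proof. by move=> f g; apply: smap_eq => v /=; rewrite mulrC. Qed.
Fact Cinf_mul1 : left_id (Cinf_cst 1) Cinf_mul.
Proof. by move=> f; apply: smap_eq => v /=; rewrite mul1r. Qed.
Fact Cinf_mulD : left_distributive Cinf_mul +%R.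
Proof. by move=> f g h; apply: smap_eq => v /=; rewrite mulrDl. Qed.
Fact Cinf_1neq0 : Cinf_cst 1 != 0.
Proof.
apply/eqP => /(congr1 (fun f : Cinf n => f 0 : R)) /= /eqP.
by rewrite oner_eq0.
Qed.

HB.instance Definition _ := GRing.Zmodule_isComNzRing.Build (Cinf n)
  Cinf_mulA Cinf_mulC Cinf_mul1 Cinf_mulD Cinf_1neq0.

Definition Cinf_scale (a : R) f := Cinf_cst a * f.

Fact Cinf_scaleA a b f :
  Cinf_scale a (Cinf_scale b f) = Cinf_scale (a * b) f.
Proof. by apply: smap_eq => v /=; rewrite mulrA. Qed.
Fact Cinf_scale1 : left_id 1 Cinf_scale.
Proof. by move=> f; apply: smap_eq => v /=; rewrite mul1r. Qed.
Fact Cinf_scaleDr : right_distributive Cinf_scale +%R.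
Proof. by move=> a f g; apply: smap_eq => v /=; rewrite mulrDr. Qed.
Fact Cinf_scaleDl f : {morph Cinf_scale^~ f : a b / a + b}.
Proof. by move=> a b; apply: smap_eq => v /=; rewrite mulrDl. Qed.

HB.instance Definition _ := GRing.Zmodule_isLmodule.Build R (Cinf n)
  Cinf_scaleA Cinf_scale1 Cinf_scaleDr Cinf_scaleDl.

Fact Cinf_scaleAl (a : R) f g : a *: (f * g) = (a *: f) * g.
Proof. by apply: smap_eq => v /=; rewrite mulrA. Qed.

HB.instance Definition _ :=
  GRing.Lmodule_isLalgebra.Build R (Cinf n) Cinf_scaleAl.
HB.instance Definition _ := GRing.Lalgebra_isComAlgebra.Build R (Cinf n).

End CinfRing.

End Ring.

Section QuotAlg.
Variables (K : comNzRingType) (A : comAlgType K) (I : idealr A).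
Local Notation Q := {ideal_quot I}.

Definition qscale (a : K) (x : Q) : Q := \pi_Q (a *: repr x).

Lemma qscale_pi a x : qscale a (\pi x) = \pi_Q (a *: x).
Proof.
apply/eqP; rewrite /qscale -Quotient.idealrBE -scalerBr.
rewrite -[a *: _]mul1r -scalerAr scalerAl idealMr //.
by rewrite Quotient.idealrBE reprK.
Qed.

Fact qscaleA a b x : qscale a (qscale b x) = qscale (a * b) x.
Proof. by rewrite -[x]reprK !qscale_pi scalerA. Qed.
Fact qscale1 : left_id 1 qscale.
Proof. by move=> x; rewrite -[x]reprK !qscale_pi scale1r. Qed.
Fact qscaleDr : right_distributive qscale +%R.
Proof.
move=> a x y; rewrite -[x]reprK -[y]reprK.
by rewrite -rmorphD !qscale_pi scalerDr rmorphD.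
Qed.
Fact qscaleDl x : {morph qscale^~ x : a b / a + b}.
Proof. by move=> a b; rewrite -[x]reprK !qscale_pi scalerDl rmorphD. Qed.

HB.instance Definition _ :=
  GRing.Zmodule_isLmodule.Build K Q qscaleA qscale1 qscaleDr qscaleDl.

Fact qscaleAl (a : K) (x y : Q) : a *: (x * y) = (a *: x) * y.
Proof.
rewrite -[x]reprK -[y]reprK /GRing.scale /= !qscale_pi.
by rewrite -!rmorphM qscale_pi scalerAl.
Qed.

HB.instance Definition _ := GRing.Lmodule_isLalgebra.Build K Q qscaleAl.
HB.instance Definition _ := GRing.Lalgebra_isComAlgebra.Build K Q.

End QuotAlg.

Section Weil.
Variable R : realType.
Local Notation Cinf := (Cinf R).
Local Notation euclid := (euclid R).
Local Notation line := (line R).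

Fact coord_subproof n (i : 'I_n) (c : R -> 'rV[R]_n) :
  @curves R (euclid n) c -> smooth ((fun v : 'rV[R]_n => v 0 i) \o c).
Proof. by move=> cc; apply: cc; exists i. Qed.
Definition coord n (i : 'I_n) : Cinf n := Cinf_mk (@coord_subproof n i).

Fact srow_subproof n m (g : 'I_m -> Cinf n) :
  @smooth_map R (euclid n) (euclid m) (fun v => \row_i (g i v : R)).
Proof.
move=> c cc _ [i _ <-].
rewrite (_ : _ \o _ = g i \o c); first exact: (@Cinf_smooth _ _ (g i) c cc).
by apply/funext => t /=; rewrite mxE.
Qed.
Definition srow n m (g : 'I_m -> Cinf n) : smap (euclid n) (euclid m) :=
  Smap (@srow_subproof n m g).

Definition polymap n m (t : m.-tuple (Cinf n)) : smap (euclid n) (euclid m) :=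
  srow (tnth t).

(* C^oo(R^n)/I, together with the presentation; since I vanishes at 0, the
   quotient is nontrivial and evaluation at 0 factors through it. *)
Record wpres := Wpres {
  wdim : nat ;
  wideal : idealr (Cinf wdim) ;
  wcentred : forall f, f \in wideal -> f 0 = 0 :> R }.

Definition walg (W : wpres) := {ideal_quot (wideal W)}.
HB.instance Definition _ W := GRing.ComAlgebra.on (walg W).
HB.instance Definition _ W := EqQuotient.on (walg W).

Definition findim (A : lmodType R) :=
  exists (k : nat) (b : 'I_k -> A),
    forall a, exists c : 'I_k -> R, a = \sum_i c i *: b i.

Definition maximal_ideal (A : comNzRingType) (m : idealr A) :=
  forall J : idealr A, {subset m <= J} -> {subset J <= m}.

Definition weil_algebra (A : comAlgType R) :=
  findim A /\
  exists m : idealr A,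
    [/\ maximal_ideal m, (forall J : idealr A, maximal_ideal J -> J =i m) &
        bijective (fun c : R => \pi_{ideal_quot m} (c%:A : A))].

Definition is_weil (W : wpres) := weil_algebra (walg W).

Section GeneratedIdeal.
Variables (n : nat) (G : set (Cinf n)).

Definition at0 : {pred Cinf n} := fun f => (f 0 : R) == 0.

Fact at0_idealr : idealr_closed at0.
Proof.
split; first by apply/eqP.
  by apply/negP => /eqP /= /eqP; rewrite oner_eq0.
move=> a u v /eqP u0 /eqP v0; apply/eqP => /=.
by rewrite u0 v0 mulr0 addr0.
Qed.
HB.instance Definition _ := isIdealr.Build (Cinf n) at0 at0_idealr.

Hypothesis G0 : forall f, G f -> f 0 = 0 :> R.

Definition gen : {pred Cinf n} := fun f =>
  `[< forall J : idealr (Cinf n), (forall g, G g -> g \in J) -> f \in J >].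

Lemma gen_at0 f : f \in gen -> f 0 = 0 :> R.
Proof. by move=> /asboolP /(_ at0) H; apply/eqP; apply: H => g /G0/eqP. Qed.

Fact gen_idealr : idealr_closed gen.
Proof.
split; first by apply/asboolP => J _; exact: rpred0.
  by apply/negP => /gen_at0 /eqP; rewrite oner_eq0.
move=> a u v /asboolP Hu /asboolP Hv; apply/asboolP => J GJ.
by rewrite rpredD ?idealMr ?Hu ?Hv.
Qed.
HB.instance Definition _ := isIdealr.Build (Cinf n) gen gen_idealr.

Definition wgen : wpres := @Wpres n gen gen_at0.

End GeneratedIdeal.

Section Tensor.
Variables W1 W2 : wpres.
Local Notation m := (wdim W1).
Local Notation n := (wdim W2).

Definition tensor_gens : set (Cinf (m + n)) :=
  [set scomp g (srow (fun i => coord (lshift n i)))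
    | g in [set g : Cinf m | g \in wideal W1]] `|`
  [set scomp g (srow (fun j => coord (rshift m j)))
    | g in [set g : Cinf n | g \in wideal W2]].

Fact tensor_gens0 f : tensor_gens f -> f 0 = 0 :> R.
Proof.
by case=> -[g /wcentred g0 <-]; rewrite -g0 /=; congr (smap_fun g _);
  apply/rowP => i; rewrite !mxE.
Qed.
Definition wtensor : wpres := wgen tensor_gens0.
End Tensor.

End Weil.

Section Prolongation.
Variable R : realType.
Local Notation Cinf := (Cinf R).
Local Notation euclid := (euclid R).
Local Notation frolicher := (frolicher R).
Local Notation wpres := (wpres R).

Section Object.
Variables (X : frolicher) (W : wpres).
Local Notation n := (wdim W).

Definition jet_rel : rel (smap (euclid n) X) := fun f g =>
  `[< f 0 = g 0 /\
      forall h : smap X (line R),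
        (scomp h f : Cinf n) - (scomp h g : Cinf n) \in wideal W >].

Fact jet_rel_equiv : equiv_class_of jet_rel.
Proof.
split=> [f|f g|g f h].
- by apply/asboolP; split=> // k; rewrite subrr rpred0.
- by apply/asboolP/asboolP => -[e H]; split=> // h;
    rewrite -opprB rpredN; apply: H.
- move=> /asboolP[e H] /asboolP[e' H']; apply/asboolP.
  split=> [|k]; first exact: etrans e e'.
  by rewrite -[X in X - _](subrK (scomp k g : Cinf n)) -addrA rpredD.
Qed.
Canonical jet_equiv := EquivRelPack jet_rel_equiv.

Definition jets := {eq_quot jet_equiv}.
HB.instance Definition _ := Choice.on jets.
HB.instance Definition _ := EqQuotient.on jets.

(* h (x) W : X (x) W -> R (x) W = W *)
Definition jet_eval (h : smap X (line R)) (u : jets) : walg W :=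
  \pi_(walg W) (scomp h (repr u)).

(* The finite-dimensional space W carries the structure whose smooth curves
   are those smooth under every linear functional. *)
Definition prol : frolicher :=
  initial [set k | exists h (l : {scalar walg W}), k = l \o jet_eval h].

Definition foot (u : prol) : X := repr (u : jets) 0.

Definition at0_walg (w : walg W) : R := (repr w : Cinf n) 0.

Fact at0_walg_pi (f : Cinf n) : at0_walg (\pi f) = f 0.
Proof.
apply/eqP; rewrite -subr_eq0; apply/eqP.
have := @wcentred R W (repr (\pi_(walg W) f) - f).
rewrite Quotient.idealrBE reprK eqxx => /(_ isT) <-.
by rewrite /= mulN1r.
Qed.

Fact at0_walg_scalar : scalar at0_walg.
Proof.
move=> a x y; rewrite -[x in LHS]reprK -[y in LHS]reprK.
have -> : a *: \pi_(walg W) (repr x) + \pi_(walg W) (repr y) =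
    \pi_(walg W) (a *: repr x + repr y).
  by rewrite rmorphD /= [in LHS]/GRing.scale /= qscale_pi.
by rewrite at0_walg_pi.
Qed.
HB.instance Definition _ :=
  GRing.isLinear.Build R (walg W) R^o _ at0_walg at0_walg_scalar.

Lemma foot_smooth : smooth_map foot.
Proof.
move=> c cc; apply: (curvesP _).2 => f Ff.
have sf : @smooth_map R X (line R) f.
  by move=> d cd _ ->; apply: (funsP f).1.
apply: (cc (f \o foot)); exists (Smap sf), at0_walg.
by apply/funext => u /=; rewrite /jet_eval at0_walg_pi.
Qed.

Definition zero_jet (x : X) : prol := \pi_jets (scst (euclid n) x).

End Object.

(* F (x) id_W : [f] |-> [F o f].  F is a bare function, so that smoothness of
   the operations it is applied to below need not be established first; the
   value is the intended one as soon as F is smooth. *)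
Definition prol_map (X Y : frolicher) (W : wpres) (F : X -> Y) (u : prol X W) :
    prol Y W :=
  let f := repr (u : jets X W) in
  \pi_(jets Y W) (smoothen (scst _ (F (f 0))) (F \o f)).

(* id_X (x) W_g : X (x) W -> X (x) W', for a map g from the object of W' to
   that of W. *)
Definition pull (X : frolicher) (W W' : wpres)
    (g : smap (euclid (wdim W')) (euclid (wdim W))) (u : prol X W) :
    prol X W' :=
  \pi_(jets X W') (scomp (repr (u : jets X W)) g).

(* id_X (x) phi for an arbitrary algebra map phi: it is induced by any smooth
   map whose i-th component represents the image of the i-th coordinate. *)
Definition lift_hom (W W' : wpres) (phi : walg W -> walg W') :
    smap (euclid (wdim W')) (euclid (wdim W)) :=
  srow (fun i => repr (phi (\pi_(walg W) (coord R i)))).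

Definition prol_hom (X : frolicher) (W W' : wpres)
    (phi : walg W -> walg W') : prol X W -> prol X W' :=
  pull (lift_hom phi).

(* Diagrams are indexed by finite directed graphs; limits only depend on the
   underlying graph of the indexing category. *)
Definition is_alg_limit (V E : finType) (src tgt : E -> V) (D : V -> wpres)
    (d : forall e, {lrmorphism walg (D (src e)) -> walg (D (tgt e))})
    (L : wpres) (k : forall v, {lrmorphism walg L -> walg (D v)}) :=
  (forall e, d e \o k (src e) =1 k (tgt e)) /\
  forall (A : comAlgType R) (a : forall v, {lrmorphism A -> walg (D v)}),
    (forall e, d e \o a (src e) =1 a (tgt e)) ->
    exists u : {lrmorphism A -> walg L},
      (forall v, k v \o u =1 a v) /\
      forall u' : {lrmorphism A -> walg L},
        (forall v, k v \o u' =1 a v) -> u' =1 u.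

Definition is_frolicher_limit (V E : finType) (src tgt : E -> V)
    (D : V -> frolicher) (d : forall e, D (src e) -> D (tgt e))
    (L : frolicher) (k : forall v, L -> D v) :=
  [/\ (forall e, smooth_map (d e)), (forall v, smooth_map (k v)),
      (forall e, d e \o k (src e) =1 k (tgt e)) &
      forall (Z : frolicher) (a : forall v, smap Z (D v)),
        (forall e, d e \o a (src e) =1 a (tgt e)) ->
        exists! u : smap Z L, forall v, k v \o u =1 a v].

Definition microlinear (X : frolicher) :=
  forall (V E : finType) (src tgt : E -> V) (D : V -> wpres)
    (d : forall e, {lrmorphism walg (D (src e)) -> walg (D (tgt e))})
    (L : wpres) (k : forall v, {lrmorphism walg L -> walg (D v)}),
    (forall v, is_weil (D v)) -> is_weil L ->
    is_alg_limit d k ->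
    @is_frolicher_limit V E src tgt (fun v => prol X (D v))
      (fun e => prol_hom (d e)) (prol X L) (fun v => prol_hom (k v)).

(* The canonical map X (x) (W1 (x) W2) -> (X (x) W1) (x) W2 on representatives:
   f |-> (t |-> (s |-> f (s, t))).  The outer map is smooth whenever W1 is a
   Weil algebra. *)
Definition slice m n (t : 'rV[R]_n) : smap (euclid m) (euclid (m + n)) :=
  srow (fun i => match fintype.split i with
                 | inl j => coord R j
                 | inr k => (t 0 k)%:A : Cinf m
                 end).

Definition curry_jet (X : frolicher) (W1 W2 : wpres)
    (f : smap (euclid (wdim W1 + wdim W2)) X) : prol (prol X W1) W2 :=
  let g (t : 'rV[R]_(wdim W2)) : prol X W1 :=
    \pi_(jets X W1) (scomp f (slice _ t)) in
  \pi_(jets (prol X W1) W2) (smoothen (scst (euclid (wdim W2)) (g 0)) g).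

(* (X (x) (W1 (x) W2))^Y = (X (x) W1)^Y (x) W2 through the canonical map: the
   isomorphism is required to be compatible with evaluation at every point of
   Y and with currying of representatives. *)
Definition weil_exponentiable (X : frolicher) :=
  forall (Y : frolicher) (W1 W2 : wpres), is_weil W1 -> is_weil W2 ->
  exists (Phi : smap (fhom Y (prol X (wtensor W1 W2)))
                     (prol (fhom Y (prol X W1)) W2))
         (Psi : smap (prol (fhom Y (prol X W1)) W2)
                     (fhom Y (prol X (wtensor W1 W2)))),
    [/\ cancel Phi Psi, cancel Psi Phi &
        forall (u : smap Y (prol X (wtensor W1 W2))) (y : Y)
               (f : smap (euclid (wdim W1 + wdim W2)) X),
          u y = \pi_(jets X (wtensor W1 W2)) f ->
          prol_map (fun v : fhom Y (prol X W1) => (v : smap Y (prol X W1)) y)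
            (Phi u) = curry_jet f].

End Prolongation.

Section Infinitesimal.
Variable R : realType.
Local Notation Cinf := (Cinf R).
Local Notation euclid := (euclid R).
Local Notation "''x[' n ]_ k" := (coord R (@Ordinal n k isT))
  (at level 8, k at level 2, format "''x[' n ]_ k").

Definition D_gens n : set (Cinf n) :=
  [set coord R i ^+ 2 | i in [set: 'I_n]].
Fact D_gens0 n f : @D_gens n f -> f 0 = 0 :> R.
Proof. by case=> i _ <-; rewrite expr2 /= mxE mul0r. Qed.
Definition WD n : wpres R := wgen (@D_gens0 n).

Definition D2_gens : set (Cinf 2) :=
  [set` [:: 'x[2]_0 ^+ 2; 'x[2]_1 ^+ 2; 'x[2]_0 * 'x[2]_1]].
Fact D2_gens0 f : D2_gens f -> f 0 = 0 :> R.
Proof.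
rewrite /D2_gens /= !inE => /or3P[] /eqP ->;
  by rewrite ?expr2 /= !mxE mul0r.
Qed.
Definition WD2 : wpres R := wgen D2_gens0.

Definition D2D_gens : set (Cinf 3) :=
  [set` [:: 'x[3]_0 ^+ 2; 'x[3]_1 ^+ 2; 'x[3]_2 ^+ 2;
            'x[3]_0 * 'x[3]_2; 'x[3]_1 * 'x[3]_2]].
Fact D2D_gens0 f : D2D_gens f -> f 0 = 0 :> R.
Proof.
rewrite /D2D_gens /= !inE => /or4P[||| /orP[]] /eqP ->;
  by rewrite ?expr2 /= !mxE mul0r.
Qed.
Definition WD2D : wpres R := wgen D2D_gens0.

Section Tangent.
Variable X : frolicher R.

(* [xget] returns its first argument only when no suitable gamma exists, which
   does not happen on the intended arguments when X is microlinear. *)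
Definition tadd (t1 t2 : prol X (WD 1)) : prol X (WD 1) :=
  let i1 := polymap [tuple 'x[1]_0; 0] : smap (euclid 1) (euclid 2) in
  let i2 := polymap [tuple 0; 'x[1]_0] : smap (euclid 1) (euclid 2) in
  let diag := polymap [tuple 'x[1]_0; 'x[1]_0] : smap (euclid 1) (euclid 2) in
  let pr := polymap [tuple 'x[2]_0] : smap (euclid 2) (euclid 1) in
  let gamma : prol X WD2 :=
    xget (@pull R X (WD 1) WD2 pr t1 : jets X WD2)
      [set g | @pull R X WD2 (WD 1) i1 g = t1 /\
               @pull R X WD2 (WD 1) i2 g = t2] in
  @pull R X WD2 (WD 1) diag gamma.

Definition strong_diff (g1 g2 : prol X (WD 2)) : prol X (WD 1) :=
  let phi := polymap [tuple 'x[2]_0; 'x[2]_1; 0] : smap (euclid 2) (euclid 3) in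
  let psi := polymap [tuple 'x[2]_0; 'x[2]_1; 'x[2]_0 * 'x[2]_1]
    : smap (euclid 2) (euclid 3) in
  let eps := polymap [tuple 0; 0; 'x[1]_0] : smap (euclid 1) (euclid 3) in
  let pr := polymap [tuple 'x[3]_0; 'x[3]_1] : smap (euclid 3) (euclid 2) in
  let gamma : prol X WD2D :=
    xget (@pull R X (WD 2) WD2D pr g2 : jets X WD2D)
      [set g | @pull R X WD2D (WD 2) psi g = g1 /\
               @pull R X WD2D (WD 2) phi g = g2] in
  @pull R X WD2D (WD 1) eps gamma.

End Tangent.

Section Icon.
Variable M : frolicher R.

Definition ops p : frolicher R := fhom (prol M (WD p)) M.

Definition delta p : ops p := Smap (@foot_smooth R M (WD p)).

Definition icon p (xi : prol (ops p) (WD 1)) := foot xi = delta p.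

Definition jperm p (s : 'S_p) : prol M (WD p) -> prol M (WD p) :=
  @pull R M (WD p) (WD p) (srow (fun i => coord R (s i))).

Definition operm p (s : 'S_p) (eta : ops p) : ops p :=
  let eta' : smap (prol M (WD p)) M := eta in
  smoothen eta' (fun gamma => eta' (jperm s gamma)).

Definition iperm p (s : 'S_p) : prol (ops p) (WD 1) -> prol (ops p) (WD 1) :=
  prol_map (operm s).

Definition icast p q (e : p = q) (xi : prol (ops p) (WD 1)) :
    prol (ops q) (WD 1) :=
  ecast n (prol (ops n) (WD 1)) e xi.

(* The identification of M (x) W_{D^(p+q)} with (M (x) W_{D^p}) (x) W_{D^q},
   the last q coordinates being the outer ones. *)
Definition split_jet p q (gamma : prol M (WD (p + q))) :
    prol (prol M (WD p)) (WD q) :=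
  @curry_jet R M (WD p) (WD q) (repr (gamma : jets M (WD (p + q)))).

(* The identification of M (x) W_{D^(p+q)} with (M (x) W_{D^q}) (x) W_{D^p},
   the first p coordinates being the outer ones. *)
Definition split_jet' p q (gamma : prol M (WD (p + q))) :
    prol (prol M (WD q)) (WD p) :=
  let swap : smap (euclid (q + p)) (euclid (p + q)) :=
    srow (fun i : 'I_(p + q) => match fintype.split i with
                                | inl j => coord R (rshift q j)
                                | inr k => coord R (lshift p k)
                                end) in
  @curry_jet R M (WD q) (WD p)
    (scomp (repr (gamma : jets M (WD (p + q)))) swap).

(* eta1 * eta2 and its opposite, as maps on the product; smoothness of the
   composites comes from M being Weil exponentiable. *)
Definition star p q (z : fprod (ops p) (ops q)) : ops (p + q) :=
  let eta1 : smap (prol M (WD p)) M := z.1 in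
  let eta2 : smap (prol M (WD q)) M := z.2 in
  @smoothen R (prol M (WD (p + q))) M (delta (p + q))
    (fun gamma => eta1 (prol_map eta2 (split_jet' gamma))).

Definition tstar p q (z : fprod (ops p) (ops q)) : ops (p + q) :=
  let eta1 : smap (prol M (WD p)) M := z.1 in
  let eta2 : smap (prol M (WD q)) M := z.2 in
  @smoothen R (prol M (WD (p + q))) M (delta (p + q))
    (fun gamma => eta2 (prol_map eta1 (split_jet gamma))).

(* (X (x) W) x (Y (x) W) = (X x Y) (x) W *)
Definition jet_pair (X Y : frolicher R) (W : wpres R)
    (u : prol X W) (v : prol Y W) : prol (fprod X Y) W :=
  let f := repr (u : jets X W) in
  let g := repr (v : jets Y W) in
  \pi_(jets (fprod X Y) W)
    (smoothen (scst _ ((f 0, g 0) : fprod X Y))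
       (fun x => (f x, g x))).

(* xi1 pulled back along (d1, d2) |-> d1, paired with xi2 pulled back along
   (d1, d2) |-> d2 *)
Definition bipull p q (xi1 : prol (ops p) (WD 1)) (xi2 : prol (ops q) (WD 1)) :
    prol (fprod (ops p) (ops q)) (WD 2) :=
  jet_pair
    (@pull R _ (WD 1) (WD 2) (polymap [tuple 'x[2]_0]) xi1)
    (@pull R _ (WD 1) (WD 2) (polymap [tuple 'x[2]_1]) xi2).

Definition lie p q (xi1 : prol (ops p) (WD 1)) (xi2 : prol (ops q) (WD 1)) :
    prol (ops (p + q)) (WD 1) :=
  strong_diff (prol_map (@tstar p q) (bipull xi1 xi2))
              (prol_map (@star p q) (bipull xi1 xi2)).

End Icon.

End Infinitesimal.

(* sigma_{a,b} in 'S_(a + b), with indices counted from 0: i |-> b + i for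
   i < a, and a + j |-> j. *)
Definition sigma_fun a b (i : 'I_(a + b)) : 'I_(a + b) :=
  cast_ord (addnC b a) match fintype.split i with
                       | inl j => rshift b j
                       | inr k => lshift a k
                       end.

Fact sigma_fun_inj a b : injective (@sigma_fun a b).
Proof.
move=> i j /cast_ord_inj; rewrite -[i]splitK -[j]splitK !unsplitK.
case: (fintype.split i) => k; case: (fintype.split j) => l //=.
- by move/rshift_inj ->.
- by move/eqP; rewrite eq_sym eq_lrshift.
- by move/eqP; rewrite eq_lrshift.
- by move/lshift_inj ->.
Qed.

Definition sigma a b : 'S_(a + b) := perm (@sigma_fun_inj a b).

(* Main.v *)
From HB Require Import structures.
From mathcomp Require Import all_boot all_order all_algebra.
From mathcomp Require Import fingroup perm.
From mathcomp Require Import all_classical all_reals all_analysis.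
From mathcomp Require Import ring lra.
From mathcomp Require Import generic_quotient ring_quotient.
Require Import Defs.

(** The Lie bracket is infinitesimally a commutator, and the Jacobi identity is
    the cancellation of the twelve triple products in three nested commutators.
    To make this literal, tangent vectors to a Frölicher space X are tested
    against smooth functions H on X: an element of X (x) W_D is determined by
    its foot point and by the derivatives at 0 of H o f, for f a representative
    ([tangent_ext]).  Under such a test the sum of tangent vectors becomes a sum
    of real numbers ([tadd_spec]), and the strong difference becomes a
    difference of mixed second derivatives ([strong_spec]), because the
    coefficient of z in G(x, y, z) is the difference of the coefficients of xy
    in G(x, y, xy) and in G(x, y, 0).  A nested bracket is therefore a signed
    sum of four mixed third derivatives of H along composites of three families
    of operations ([lie_nested]).  In such a composite the three operations are
    applied in some order; after the prescribed permutations of coordinates the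
    twelve composites are the six orders, each occurring once with each sign
    ([word_231] and the lemmas after it), and mixed derivatives commute
    ([D3_rot]).

    Most of the work goes into the smoothness and existence statements that
    this computation takes for granted.

    First, exponentials carry a final structure, and a curve in Y^X has to be
    shown to be smooth jointly with the points of X ([fhom_uncurry]).  This
    rests on a version of Boman's theorem in two variables: derivatives and
    difference quotients in one variable of a function that is smooth along
    smooth curves are again smooth along smooth curves ([BS2_d2],
    [hquot_BS2]).  A gliding hump argument ([gliding_hump]) then shows that
    testing against weighted sums of point evaluations controls all
    derivatives uniformly, and hence smoothness on the diagonal
    ([wsm2_diag]).

    Secondly, modulo squares of coordinates a smooth function has a Taylor
    expansion whose coefficients are smooth in parameters ([taylor_sq]).
    Consequently presentations with square-zero coordinates define Weil
    algebras ([sq_is_weil]), smooth families of representatives give smooth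
    families of jets ([jet_param]), and jets in a product are pairs of jets
    ([jet_pairE]).

    Thirdly, the element gamma in the definitions of the sum and of the strong
    difference is needed in the exponential M^Y, whereas only M is microlinear.
    Weil exponentiability identifies points of M^Y (x) W with smooth maps from
    Y to M (x) W ([transp_surj], [transp_inj]), and the universal property of
    the limit M (x) W_{D(2)} or M (x) W_{D^2+D}, used with source Y, gives
    gamma ([tadd_ex], [strong_ex]).  Transposition with Y the real line also
    shows that curves of jets lift to smooth families of representatives
    ([jet_lift]), whence the two composites of operations are smooth. *)

Set Implicit Arguments.
Set Strict Implicit.
Unset Printing Implicit Defensive.

Import Order.TTheory GRing.Theory Num.Theory.
Import numFieldNormedType.Exports.

Local Open Scope classical_set_scope.
Local Open Scope ring_scope.

(** * Smooth functions of one real variable *)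

Section SmoothCalculus.
Variable R : realType.
Implicit Types (f g : R -> R) (x : R).

Lemma smooth_derivable f x : smooth f -> derivable f x 1.
Proof. by move=> sf; exact: (sf 0%N). Qed.

Lemma smooth_is_derive f x : smooth f -> is_derive x 1 f (derive1 f x).
Proof. by move=> sf; rewrite derive1E; apply/derivableP/smooth_derivable. Qed.

Lemma smooth_derive1 f : smooth f -> smooth (derive1 f).
Proof. by move=> sf n x; have := sf n.+1 x; rewrite derive1Sn. Qed.

Lemma smooth_derive1n n f : smooth f -> smooth (derive1n n f).
Proof.
elim: n => [|n IHn] sf; first exact: sf.
by rewrite derive1nS; exact: (smooth_derive1 (IHn sf)).
Qed.

Lemma smooth_continuous f : smooth f -> continuous f.
Proof.
by move=> sf x; apply/differentiable_continuous/derivable1_diffP/smooth_derivable.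
Qed.

Lemma is_derive1E f x l : is_derive x 1 f l -> derive1 f x = l.
Proof. by rewrite derive1E => -[]. Qed.

(** Coinduction for smoothness, which spares an induction on the order when
    the derivatives of an explicit function are again of the same form. *)
Lemma smooth_coind (P : (R -> R) -> Prop) :
  (forall f, P f -> exists2 g, P g & forall x, is_derive x 1 f (g x)) ->
  forall f, P f -> smooth f.
Proof.
move=> H f Pf; apply/ndiffP => n; elim: n f Pf => //= n IHn f /H[g Pg fg].
split=> [x|]; first by have [] := fg x.
rewrite (_ : derive1 f = g); first exact: IHn.
by apply/funext => x; apply: is_derive1E.
Qed.

Lemma smoothS f g : (forall x, is_derive x 1 f (g x)) -> smooth g -> smooth f.
Proof.
move=> fg /ndiffP sg; apply/ndiffP => -[|n] //=; split=> [x|].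
  by have [] := fg x.
rewrite (_ : derive1 f = g) //.
by apply/funext => x; apply: is_derive1E.
Qed.

Lemma smooth_ndiff n f : smooth f -> ndiff n f.
Proof. by move=> /ndiffP. Qed.

Lemma smooth_id : smooth (id : R -> R).
Proof. by apply: (@smoothS _ (fun=> 1)); exact: smooth_cst. Qed.

Lemma smoothZ a f : smooth f -> smooth (fun x => a * f x).
Proof. by move=> sf; exact: (smoothM (@smooth_cst _ a) sf). Qed.

Lemma smoothN f : smooth f -> smooth (fun x => - f x).
Proof.
move=> sf; rewrite (_ : (fun x => - f x) = (fun x => -1 * f x)).
  exact: smoothZ.
by apply/funext => x; rewrite mulN1r.
Qed.

Lemma smoothB f g : smooth f -> smooth g -> smooth (fun x => f x - g x).
Proof. by move=> sf sg; exact: (smoothD sf (smoothN sg)). Qed.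

Lemma smooth_sum (I : Type) (r : seq I) (P : pred I) (F : I -> R -> R) :
  (forall i, P i -> smooth (F i)) ->
  smooth (fun x => \sum_(i <- r | P i) F i x).
Proof.
move=> H; elim: r => [|i r IHr].
  by under eq_fun do rewrite big_nil; exact: smooth_cst.
case Pi : (P i); under eq_fun do rewrite big_cons Pi; last exact: IHr.
exact: (smoothD (H i Pi) IHr).
Qed.

Lemma is_derive_comp1 f g x df dg :
  is_derive (g x) 1 f df -> is_derive x 1 g dg ->
  is_derive x 1 (f \o g) (dg * df).
Proof. by move=> H1 H2; rewrite mulrC; exact: is_derive1_comp. Qed.

Lemma smooth_comp f g : smooth f -> smooth g -> smooth (f \o g).
Proof.
move=> sf sg; apply/ndiffP => n.
elim: n f sf => //= n IHn f sf.
have D x : is_derive x 1 (f \o g) (derive1 g x * derive1 f (g x)).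
  by apply: is_derive_comp1; apply: smooth_is_derive.
split=> [x|]; first by have [] := D x.
rewrite (_ : derive1 _ = derive1 g \* (derive1 f \o g)).
  apply: ndiffM; first by apply/smooth_ndiff/smooth_derive1.
  by apply: IHn; apply: smooth_derive1.
by apply/funext => x; apply: is_derive1E.
Qed.

Lemma smoothV f : smooth f -> (forall x, f x != 0) -> smooth (fun x => (f x)^-1).
Proof.
move=> sf f0; apply/ndiffP => n; elim: n => //= n IHn.
have D x : is_derive x 1 (fun x => (f x)^-1) (- (f x) ^- 2 *: derive1 f x).
  by apply: is_deriveV => //; exact: smooth_is_derive.
split=> [x|]; first by have [] := D x.
set k := fun x => (f x)^-1 in IHn *.
rewrite (_ : derive1 k = (fun=> -1) \* (derive1 f \* (k \* k))).
  apply: ndiffM; first by apply/smooth_ndiff/smooth_cst.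
  apply: ndiffM; last exact: ndiffM.
  by apply/smooth_ndiff/smooth_derive1.
apply/funext => x; rewrite (is_derive1E (D x)) /= /k /GRing.scale /=.
by rewrite -exprVn expr2; ring.
Qed.

(** The estimates below come from Taylor bounds, so derivatives are always
    obtained from an error that is quadratic in the increment. *)
Lemma is_derive_quad f x l C d : 0 < d ->
  (forall h, `|h| < d -> `|f (x + h) - f x - h * l| <= C * h ^+ 2) ->
  is_derive x 1 f l.
Proof.
move=> d0 H.
have L : (fun h => h^-1 *: ((f \o shift x) (h *: 1) - f x)) @ 0^' --> l.
  apply/cvgrPdist_le => e e0.
  have C0 : 0 <= C.
    have d2 : `|d / 2| < d by rewrite gtr0_norm ?divr_gt0//; lra.
    have := le_trans (normr_ge0 _) (H _ d2).
    by rewrite pmulr_lge0 // exprn_gt0 // divr_gt0.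
  have m0 : 0 < Num.min d (e / (C + 1)).
    by rewrite lt_min d0 divr_gt0 //; lra.
  near=> h.
  have h0 : h != 0 by near: h; exact: nbhs_dnbhs_neq.
  have : `|h| < Num.min d (e / (C + 1)) by near: h; exact: dnbhs0_lt.
  rewrite lt_min => /andP[hd he].
  rewrite /= /shift /= /GRing.scale /= mulr1 [h + x]addrC.
  have -> : l - h^-1 * (f (x + h) - f x) =
            - (h^-1 * (f (x + h) - f x - h * l)).
    by rewrite [in RHS]mulrBr mulKf //; ring.
  rewrite normrN normrM normfV ler_pdivrMl ?normr_gt0 //.
  apply: le_trans (H _ hd) _.
  rewrite -[h ^+ 2]real_normK ?num_real // expr2 mulrCA ler_wpM2l //.
  rewrite ltr_pdivlMr in he; last by lra.
  have := normr_ge0 h; nra.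
split.
- by apply/cvg_ex; exists l.
- by apply/cvg_lim.
Unshelve. all: by end_near. Qed.

Lemma near_is_derive f g x l : (\near x, f x = g x) ->
  is_derive x 1 g l -> is_derive x 1 f l.
Proof.
by move=> fg; apply: near_eq_is_derive; apply: filterS fg => y ->.
Qed.

Lemma nearR_dist (x : R) (P : R -> Prop) :
  (\near x, P x) <-> exists2 d : R, 0 < d & forall h, `|h| < d -> P (x + h).
Proof.
split=> [/nbhs_ballP[d /= d0 H]|[d d0 H]].
  exists d => // h hd; apply: H; rewrite /ball /= opprD addrA subrr add0r.
  by rewrite normrN.
apply/nbhs_ballP; exists d => // y /= xy.
have -> : y = x + (y - x) by rewrite addrC subrK.
by apply: H; rewrite distrC.
Qed.

Lemma cont_bounded f x : {for x, continuous f} ->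
  exists2 d : R, 0 < d & forall h, `|h| < d -> `|f (x + h)| <= `|f x| + 1.
Proof.
move=> /cvgrPdist_le /(_ 1 ltr01) /nearR_dist[d d0 H].
exists d => // h /H ?.
rewrite -[f (x + h)](subrK (f x)) addrC (le_trans (ler_normD _ _)) //.
by rewrite lerD2l distrC.
Qed.

Lemma seg_bounded f a b : continuous f ->
  exists C, forall x, a <= x <= b -> `|f x| <= C.
Proof.
move=> cf; have [ab|ba] := leP a b; last first.
  by exists 0 => x /andP[ax xb]; have := le_trans ax xb; rewrite leNgt ba.
have [|c _ Hc] := @EVT_max R (fun x => `|f x|) a b ab.
  apply: continuous_subspaceT => x.
  by apply: continuous_comp; [exact: cf|exact: norm_continuous].
by exists `|f c| => x xab; apply: Hc; rewrite in_itv.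
Qed.

Lemma mean_value_ineq f x h C : 
  (forall y, `|y - x| <= `|h| -> derivable f y 1 /\ `|derive1 f y| <= C) ->
  `|f (x + h) - f x| <= C * `|h|.
Proof.
move=> H; have [h0|h0] := leP 0 h.
  have [|||c] := @MVT_segment R f (derive1 f) x (x + h).
  - by rewrite lerDl.
  - move=> y; rewrite in_itv /= => /andP[y1 y2].
    rewrite derive1E; apply/derivableP; apply: (H y _).1.
    by rewrite !ger0_norm ?subr_ge0 ?(ltW y1)//; lra.
  - apply: derivable_within_continuous => y; rewrite in_itv /= => /andP[y1 y2].
    by apply: (H y _).1; rewrite !ger0_norm ?subr_ge0 //; lra.
  rewrite in_itv /= => /andP[c1 c2] ->.
  rewrite normrM; have -> : x + h - x = h by ring.
  by rewrite ler_wpM2r //; apply: (H c _).2; rewrite !ger0_norm ?subr_ge0 //; lra.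
have [|||c] := @MVT_segment R f (derive1 f) (x + h) x.
- by lra.
- move=> y; rewrite in_itv /= => /andP[y1 y2].
  rewrite derive1E; apply/derivableP; apply: (H y _).1.
  by rewrite !ltr0_norm; lra.
- apply: derivable_within_continuous => y; rewrite in_itv /= => /andP[y1 y2].
  by apply: (H y _).1; rewrite ler0_norm ?ltr0_norm; lra.
rewrite in_itv /= => /andP[c1 c2] E.
rewrite distrC E normrM; have -> : x - (x + h) = - h by ring.
rewrite normrN ler_wpM2r //; apply: (H c _).2.
by rewrite ler0_norm ?ltr0_norm; lra.
Qed.

End SmoothCalculus.

(** * Smooth curves with prescribed germs *)

Section Bump.
Variable R : realType.
Implicit Types (f g psi : R -> R) (x t y : R) (A : nat -> R).

(** Raise y / k <= exp (y / k) to the power k. *)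
Lemma pow_expN_bounded k : exists C, forall y, 0 <= y -> y ^+ k * expR (- y) <= C.
Proof.
exists (k%:R ^+ k) => y y0; rewrite expRN ler_pdivrMr ?expR_gt0 //.
case: k => [|k]; first by rewrite expr0 mul1r -expR0 ler_expR.
have k0 : 0 < k.+1%:R :> R by rewrite ltr0n.
set z := y / k.+1%:R.
have -> : y = z * k.+1%:R by rewrite divfK ?gt_eqF.
rewrite expRM_natr exprMn mulrC ler_pM2l ?exprn_gt0 //.
apply: lerXn2r; rewrite ?nnegrE ?expR_ge0 ?divr_ge0 //.
have := @expR_ge1Dx R z; set E := expR z; lra.
Qed.

(** The functions x^-j exp (-1/x), extended by 0: the powers of 1/x make the
    family closed under differentiation. *)
Definition texp j x : R := if 0 < x then x^-1 ^+ j * expR (- x^-1) else 0.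

Lemma texp_ge0 j x : 0 <= texp j x.
Proof.
by rewrite /texp; case: ifP => // x0; rewrite mulr_ge0 ?expR_ge0 ?exprn_ge0 ?invr_ge0 ?ltW.
Qed.

Lemma texp_quad j : exists C, forall x, texp j x <= C * x ^+ 2.
Proof.
have [C HC] := pow_expN_bounded j.+2; exists C => x; rewrite /texp.
have C0 : 0 <= C by apply: le_trans (HC 0 (lexx _)); rewrite expr0n mul0r.
case: ifP => x0; last by rewrite mulr_ge0 ?sqr_ge0.
have := HC x^-1; rewrite invr_ge0 => /(_ (ltW x0)).
rewrite -addn2 exprD -mulrA [_ ^+ 2 * _]mulrC mulrA [x^-1 ^+ 2]exprVn.
by rewrite ler_pdivrMr ?exprn_gt0.
Qed.

Lemma is_derive_inv x : x != 0 -> is_derive x 1 (fun x : R => x^-1) (- (x^-1 ^+ 2)).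
Proof.
move=> x0; have := @is_deriveV R id x 1 1 x0 (is_derive_id _ _).
by rewrite /GRing.scale /= mulr1 exprVn.
Qed.

Lemma is_derive_comp_inv f t d : 0 < t -> is_derive t^-1 1 f d ->
  is_derive t 1 (f \o (fun x => x^-1)) (- (t^-1 ^+ 2) * d).
Proof.
move=> t0 H; apply: is_derive_comp1 => //.
by apply: is_derive_inv; rewrite gt_eqF.
Qed.

Lemma is_deriveM1 f g t df dg :
  is_derive t 1 f df -> is_derive t 1 g dg ->
  is_derive t 1 (fun x => f x * g x) (f t * dg + g t * df).
Proof. by move=> H1 H2; exact: (is_deriveM H1 H2). Qed.

Lemma is_deriveX1 j y : is_derive y 1 (fun y : R => y ^+ j) (j%:R * y ^+ j.-1).
Proof. by rewrite -[_ * _]exp_derive1 derive1E; apply/derivableP/exprn_derivable. Qed.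

Lemma is_derive_powexpN j y : is_derive y 1 (fun y : R => y ^+ j * expR (- y))
  (j%:R * y ^+ j.-1 * expR (- y) - y ^+ j * expR (- y)).
Proof.
apply: is_derive_eq.
  apply: is_deriveM1; first exact: is_deriveX1.
rewrite /=; ring.
Qed.

Lemma texp_derive j x :
  is_derive x 1 (texp j) (texp j.+2 x - j%:R * texp j.+1 x).
Proof.
have [x0|x0|<-] := ltgtP 0 x.
- apply: (@near_is_derive _ _ ((fun y => y ^+ j * expR (- y)) \o (fun x => x^-1))).
    near=> y; rewrite /texp ifT //; near: y; exact: lt_nbhsr.
  apply: is_derive_eq.
    apply: is_derive_comp_inv => //; exact: is_derive_powexpN.
  rewrite /texp x0 /GRing.scale /=; case: j => [|j]; rewrite /= ?exprS; ring.
- apply: (@near_is_derive _ _ (fun=> 0)).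
    near=> y; rewrite /texp ltNge ifF //; apply/negbTE; rewrite negbK ltW //.
    near: y; exact: lt_nbhsl.
  by rewrite /texp ltNge ltW //= mulr0 subrr; exact: is_derive_cst.
- have E k : texp k 0 = 0 by rewrite /texp ltxx.
  rewrite !E mulr0 subrr.
  have [C HC] := texp_quad j.
  apply: (@is_derive_quad _ _ _ _ C 1) => // h _.
  rewrite add0r mulr0 subr0 E subr0.
  by rewrite ger0_norm ?texp_ge0.
Unshelve. all: by end_near. Qed.

Lemma texp_smooth j : smooth (texp j).
Proof.
apply/ndiffP => n; elim: n j => //= n IHn j; split=> [x|].
  by have [] := texp_derive j x.
rewrite (_ : derive1 _ = texp j.+2 \+ ((fun=> - j%:R) \* texp j.+1)).
  apply: ndiffD => //; apply: ndiffM => //.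
  by apply/smooth_ndiff/smooth_cst.
by apply/funext => x; rewrite (is_derive1E (texp_derive j x)) /= mulNr.
Qed.

Lemma smooth_affine a b : smooth (fun x : R => a * x + b).
Proof. exact: (smoothD (smoothZ a (@smooth_id R)) (@smooth_cst _ b)). Qed.

Definition sstep x : R := texp 0 x / (texp 0 x + texp 0 (1 - x)).

Lemma texp0_gt0 x : 0 < x -> 0 < texp 0 x.
Proof. by move=> x0; rewrite /texp x0 expr0 mul1r expR_gt0. Qed.

Lemma sstep_smooth : smooth sstep.
Proof.
apply: (smoothM (texp_smooth 0)); apply: smoothV.
  apply: (smoothD (texp_smooth 0)).
  rewrite (_ : (fun x => _) = texp 0 \o (fun x => -1 * x + 1)).
    by apply: smooth_comp; [exact: texp_smooth|exact: smooth_affine].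
  by apply/funext => x /=; congr texp; ring.
move=> x; rewrite gt_eqF //.
have [x0|x0] := ltP 0 x.
  by rewrite ltr_pwDl ?texp0_gt0 ?texp_ge0.
by rewrite ltr_wpDl ?texp_ge0 ?texp0_gt0 //; lra.
Qed.

Lemma sstep0 x : x <= 0 -> sstep x = 0.
Proof. by rewrite leNgt => /negbTE x0; rewrite /sstep /texp x0 mul0r. Qed.

Lemma sstep1 x : 1 <= x -> sstep x = 1.
Proof.
move=> x1; have x0 : 0 < x by lra.
rewrite /sstep [texp 0 (1 - x)]/texp ifF; last by apply/negbTE; rewrite -leNgt; lra.
by rewrite addr0 divff // gt_eqF ?texp0_gt0.
Qed.

Definition bump x : R := sstep (8 * x - 2) * sstep (- 8 * x + 6).

Lemma bump_smooth : smooth bump.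
Proof.
apply: (@smoothM _ (sstep \o (fun x => 8 * x - 2)) (sstep \o (fun x => -8 * x + 6)));
  by apply: smooth_comp; [exact: sstep_smooth|exact: smooth_affine].
Qed.

(** Support in the middle half of the unit interval: the margins keep the
    pieces that are glued below apart. *)
Definition supp14 psi := forall x, x < 1 / 4 \/ 3 / 4 < x -> psi x = 0.

Lemma bump_supp : supp14 bump.
Proof.
move=> x [x1|x1]; rewrite /bump.
  by rewrite [sstep (8 * _ - _)]sstep0 ?mul0r //; lra.
by rewrite [sstep (- 8 * _ + _)]sstep0 ?mulr0 //; lra.
Qed.

Lemma bump1 x : 3 / 8 <= x <= 5 / 8 -> bump x = 1.
Proof. by move=> /andP[x1 x2]; rewrite /bump !sstep1 ?mulr1 //; lra. Qed.

Lemma supp14_derive psi : smooth psi -> supp14 psi -> supp14 (derive1 psi).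
Proof.
move=> sp H x Hx; apply: is_derive1E; apply: (@near_is_derive _ _ (fun=> 0)).
  case: Hx => Hx; near=> y; apply: H; [left|right]; near: y.
    exact: lt_nbhsl.
  exact: lt_nbhsr.
Unshelve. all: by end_near. Qed.

(** On the interval 1/(n+1) < t <= 1/n the value is A_n t^-j psi (1/t - n);
    the powers of 1/t make the family closed under differentiation. *)
Definition glue A psi j t : R :=
  let n := Num.trunc t^-1 in
  if 0 < t then A n * t^-1 ^+ j * psi (t^-1 - n%:R) else 0.

(** Where 1/t is an integer the integer part jumps, but there psi vanishes on
    both sides. *)
Lemma glue_local A psi j t : supp14 psi -> 0 < t ->
  let n := Num.trunc t^-1 in
  \near t, glue A psi j t = A n * (t^-1 ^+ j * psi (t^-1 - n%:R)).
Proof.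
move=> H t0 n.
have /andP[n1 n2] : n%:R <= t^-1 < n.+1%:R.
  by apply: truncn_itv; rewrite invr_ge0 ltW.
have ci : (fun s : R => s^-1) @ t --> t^-1 by apply: inv_continuous; rewrite gt_eqF.
near=> s.
have s0 : 0 < s by near: s; exact: lt_nbhsr.
have sN0 : 0 <= s^-1 by rewrite invr_ge0 ltW.
have s1 : s^-1 < n.+1%:R by near: s; exact: (cvgr_lt _ ci).
have s2 : n%:R - 1 / 4 < s^-1.
  by near: s; apply: (cvgr_gt _ ci); lra.
rewrite /glue s0 -mulrA; have [ns|sn] := leP n%:R s^-1.
  by rewrite (@truncn_def _ _ n) // ns.
rewrite [psi (_ - n%:R)]H; last by left; lra.
have n0 : (0 < n)%N.
  rewrite lt0n; apply/eqP => n0; rewrite n0 in sn.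
  by have := le_lt_trans sN0 sn; rewrite ltxx.
have En : n%:R = n.-1%:R + 1 :> R by rewrite natr1 prednK.
rewrite (@truncn_def _ _ n.-1); last by rewrite -natr1 -En sn andbT; lra.
by rewrite [psi _]H ?mulr0 //; right; lra.
Unshelve. all: by end_near. Qed.

(** The exponential decay of A beats all powers of 1/t, so that the glued
    function is flat at 0. *)
Lemma glue_bound A psi j C : smooth psi -> supp14 psi ->
  (forall n, `|A n| <= C * expR (- n%:R)) ->
  exists D, forall t, `|glue A psi j t| <= D * t ^+ 2.
Proof.
move=> sp H HA.
have [B HB] : exists B, forall x, `|psi x| <= B.
  have [B HB] := seg_bounded (1 / 4) (3 / 4) (smooth_continuous sp).
  exists (Num.max B 0) => x; rewrite le_max.
  have [x1|x1] := ltP x (1 / 4); first by rewrite H ?normr0 ?lexx ?orbT //; left.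
  have [x2|x2] := ltP (3 / 4) x; first by rewrite H ?normr0 ?lexx ?orbT //; right.
  by rewrite HB // x1.
have B0 : 0 <= B := le_trans (normr_ge0 _) (HB 0).
have C0 : 0 <= C.
  by have := le_trans (normr_ge0 _) (HA 0%N); rewrite pmulr_lge0 ?expR_gt0.
have [D HD] := texp_quad j.
exists (C * expR 1 * B * D) => t.
rewrite -mulrA; apply: le_trans (_ : C * expR 1 * B * texp j t <= _); last first.
  by rewrite ler_wpM2l // !mulr_ge0 ?expR_ge0.
rewrite /glue /texp; case: ifP => t0; last by rewrite normr0 mulr0.
set n := Num.trunc _.
have /andP[n1 n2] : n%:R <= t^-1 < n.+1%:R.
  by apply: truncn_itv; rewrite invr_ge0 ltW.
rewrite !normrM (ger0_norm (exprn_ge0 _ _)) ?invr_ge0 ?(ltW t0) //.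
have -> : C * expR 1 * B * (t^-1 ^+ j * expR (- t^-1)) =
  (C * expR (1 - t^-1)) * t^-1 ^+ j * B by rewrite expRD; ring.
rewrite ler_pM ?mulr_ge0 ?exprn_ge0 ?invr_ge0 ?(ltW t0) //.
rewrite ler_wpM2r ?exprn_ge0 ?invr_ge0 ?(ltW t0) //.
apply: le_trans (HA n) _; rewrite ler_wpM2l // ler_expR.
by rewrite -natr1 in n2; lra.
Qed.

Lemma glue_derive A psi j C t : smooth psi -> supp14 psi ->
  (forall n, `|A n| <= C * expR (- n%:R)) ->
  is_derive t 1 (glue A psi j)
    (- j%:R * glue A psi j.+1 t - glue A (derive1 psi) j.+2 t).
Proof.
move=> sp H HA.
have [t0|t0|<-] := ltgtP 0 t.
- have := glue_local A j t H t0; cbv zeta; set n := Num.trunc _ => L.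
  apply: (@near_is_derive _ _ (fun s => A n * (s^-1 ^+ j * psi (s^-1 - n%:R))) _ _ L).
  rewrite [X in is_derive _ _ X](_ : _ =
    (fun y => A n * (y ^+ j * psi (y - n%:R))) \o (fun x => x^-1)) //.
  have sp' : is_derive t^-1 1 (fun y => psi (y - n%:R))
      (1 * derive1 psi (t^-1 - n%:R)).
    apply: (@is_derive_comp1 _ psi (fun y => y - n%:R)).
      exact: smooth_is_derive.
    by apply: is_derive_eq; rewrite subr0.
  apply: is_derive_eq.
    apply: is_derive_comp_inv => //.
    apply: is_deriveM1; apply: is_deriveM1; exact: is_deriveX1.
  rewrite /glue t0 -/n /GRing.scale /=; clear; case: j => [|j]; rewrite /= ?exprS; ring.
- apply: (@near_is_derive _ _ (fun=> 0)).
    near=> y; rewrite /glue ltNge ifF //; apply/negbTE; rewrite negbK ltW //.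
    near: y; exact: lt_nbhsl.
  by rewrite /glue ltNge ltW //= mulr0 subrr; exact: is_derive_cst.
- have E psi' k : glue A psi' k 0 = 0 by rewrite /glue ltxx.
  rewrite !E mulr0 subrr.
  have [D HD] := glue_bound _ j _ sp H HA.
  apply: (@is_derive_quad _ _ _ _ D 1) => // h _.
  rewrite add0r mulr0 subr0 E subr0.
  exact: HD.
Unshelve. all: by end_near. Qed.

Lemma glue_smooth A psi j C : smooth psi -> supp14 psi ->
  (forall n, `|A n| <= C * expR (- n%:R)) -> smooth (glue A psi j).
Proof.
move=> sp H HA; apply/ndiffP => n; elim: n psi j sp H => //= n IHn psi j sp H.
have D t := glue_derive _ j _ t sp H HA.
split=> [x|]; first by have [] := D x.
rewrite (_ : derive1 _ = (fun=> - j%:R) \* glue A psi j.+1 \+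
   ((fun=> -1) \* glue A (derive1 psi) j.+2)).
  have Dc a : ndiff n (fun=> a : R) by apply/smooth_ndiff/smooth_cst.
  apply: ndiffD; (apply: ndiffM; first exact: Dc); apply: IHn; [exact: sp|exact: H|..].
    exact: smooth_derive1.
  exact: supp14_derive.
by apply/funext => x; rewrite (is_derive1E (D x)) /= mulN1r.
Qed.

(** The midpoints of the cells, around which the bump function is constantly
    1. *)
Definition stime n : R := (n%:R + 1 / 2)^-1.

Lemma stime_gt0 n : 0 < stime n.
Proof. by rewrite invr_gt0; have := ler0n R n; lra. Qed.

Lemma glue_stime A n : \forall t \near stime n, glue A bump 0 t = A n.
Proof.
have ci : (fun s : R => s^-1) @ stime n --> (n%:R + 1 / 2 : R).
  rewrite -[n%:R + _]invrK; apply: inv_continuous; rewrite gt_eqF ?stime_gt0 //.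
near=> s.
have s0 : 0 < s by near: s; apply: lt_nbhsr; exact: stime_gt0.
have s1 : s^-1 < n%:R + 5 / 8 by near: s; apply: (cvgr_lt _ ci); lra.
have s2 : n%:R + 3 / 8 < s^-1 by near: s; apply: (cvgr_gt _ ci); lra.
rewrite /glue s0 (@truncn_def _ _ n).
  by rewrite expr0 mulr1 bump1 ?mulr1 //; lra.
by rewrite -natr1; lra.
Unshelve. all: by end_near. Qed.

(** The special curve lemma: rapidly decreasing affine germs are interpolated
    by one smooth curve.  It produces contradictions later on: bad behaviour
    at infinitely many points is put on a single curve. *)
Lemma special_curve (a b : nat -> R) :
  (forall n, `|a n| <= expR (- n%:R)) -> (forall n, `|b n| <= expR (- n%:R)) ->
  exists2 c, smooth c &
    forall n, \forall t \near stime n, c t = a n + b n * (t - stime n).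
Proof.
move=> Ha Hb.
pose A n := a n - b n * stime n.
have HA n : `|A n| <= 3 * expR (- n%:R).
  apply: le_trans (ler_normB _ _) _; rewrite normrM.
  have : `|stime n| <= 2.
    rewrite ger0_norm ?(ltW (stime_gt0 n)) // /stime.
    have -> : 2 = (1 / 2)^-1 :> R by rewrite invf_div divr1.
    have := ler0n R n => n0.
    by rewrite lef_pV2 ?posrE; lra.
  have := Ha n; have := Hb n; have := normr_ge0 (b n); have := normr_ge0 (stime n).
  nra.
exists (fun t => glue A bump 0 t + t * glue b bump 0 t).
  apply: (smoothD (glue_smooth _ 0 _ bump_smooth bump_supp HA)).
  apply: (smoothM (@smooth_id R)); apply: (@glue_smooth _ _ _ 1) => //.
  - exact: bump_smooth.
  - exact: bump_supp.
  - by move=> n; rewrite mul1r.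
move=> n; near=> t.
have -> : glue A bump 0 t = A n by near: t; exact: glue_stime.
have -> : glue b bump 0 t = b n by near: t; exact: glue_stime.
by rewrite /A; ring.
Unshelve. all: by end_near. Qed.

End Bump.

Unset Strict Implicit.

(** * Functions of two variables that are smooth along curves *)

Section Boman.
Variable R : realType.
Implicit Types (f g : R -> R) (x t u : R) (F : R -> R -> R).

(** Smoothness in the sense of curves, the form in which it is available on
    products of Frölicher spaces; joint continuity follows, see
    [BS2_continuous]. *)
Definition BS2 F := forall a b, smooth a -> smooth b -> smooth (fun s => F (a s) (b s)).

Lemma near_derive1n m f g x : (\forall t \near x, f t = g t) ->
  \forall t \near x, derive1n m f t = derive1n m g t.
Proof.
elim: m f g => // m IHm f g fg; rewrite !derive1Sn; apply: IHm.
have /near_join := fg; apply: filterS => y H.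
by rewrite !derive1E; apply: near_eq_derive.
Qed.

Lemma derive1n_affine m f b c : smooth f ->
  derive1n m (fun s => f (b * s + c)) = (fun s => b ^+ m * derive1n m f (b * s + c)).
Proof.
move=> sf; elim: m => [|m IHm].
  by rewrite !derive1n0; apply/funext => s; rewrite expr0 mul1r.
rewrite derive1nS IHm; apply/funext => s; apply: is_derive1E.
have D : is_derive s 1 (derive1n m f \o (fun s => b * s + c))
    (b * derive1n m.+1 f (b * s + c)).
  apply: is_derive_comp1.
    by rewrite derive1nS; apply: smooth_is_derive; apply: smooth_derive1n.
  by apply: is_derive_eq; rewrite /GRing.scale /=; ring.
by apply: is_derive_eq; rewrite /GRing.scale /= exprS; ring.
Qed.

Lemma BS2_smooth F u : BS2 F -> smooth (F u).
Proof. by move=> H; exact: (H (fun=> u) id (@smooth_cst _ u) (@smooth_id R)). Qed.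

Lemma BS2_smoothl F t : BS2 F -> smooth (F^~ t).
Proof. by move=> H; exact: (H id (fun=> t) (@smooth_id R) (@smooth_cst _ t)). Qed.

Lemma BS2_shift F u0 t0 : BS2 F -> BS2 (fun u t => F (u0 + u) (t0 + t)).
Proof.
move=> H c d sc second_diff.
exact: H (smoothD (@smooth_cst _ u0) sc) (smoothD (@smooth_cst _ t0) second_diff).
Qed.

(** Otherwise there are points (u_n, t_n) that tend rapidly to 0 and at which
    the derivative exceeds n exp(n)^m.  A special curve that passes through
    these points, moving in the second variable at speed exp(-n), gives a
    smooth function of one variable whose m-th derivative is unbounded near 0. *)
Lemma BS2_lbound0 F m : BS2 F -> exists2 d : R, 0 < d &
  exists C, forall u t, `|u| < d -> `|t| < d -> `|derive1n m (F u) t| <= C.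
Proof.
move=> H; apply: contrapT => N.
have /choice[p Hp] : forall n : nat, exists p : R * R,
    [/\ `|p.1| < expR (- n%:R), `|p.2| < expR (- n%:R) &
        n%:R * expR n%:R ^+ m < `|derive1n m (F p.1) p.2|].
  move=> n; apply: contrapT => N'; apply: N; exists (expR (- n%:R)).
    exact: expR_gt0.
  exists (n%:R * expR n%:R ^+ m) => u t Hu Ht; rewrite leNgt; apply/negP => L.
  by apply: N'; exists (u, t).
have [||a sa Ha] := @special_curve R (fun n => (p n).1) (fun=> 0).
- by move=> n; apply: ltW; have [] := Hp n.
- by move=> n; rewrite normr0 expR_ge0.
have [||b sb Hb] := @special_curve R (fun n => (p n).2) (fun n => expR (- n%:R)).
- by move=> n; apply: ltW; have [] := Hp n.
- by move=> n; rewrite ger0_norm ?expR_ge0.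
have sf := H _ _ sa sb; set f := fun s => F (a s) (b s) in sf.
have cf : {for 0, continuous (derive1n m f)}.
  exact: smooth_continuous (smooth_derive1n m sf) 0.
have [d d0 Hd] := cont_bounded cf.
set C := `|_| + 1 in Hd.
pose n := (Num.bound (C + d^-1)).
have C0 : 0 <= C by rewrite /C addr_ge0.
have dV : 0 < d^-1 by rewrite invr_gt0.
have Cn : C + d^-1 < n%:R.
  by have := @archi_boundP _ (C + d^-1); apply; rewrite addr_ge0 // ltW.
have sn : `|stime R n| < d.
  rewrite ger0_norm ?(ltW (stime_gt0 R n)) // /stime -[d]invrK ltf_pV2 ?posrE //.
  by have := ler0n R n; lra.
have := Hd _ sn; rewrite add0r.
have E : derive1n m f (stime R n) =
    expR (- n%:R) ^+ m * derive1n m (F (p n).1) (p n).2.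
  pose g s := F (p n).1 (expR (- n%:R) * s + ((p n).2 - expR (- n%:R) * stime R n)).
  have En : \forall s \near stime R n, f s = g s.
    near=> s; rewrite /f /g.
    have -> : a s = (p n).1 + 0 * (s - stime R n) by near: s; exact: Ha.
    have -> : b s = (p n).2 + expR (- n%:R) * (s - stime R n) by near: s; exact: Hb.
    by rewrite mul0r addr0; congr (F _ _); ring.
  rewrite (nbhs_singleton (@near_derive1n m f g _ En)) /g derive1n_affine; last exact: BS2_smooth.
  by rewrite addrC subrK.
have [_ _ L] := Hp n.
rewrite E normrM normrX ger0_norm ?expR_ge0 // => L2.
have : n%:R < expR (- n%:R) ^+ m * `|derive1n m (F (p n).1) (p n).2|.
  by rewrite expRN exprVn mulrC ltr_pdivlMr ?exprn_gt0 ?expR_gt0.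
by lra.
Unshelve. all: by end_near. Qed.

Lemma BS2_lbound F m u0 t0 : BS2 F -> exists2 d : R, 0 < d &
  exists C, forall u t, `|u| < d -> `|t| < d ->
    `|derive1n m (F (u0 + u)) (t0 + t)| <= C.
Proof.
move=> H; have [d d0 [C HC]] := BS2_lbound0 m (@BS2_shift F u0 t0 H).
exists d => //; exists C => u t Hu Ht; have := HC u t Hu Ht.
have -> : (fun t1 => F (u0 + u) (t0 + t1)) = (fun t1 => F (u0 + u) (1 * t1 + t0)).
  by apply/funext => s; congr (F _ _); ring.
rewrite derive1n_affine; last exact: BS2_smooth.
by rewrite expr1n !mul1r [t + t0]addrC.
Qed.

Lemma is_derive_bigsum n (G : 'I_n -> R -> R) (d : 'I_n -> R) (y : R) :
  (forall i, is_derive y 1 (G i) (d i)) ->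
  is_derive y 1 (fun h => \sum_(i < n) G i h) (\sum_(i < n) d i).
Proof.
move=> H; have := @is_derive_sum _ _ _ n G y 1 d H.
by rewrite (_ : \sum_(i < n) G i = (fun h => \sum_(i < n) G i h)) // fct_sumE.
Qed.

Lemma is_derive_monom (a b : R) l (y : R) :
  is_derive y 1 (fun h => a * h ^+ l / b) (a * (l%:R * y ^+ l.-1) / b).
Proof.
have D := @is_deriveX1 R l y.
have := @is_deriveM1 _ (fun=> a) _ _ _ _ (is_derive_cst a y 1) D.
move=> /(@is_deriveM1 _ _ (fun=> b^-1) _ _ _) /(_ (is_derive_cst b^-1 y 1)).
by congr (is_derive _ _ _ _); ring.
Qed.

Lemma taylor_bound M f (C d : R) : smooth f ->
  (forall t, `|t| < d -> `|derive1n M f t| <= C) ->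
  forall h, `|h| < d ->
    `|f h - \sum_(l < M) derive1n l f 0 * h ^+ l / l`!%:R| <= C * `|h| ^+ M.
Proof.
elim: M f => [|M IHM] f sf HC h hd.
  by rewrite big_ord0 subr0 expr0 mulr1; exact: HC.
have C0 : 0 <= C.
  by apply: le_trans (HC h hd).
pose r h := f h - \sum_(l < M.+1) derive1n l f 0 * h ^+ l / l`!%:R.
have r0 : r 0 = 0.
  rewrite /r big_ord_recl /= big1 ?addr0.
    by rewrite expr0 mulr1 fact0 divr1 subrr.
  by move=> i _; rewrite /fintype.bump add1n exprS mul0r mulr0 mul0r.
pose r' h : R := derive1 f h - \sum_(l < M) derive1n l (derive1 f) 0 * h ^+ l / l`!%:R.
have D (y : R) : is_derive y 1 r (r' y).
  rewrite /r /r'.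
  have D1 : is_derive y 1 f (derive1 f y) by exact: smooth_is_derive.
  have D2 : is_derive y 1 (fun h => \sum_(l < M.+1) derive1n l f 0 * h ^+ l / l`!%:R)
      (\sum_(l < M) derive1n l (derive1 f) 0 * y ^+ l / l`!%:R).
    under eq_fun do rewrite big_ord_recl.
    have D3 (l : 'I_M) : is_derive y 1
        (fun h => derive1n (lift ord0 l) f 0 * h ^+ (lift ord0 l) / (lift ord0 l)`!%:R)
        (derive1n l (derive1 f) 0 * y ^+ l / l`!%:R).
      have := is_derive_monom (derive1n (lift ord0 l) f 0) (lift ord0 l)`!%:R (lift ord0 l) y.
      congr (is_derive _ _ _ _).
      have -> : lift ord0 l = l.+1 :> nat by [].
      rewrite factS natrM derive1Sn [in LHS]succnK; field.
      by rewrite nat1r !pnatr_eq0 -lt0n fact_gt0.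
    have D4 := is_derive_bigsum D3.
    have D5 := is_derive_monom (derive1n 0 f 0) (0`!)%:R 0 y.
    have := is_deriveD D5 D4; congr (is_derive _ _ _ _).
    by rewrite mul0r mulr0 mul0r add0r.
  exact: (is_deriveB D1 D2).
have := @mean_value_ineq R r 0 h (C * `|h| ^+ M).
rewrite add0r r0 subr0 exprSr mulrA; apply=> y; rewrite subr0 => yh.
split; first by have [] := D y.
rewrite (is_derive1E (D y)); apply: le_trans (IHM _ _ _ y _) _.
- exact: smooth_derive1.
- by move=> t td; rewrite -derive1Sn; exact: HC.
- exact: le_lt_trans yh hd.
- by rewrite ler_wpM2l // lerXn2r ?nnegrE.
Qed.

(** Invertibility of the Vandermonde matrix of the nodes 0, ..., N - 1. *)
Lemma weights_exist N m : (m < N)%N -> exists w : 'I_N -> R,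
  forall l : nat, (l < N)%N -> \sum_(i < N) w i * i%:R ^+ l = (l == m)%:R * m`!%:R.
Proof.
move=> mN; pose a : 'rV[R]_N := \row_i (i : nat)%:R.
pose V := Vandermonde N a.
have Vu : V \in unitmx.
  rewrite unitmxE det_Vandermonde unitfE prodf_seq_neq0.
  apply/allP => i _ /=; rewrite prodf_seq_neq0; apply/allP => j _ /=.
  apply/implyP => ij; rewrite !mxE subr_eq0 eqr_nat.
  by rewrite gtn_eqF.
pose w := invmx V *m \col_(l < N) ((l == m :> nat)%:R * m`!%:R) : 'cV[R]_N.
exists (fun i => w i 0) => l lN.
have : V *m w = \col_(l < N) ((l == m :> nat)%:R * m`!%:R) by rewrite mulKVmx.
move=> /matrixP /(_ (Ordinal lN) 0); rewrite !mxE /= => <-.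
by apply: eq_bigr => i _; rewrite !mxE mulrC.
Qed.

(** The coefficients are shown to vanish one at a time, dividing by k at each
    step. *)
Lemma poly_small n (c : nat -> R) :
  (forall e : R, 0 < e -> exists2 d : R, 0 < d & forall k : R, k != 0 -> `|k| < d ->
     `|\sum_(l < n.+1) c l * k ^+ l| <= e * `|k| ^+ n) ->
  forall l, (l <= n)%N -> c l = 0.
Proof.
elim: n c => [|n IHn] c H.
  case=> // _; apply/eqP/contraT => c0.
  have c1 : 0 < `|c 0%N| by rewrite normr_gt0.
  have [|d d0 Hd] := H (`|c 0%N| / 2); first by rewrite divr_gt0.
  have d2 : 0 < d / 2 by rewrite divr_gt0.
  have := Hd (d / 2) (lt0r_neq0 d2); rewrite (gtr0_norm d2).
  rewrite big_ord_recl big_ord0 !expr0 !mulr1 addr0.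
  have -> : d / 2 < d by lra.
  by move=> /(_ isT); lra.
have c0 : c 0%N = 0.
  apply/eqP/contraT => c0.
  have c1 : 0 < `|c 0%N| by rewrite normr_gt0.
  have [d d0 Hd] := H 1 ltr01.
  pose S : R := \sum_(l < n.+1) `|c l.+1|.
  have S0 : 0 <= S by rewrite sumr_ge0.
  pose k := Num.min (Num.min (d / 2) 1) (`|c 0%N| / 2 / (S + 2)).
  have k0 : 0 < k by rewrite !lt_min ltr01 !divr_gt0 //; lra.
  have kd : k < d by rewrite /k !gt_min; apply/orP; left; apply/orP; left; lra.
  have k1 : k <= 1 by rewrite /k !ge_min lexx !orbT.
  have kc : k * (S + 2) <= `|c 0%N| / 2.
    by rewrite -ler_pdivlMr ?ge_min ?lexx ?orbT //; lra.
  have := Hd k (lt0r_neq0 k0); rewrite (gtr0_norm k0) => /(_ kd).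
  rewrite big_ord_recl expr0 mulr1 mul1r; set T := \sum_(i < _) _ => L.
  have kn n' : k ^+ n' <= 1 by apply: exprn_ile1 => //; exact: ltW.
  have L1 : `|T| <= S * k.
    apply: le_trans (ler_norm_sum _ _ _) _; rewrite /S mulr_suml.
    apply: ler_sum => i _; rewrite normrM.
    have -> : lift ord0 i = i.+1 :> nat by [].
    by rewrite ler_wpM2l // normrX gtr0_norm // exprS ler_piMr ?(ltW k0).
  have L2 : k ^+ n.+1 <= k by rewrite exprS ler_piMr ?(ltW k0).
  have : `|c 0%N| <= k + S * k.
    have -> : c 0%N = (c 0%N + T) - T by rewrite addrK.
    apply: le_trans (ler_normB _ _) _; apply: lerD => //.
    exact: le_trans L _.
  lra.
case=> [//|l] ln; apply: (IHn (fun l => c l.+1)) => // e e0.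
have [d d0 Hd] := H e e0; exists d => // k k0 kd.
have := Hd k k0 kd; rewrite big_ord_recl c0 mul0r add0r.
rewrite (_ : \sum_(i < _) _ = k * \sum_(l < n.+1) c l.+1 * k ^+ l).
  by rewrite normrM exprS mulrCA ler_pM2l ?normr_gt0.
rewrite mulr_sumr; apply: eq_bigr => i _.
by rewrite [lift ord0 i : nat]/= /fintype.bump leq0n add1n exprS; ring.
Qed.

(** It is enough to study derivatives in the second variable along the first
    axis, because the class of F under consideration is stable under
    translation along curves. *)
Definition phi m F u := derive1n m (F u) 0.

Lemma BS2_line F (c : R) : BS2 F -> BS2 (fun u t => F (u + t) (c * t)).
Proof.
by move=> H a b sa sb; exact: (H _ _ (smoothD sa sb) (smoothZ c sb)).
Qed.

(** Taylor expansion in the second variable with the remainder bound of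
    [BS2_lbound0]; the moments of the weights remove all terms up to order m +
    1 but the m-th. *)
Lemma phi_diffquot F m (w : 'I_m.+2 -> R) : BS2 F ->
  (forall l : nat, (l < m.+2)%N -> \sum_(i < m.+2) w i * i%:R ^+ l = (l == m)%:R * m`!%:R) ->
  exists2 d : R, 0 < d & exists C : R, forall u h : R, `|u| < d -> `|h| < d ->
    `|\sum_(i < m.+2) w i * F u (i%:R * h) - phi m F u * h ^+ m| <= C * `|h| ^+ m.+2.
Proof.
move=> H Hw; have [d d0 [C HC]] := BS2_lbound0 m.+2 H.
have m2 : 0 < m.+2%:R :> R by rewrite ltr0n.
exists (d / m.+2%:R); first by rewrite divr_gt0.
exists (\sum_(i < m.+2) `|w i| * (C * i%:R ^+ m.+2)) => u h Hu Hh.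
have ih (i : 'I_m.+2) : `|i%:R * h| < d.
  rewrite normrM ger0_norm ?ler0n //.
  rewrite -(divfK (lt0r_neq0 m2) d) [ltRHS]mulrC.
  apply: le_lt_trans (_ : m.+2%:R * `|h| < _); last by rewrite ltr_pM2l.
  by rewrite ler_wpM2r // ler_nat ltnW.
have ud : `|u| < d.
  apply: lt_le_trans Hu _; rewrite ler_pdivrMr // ler_peMr ?(ltW d0) //.
  by rewrite ler1n.
have E : phi m F u * h ^+ m = \sum_(i < m.+2)
    w i * \sum_(l < m.+2) derive1n l (F u) 0 * (i%:R * h) ^+ l / l`!%:R.
  under eq_bigr do rewrite mulr_sumr.
  rewrite exchange_big /=.
  transitivity (\sum_(l < m.+2) derive1n l (F u) 0 * h ^+ l / l`!%:R * ((l == m :> nat)%:R * m`!%:R)); last first.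
    by apply: eq_bigr => l _; rewrite -Hw // mulr_sumr; apply: eq_bigr => i _; rewrite exprMn; ring.
  pose lm : 'I_m.+2 := widen_ord (leqnSn _) ord_max.
  rewrite (bigD1 lm) //= eqxx mul1r big1 => [|l lmN].
    rewrite addr0 divfK ?pnatr_eq0 -?lt0n ?fact_gt0 //.
  rewrite (negbTE (_ : nat_of_ord l != m)) ?mul0r ?mulr0 //.
rewrite E -sumrB; apply: le_trans (ler_norm_sum _ _ _) _.
rewrite mulr_suml; apply: ler_sum => i _.
rewrite -mulrBr normrM -[X in _ <= X]mulrA ler_wpM2l //.
have HC' t : `|t| < d -> `|derive1n m.+2 (F u) t| <= C by exact: HC.
apply: le_trans (taylor_bound (@BS2_smooth F u H) HC' (ih i)) _.
by rewrite normrM exprMn ger0_norm ?ler0n // mulrA.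
Qed.

(** On the diagonal h = u the weighted sum of [phi_diffquot] is a combination
    of the smooth functions F(u, i u) of one variable, which have Taylor
    expansions of their own.  Comparing the two expansions yields an expansion
    of phi m F at 0, and expresses its derivative by derivatives of order m +
    1 along the lines (u + t, i t). *)
Lemma phi_derive F m : BS2 F ->
  exists w : 'I_m.+2 -> R, forall u, is_derive u 1 (phi m F)
    (\sum_(i < m.+2) w i * phi m.+1 (fun u t => F (u + t) (i%:R * t)) u).
Proof.
have [w Hw] := @weights_exist m.+2 m (leqnSn _).
move=> HF0; exists (fun i => w i / m.+1`!%:R) => u0.
pose G u t := F (u0 + u) t.
have HG : BS2 G.
  move=> a b sa sb; exact: (HF0 _ _ (smoothD (@smooth_cst _ u0) sa) sb).
suff : is_derive (0 : R) 1 (phi m G)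
    (\sum_(i < m.+2) w i / m.+1`!%:R * phi m.+1 (fun u t => G (u + t) (i%:R * t)) 0).
  have E : phi m F = phi m G \o (fun u => u - u0).
    by apply/funext => u; rewrite /phi /G /= addrC subrK.
  have E2 (i : 'I_m.+2) : phi m.+1 (fun u t => F (u + t) (i%:R * t)) u0 =
      phi m.+1 (fun u t => G (u + t) (i%:R * t)) 0.
    by rewrite /phi /G; congr (derive1n _ _ _); apply/funext => t; rewrite add0r.
  under [X in _ -> is_derive _ _ _ X]eq_bigr do rewrite E2.
  move=> D; rewrite E -[X in is_derive _ _ _ X]mul1r.
  apply: is_derive_comp1; first by rewrite subrr.
  by apply: is_derive_eq; rewrite subr0.
move: G HG => {F HF0 u0} F HF.
have [d1 d10 [C1 H1]] := phi_diffquot HF Hw.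
pose f (i : 'I_m.+2) k := F k (i%:R * k).
have sf i : smooth (f i).
  apply: HF; first exact: smooth_id.
  by apply: smoothZ; exact: smooth_id.
pose beta l := \sum_(i < m.+2) w i * derive1n l (f i) 0 / l`!%:R.
have [d2 d20 [C2 H2]] : exists2 d : R, 0 < d & exists C : R, forall k : R, `|k| < d ->
   `|\sum_(i < m.+2) w i * F k (i%:R * k) - \sum_(l < m.+2) beta l * k ^+ l| <= C * `|k| ^+ m.+2.
  have /choice[B HB] : forall i, exists C, forall k : R, `|k| < 1 -> `|derive1n m.+2 (f i) k| <= C.
    move=> i; have [C HC] := @seg_bounded R _ (-1) 1 (smooth_continuous (smooth_derive1n m.+2 (sf i))).
    by exists C => k; rewrite ltr_norml => /andP[? ?]; apply: HC; rewrite !ltW.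
  exists 1 => //; exists (\sum_(i < m.+2) `|w i| * B i) => k k1.
  have -> : \sum_(l < m.+2) beta l * k ^+ l = \sum_(i < m.+2)
      w i * \sum_(l < m.+2) derive1n l (f i) 0 * k ^+ l / l`!%:R.
    under [RHS]eq_bigr do rewrite mulr_sumr.
    rewrite [RHS]exchange_big; apply: eq_bigr => l _.
    by rewrite mulr_suml; apply: eq_bigr => i _; ring.
  rewrite -sumrB; apply: le_trans (ler_norm_sum _ _ _) _.
  rewrite mulr_suml; apply: ler_sum => i _.
  rewrite -mulrBr normrM -[X in _ <= X]mulrA ler_wpM2l //.
  exact: (taylor_bound (sf i) (HB i) k1).
pose C := C1 + C2; pose d := Num.min d1 d2.
have d0 : 0 < d by rewrite lt_min d10.
have H3 k : `|k| < d -> `|phi m F k * k ^+ m - \sum_(l < m.+2) beta l * k ^+ l| <= C * `|k| ^+ m.+2.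
  rewrite lt_min => /andP[k1 k2].
  have := H1 k k k1 k1; have := H2 k k2; set S := \sum_(i < _) _; set T := \sum_(i < _) _.
  move=> L2 L1; rewrite (_ : _ - T = (S - T) - (S - phi m F k * k ^+ m)); last by ring.
  by apply: le_trans (ler_normB _ _) _; rewrite mulrDl addrC lerD.
have C10 : 0 <= C1.
  have e0 : 0 < d1 / 2 by rewrite divr_gt0.
  have e1 : `|d1 / 2| < d1 by rewrite gtr0_norm //; lra.
  have := le_trans (normr_ge0 _) (H1 0 (d1 / 2) _ e1); rewrite normr0 => /(_ d10).
  by rewrite pmulr_lge0 // exprn_gt0 // gtr0_norm.
have C0 : 0 <= C.
  have e0 : 0 < d / 2 by rewrite divr_gt0.
  have e1 : `|d / 2| < d by rewrite gtr0_norm //; lra.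
  have := le_trans (normr_ge0 _) (H3 (d / 2) e1).
  by rewrite pmulr_lge0 // exprn_gt0 // gtr0_norm.
clearbody d C.
(* phi m F is a locally uniform limit of difference quotients that are
   continuous in k; this fixes the term of degree m of the expansion *)
have cphi (e : R) : 0 < e -> exists2 d : R, 0 < d & forall k : R, `|k| < d -> `|phi m F k - phi m F 0| <= e.
  move=> e0.
  pose h := Num.min (d1 / 2) (Num.min 1 (e / (4 * (C1 + 1)))).
  have h0 : 0 < h by rewrite !lt_min ltr01 !divr_gt0 //; lra.
  have hd1 : `|h| < d1.
    by rewrite gtr0_norm // gt_min; apply/orP; left; lra.
  have h1 : h <= 1 by rewrite /h !ge_min lexx !orbT.
  have he : h * (4 * (C1 + 1)) <= e.
    by rewrite -ler_pdivlMr ?ge_min ?lexx ?orbT //; lra.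
  pose S k := \sum_(i < m.+2) w i * F k (i%:R * h).
  have sS : smooth S.
    by apply: smooth_sum => i _; apply: smoothZ; exact: (@BS2_smoothl F _ HF).
  have hm : 0 < h ^+ m by rewrite exprn_gt0.
  have /cvgrPdist_le /(_ (e / 2 * h ^+ m)) := @smooth_continuous _ _ sS 0.
  rewrite mulr_gt0 ?divr_gt0 // => /(_ isT) /nearR_dist[d3 d30 H4].
  exists (Num.min d3 d1); first by rewrite lt_min d30.
  move=> k; rewrite lt_min => /andP[k3 k1].
  have := H4 k k3; rewrite add0r distrC => L4.
  have L5 := H1 k h k1 hd1; have L6 := H1 0 h; rewrite normr0 in L6.
  have {}L6 := L6 d10 hd1.
  rewrite -(ler_pM2r hm) -[X in `|_| * X](ger0_norm (ltW hm)) -normrM.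
  rewrite (_ : (phi m F k - phi m F 0) * h ^+ m =
    (S k - S 0) - (S k - phi m F k * h ^+ m) + (S 0 - phi m F 0 * h ^+ m)); last by ring.
  apply: le_trans (ler_normD _ _) _.
  apply: le_trans (lerD (ler_normB _ _) (lexx _)) _.
  apply: le_trans (lerD (lerD L4 L5) L6) _.
  have -> : `|h| ^+ m.+2 = h ^+ m * h ^+ 2 by rewrite gtr0_norm // -exprD addn2.
  have : C1 * (h ^+ m * h ^+ 2) <= e / 4 * h ^+ m.
    rewrite mulrCA mulrC ler_pM2r // expr2.
    have : h * h <= h * 1 by rewrite ler_pM2l.
    nra.
  by lra.
have Hb : forall l, (l <= m)%N -> (if l == m then beta m - phi m F 0 else beta l) = 0.
  apply: poly_small => e e0.
  have [d3 d30 H4] := cphi (e / 2) (divr_gt0 e0 (ltr0Sn _ 1)).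
  pose K := C + `|beta m.+1| + 1.
  have K0 : 0 < K by rewrite /K; have := normr_ge0 (beta m.+1); lra.
  exists (Num.min (Num.min d d3) (Num.min 1 (e / 2 / K))).
    by rewrite !lt_min d0 d30 ltr01 !divr_gt0.
  move=> k kn0; rewrite !lt_min => /andP[/andP[kd kd3] /andP[k1 ke]].
  have L3 := H3 k kd; have L4 := H4 k kd3.
  rewrite big_ord_recr /= eqxx.
  have E : \sum_(l < m.+2) beta l * k ^+ l =
     \sum_(i < m) beta i * k ^+ i + beta m * k ^+ m + beta m.+1 * k ^+ m.+1.
    by rewrite !big_ord_recr.
  have -> : \sum_(i < m) (if i == m :> nat then beta m - phi m F 0 else beta i) * k ^+ i
     = \sum_(i < m) beta i * k ^+ i.
    by apply: eq_bigr => i _; rewrite ltn_eqF.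
  move: L3; rewrite E; set T := \sum_(i < m) _ => L3.
  rewrite (_ : T + _ = - (phi m F k * k ^+ m - (T + beta m * k ^+ m + beta m.+1 * k ^+ m.+1))
     + (phi m F k - phi m F 0) * k ^+ m - beta m.+1 * k ^+ m.+1); last by ring.
  apply: le_trans (ler_normB _ _) _.
  apply: le_trans (lerD (ler_normD _ _) (lexx _)) _.
  rewrite normrN !normrM !normrX.
  apply: le_trans (lerD (lerD L3 (ler_wpM2r (exprn_ge0 m (normr_ge0 k)) L4)) (lexx _)) _.
  have km : 0 <= `|k| ^+ m by rewrite exprn_ge0.
  rewrite !exprS.
  have ke' : `|k| * K <= e / 2 by rewrite -ler_pdivlMr // ltW.
  have k00 := normr_ge0 k.
  have := normr_ge0 (beta m.+1); set B := `|beta m.+1| => B0.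
  have : `|k| * (C * `|k| + B) <= e / 2.
    apply: le_trans ke'; rewrite ler_wpM2l // /K -/B.
    have : C * `|k| <= C * 1 by rewrite ler_wpM2l // ltW.
    by lra.
  move=> L7; have := ler_wpM2r km L7; set P := `|k| ^+ m; set kk := `|k|.
  by move=> L8; lra.
have betam : beta m = phi m F 0 by have := Hb m (leqnn _); rewrite eqxx => /eqP; rewrite subr_eq0 => /eqP.
have betal l : (l < m)%N -> beta l = 0.
  by move=> lm; have := Hb l (ltnW lm); rewrite ltn_eqF.
rewrite (_ : \sum_(i < _) _ = beta m.+1); last first.
  apply: eq_bigr => i _; rewrite /phi.
  have -> : (fun t => F (0 + t) (i%:R * t)) = f i.
    by apply/funext => t; rewrite add0r.
  by rewrite [in RHS]mulrAC.
apply: (@is_derive_quad _ _ _ _ C d) => // h hd.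
rewrite add0r; have [->|h0] := eqVneq h 0.
  by rewrite mul0r subrr subr0 normr0 expr0n mulr0.
have := H3 h hd; rewrite !big_ord_recr /= big1; last by move=> i _; rewrite betal ?mul0r.
rewrite betam => L.
have hm : 0 < `|h| ^+ m by rewrite exprn_gt0 // normr_gt0.
rewrite -(ler_pM2r hm) -[X in `|_| * X]normrX -normrM.
move: L; have -> : `|h| ^+ m.+2 = `|h| ^+ m * h ^+ 2 by rewrite -[h ^+ 2]real_normK ?num_real // -exprD addn2.
rewrite [X in _ <= X -> _]mulrA [X in _ <= X -> _]mulrAC => L.
by apply: le_trans L; rewrite le_eqVlt; apply/orP; left; apply/eqP; congr `|_|; rewrite exprS; ring.
Qed.

Lemma ndiff_sum n k (G : 'I_k -> R -> R) : (forall i, ndiff n (G i)) ->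
  ndiff n (fun u => \sum_(i < k) G i u).
Proof.
move=> H; elim: k G H => [|k IHk] G H.
  under eq_fun do rewrite big_ord0.
  exact/smooth_ndiff/smooth_cst.
under eq_fun do rewrite big_ord_recl.
by apply: (ndiffD (H ord0)); apply: IHk.
Qed.

(** By [phi_derive] the derivative is a combination of functions of the same
    kind, for other functions F. *)
Lemma phi_smooth F m : BS2 F -> smooth (phi m F).
Proof.
move=> HF; apply/ndiffP => n; elim: n m F HF => //= n IHn m F HF.
have [w Hw] := phi_derive m HF.
split=> [u|]; first by have [] := Hw u.
rewrite (_ : derive1 _ =
  (fun u => \sum_(i < m.+2) w i * phi m.+1 (fun u t => F (u + t) (i%:R * t)) u)); last first.
  by apply/funext => u; rewrite (is_derive1E (Hw u)).
apply: ndiff_sum => i; apply: ndiffM; first exact/smooth_ndiff/smooth_cst.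
by apply: IHn; apply: BS2_line.
Qed.

(** Apply [phi_smooth] to the translate of F along the two given curves. *)
Lemma BS2_d2 F : BS2 F -> BS2 (fun u t => derive1 (F u) t).
Proof.
move=> HF a b sa sb.
pose G s z := F (a s) (b s + z).
have HG : BS2 G.
  move=> c d sc second_diff; apply: HF (smooth_comp sa sc) (smoothD (smooth_comp sb sc) second_diff).
rewrite (_ : (fun s => _) = phi 1 G); first exact: phi_smooth.
apply/funext => s; rewrite /phi derive1n1; apply/esym/is_derive1E.
have -> : G s = F (a s) \o (fun z => 1 * z + b s).
  by apply/funext => z; rewrite /G /= mul1r addrC.
rewrite -[X in is_derive _ _ _ X]mul1r; apply: is_derive_comp1.
  by rewrite mulr0 add0r; apply: smooth_is_derive; exact: BS2_smooth.
by apply: is_derive_eq; rewrite /GRing.scale /=; ring.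
Qed.

Lemma BS2_swap F : BS2 F -> BS2 (fun u t => F t u).
Proof. by move=> H a b sa sb; apply: H. Qed.

Lemma BS2_d1 F : BS2 F -> BS2 (fun u t => derive1 (F^~ t) u).
Proof. by move=> /BS2_swap/BS2_d2/BS2_swap. Qed.

Lemma BS2_cont F u0 t0 (e : R) : BS2 F -> 0 < e ->
  exists2 d : R, 0 < d & forall u t, `|u| < d -> `|t| < d ->
    `|F (u0 + u) (t0 + t) - F u0 t0| <= e.
Proof.
move=> H e0; have [d1 d10 [C HC]] := BS2_lbound 1 u0 t0 H.
have C0 : 0 <= C.
  by apply: le_trans (HC 0 0 _ _); rewrite ?normr0.
have /cvgrPdist_le /(_ (e / 2)) := @smooth_continuous _ _ (@BS2_smoothl F t0 H) u0.
rewrite divr_gt0 // => /(_ isT) /nearR_dist[d2 d20 H2].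
exists (Num.min (Num.min d1 d2) (e / 2 / (C + 1))).
  by rewrite !lt_min d10 d20 !divr_gt0 //; lra.
move=> u t; rewrite !lt_min => /andP[/andP[u1 u2] _] /andP[/andP[t1 t2] te].
rewrite -(subrK (F (u0 + u) t0) (F _ _)) -addrA.
apply: le_trans (ler_normD _ _) _.
have L1 : `|F (u0 + u) (t0 + t) - F (u0 + u) t0| <= C * `|t|.
  apply: mean_value_ineq => y yt; split; first by apply/smooth_derivable/BS2_smooth.
  have := HC u (y - t0) u1 (le_lt_trans yt t1); rewrite derive1n1.
  by have -> : t0 + (y - t0) = y by ring.
have L2 := H2 u u2; rewrite distrC in L2.
have L3 : `|t| * (C + 1) <= e / 2 by rewrite -ler_pdivlMr ?ltW //; lra.
have := normr_ge0 t; move: L1 L2 L3; set T := `|t|; nra.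
Qed.

Lemma BS2_continuous F : BS2 F -> continuous (fun z : R * R => F z.1 z.2).
Proof.
move=> H [u0 t0] /=; apply/cvgrPdist_le => e e0.
have [d d0 Hd] := @BS2_cont F u0 t0 e H e0.
exists (ball u0 d, ball t0 d) => [|[u t] [/= Hu Ht]] /=.
  by split; exact: nbhsx_ballx.
rewrite /ball /= in Hu Ht.
rewrite distrC -[u](subrK u0) -[t](subrK t0) [u - u0 + _]addrC [t - t0 + _]addrC.
by apply: Hd; rewrite distrC.
Qed.

Lemma BS2_bounded F (A : R) : BS2 F ->
  exists C, forall u t, `|u| <= A -> `|t| <= A -> `|F u t| <= C.
Proof.
move=> H; have [A0|A0] := ltP A 0.
  by exists 0 => u t uA; have := le_lt_trans (le_trans (normr_ge0 u) uA) A0; rewrite ltxx.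
have [||c _ Hc] := @compact_EVT_max (R * R)%type R (fun z => `|F z.1 z.2|)
    (`[-A, A] `*` `[-A, A])%classic _ (compact_setX (@segment_compact _ _ _) (@segment_compact _ _ _)).
- by exists (0, 0); split; rewrite /= in_itv /=; apply/andP; split; lra.
- apply: continuous_subspaceT => z.
  by apply: continuous_comp; [exact: BS2_continuous|exact: norm_continuous].
exists `|F c.1 c.2| => u t uA tA; apply: (Hc (u, t)).
by rewrite inE; split; rewrite /= in_itv /= -ler_norml.
Qed.

Notation mu := (@lebesgue_measure R).

Lemma cont_integrable f : continuous f ->
  mu.-integrable `[0, 1] (EFin \o f).
Proof.
by move=> cf; apply: continuous_compact_integrable;
  [exact: segment_compact|exact: continuous_subspaceT].
Qed.

Lemma int_derive F : BS2 F -> forall u, is_derive u 1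
  (fun u => \int[mu]_(t in `[0, 1]) F u t)%R
  (\int[mu]_(t in `[0, 1]) derive1 (F^~ t) u)%R.
Proof.
move=> H u.
have [C HC] := @BS2_bounded _ (`|u| + 2) (BS2_d1 H).
have C0 : 0 <= C.
  by apply: le_trans (HC 0 0 _ _); rewrite ?normr0 ?addr_ge0.
have mI : measurable (`[0, 1]%classic : set (measurableTypeR R)) by exact: measurable_itv.
have Iu : `]u - 1, u + 1[%classic u by rewrite /= in_itv /=; apply/andP; split; lra.
have intf x : `]u - 1, u + 1[%classic x -> mu.-integrable `[0, 1] (EFin \o F x).
  by move=> _; apply/cont_integrable/smooth_continuous/BS2_smooth.
have derf (x y : R) : `]u - 1, u + 1[%classic x -> `[0, 1]%classic y -> derivable (F^~ y) x 1.
  by move=> _ _; apply/smooth_derivable/(BS2_smoothl H).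
have intG : mu.-integrable `[0, 1] (EFin \o (fun=> C)).
  exact/cont_integrable/cst_continuous.
have Gub (x y : R) : `]u - 1, u + 1[%classic x -> `[0, 1]%classic y ->
    `|derive1 (F^~ y) x| <= C.
  rewrite /= !in_itv /= => /andP[x1 x2] /andP[y0 y1]; apply: HC.
    rewrite -[x](subrK u) addrC; apply: le_trans (ler_normD _ _) _.
    by rewrite lerD2l ler_norml; lra.
  by rewrite ger0_norm //; have := normr_ge0 u; lra.
split.
  exact: (derivable_under_integral mI Iu intf derf (fun=> C0) intG Gub).
rewrite -derive1E.
exact: (differentiation_under_integral mI Iu intf derf (fun=> C0) intG Gub).
Qed.

Lemma int_smooth F : BS2 F -> smooth (fun u => \int[mu]_(t in `[0, 1]) F u t)%R.
Proof.
move=> H; apply/ndiffP => n; elim: n F H => //= n IHn F H.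
have D := int_derive H.
split=> [u|]; first by have [] := D u.
rewrite (_ : derive1 _ = (fun u => \int[mu]_(t in `[0, 1]) derive1 (F^~ t) u)%R).
  by apply: IHn; exact: BS2_d1.
by apply/funext => u; exact: is_derive1E (D u).
Qed.

(** Hadamard's formula: as an integral, the quotient of F(u, t) - F(u, 0) by t
    makes sense and is smooth at t = 0 too. *)
Definition hquot F u t := (\int[mu]_(s in `[0, 1]) derive1 (F u) (s * t))%R.

Lemma hquot_BS2 F : BS2 F -> BS2 (hquot F).
Proof.
move=> H a b sa sb; apply: (@int_smooth (fun s z => derive1 (F (a s)) (z * b s))).
move=> c d sc second_diff; apply: (BS2_d2 H); first exact: smooth_comp.
exact: (smoothM second_diff (smooth_comp sb sc)).
Qed.

Lemma hquotE F u t : BS2 F -> F u t - F u 0 = t * hquot F u t.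
Proof.
move=> H.
have su := @BS2_smooth _ u H.
pose f s := t * derive1 (F u) (s * t); pose G s := F u (s * t).
have D (s : R) : is_derive s 1 G (f s).
  have -> : G = F u \o (fun s => s * t) by [].
  apply: is_derive_comp1; first exact: smooth_is_derive.
  by apply: is_derive_eq; rewrite /GRing.scale /=; ring.
have sG : smooth (fun s => s * t) by exact: (smoothM (@smooth_id R) (@smooth_cst _ t)).
have sf : smooth (fun s => derive1 (F u) (s * t)).
  exact: smooth_comp (smooth_derive1 su) sG.
have cG : continuous G := smooth_continuous (smooth_comp su sG).
have := @continuous_FTC2 R f G 0 1 ltr01 _ _ _.
rewrite /G mul1r mul0r => FTC.
have : (\int[mu]_(x in `[0%R, 1%R]) (f x)%:E = (F u t)%:E - (F u 0)%:E)%E.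
  apply: FTC.
  - by apply: continuous_subspaceT; apply/smooth_continuous/smoothZ.
  - split.
    + by move=> x _; have [] := D x.
    + by apply: cvg_at_right_filter; exact: cG.
    + by apply: cvg_at_left_filter; exact: cG.
  - by move=> x _; exact: is_derive1E (D x).
move=> /(congr1 fine) /= <-; rewrite -/(Rintegral mu `[0, 1] f).
by rewrite RintegralZl //; exact/cont_integrable/smooth_continuous.
Qed.

End Boman.

#[local] Opaque smooth BS2.

(** * Weakly smooth families of functions *)

Section Hump.
Variable R : realType.
Implicit Types (f g : R -> R) (x t : R) (u v : nat -> R).

Lemma taylor_at M f x (C d : R) : smooth f ->
  (forall h, `|h| < d -> `|derive1n M f (x + h)| <= C) -> forall h, `|h| < d ->
  `|f (x + h) - \sum_(l < M) derive1n l f x * h ^+ l / l`!%:R| <= C * `|h| ^+ M.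
Proof.
move=> sf H h hd; pose g y := f (1 * y + x).
have sg : smooth g.
  exact: (smooth_comp sf (smooth_affine 1 x)).
have E l y : derive1n l g y = derive1n l f (x + y).
  by rewrite derive1n_affine // expr1n !mul1r addrC.
have Hg t : `|t| < d -> `|derive1n M g t| <= C by rewrite E; exact: H.
have := taylor_bound sg Hg hd; rewrite [g h]/g mul1r [h + x]addrC.
by under eq_bigr do rewrite E addr0.
Qed.

Lemma taylor2 f x (C d : R) : smooth f ->
  (forall h, `|h| < d -> `|derive1n 2 f (x + h)| <= C) -> forall h, `|h| < d ->
  `|f (x + h) - f x - h * derive1 f x| <= C * h ^+ 2.
Proof.
move=> sf H h hd; have := taylor_at sf H hd.
rewrite !big_ord_recl big_ord0 /= addr0 expr0 mulr1 fact0 divr1 expr1 divr1.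
rewrite real_normK ?num_real //.
by congr (`|_| <= _); ring.
Qed.

Lemma taylor3 f x (C d : R) : smooth f ->
  (forall h, `|h| < d -> `|derive1n 3 f (x + h)| <= C) -> forall h, `|h| < d ->
  `|f (x + h) - f x - h * derive1 f x - h ^+ 2 / 2 * derive1n 2 f x| <= C * `|h| ^+ 3.
Proof.
move=> sf H h hd; have := taylor_at sf H hd.
rewrite !big_ord_recr big_ord0 /=.
have -> : 2`! = 2%N by [].
rewrite add0r expr0 mulr1 !fact0 !divr1 expr1.
by congr (`|_| <= _); ring.
Qed.

(** The symmetric second difference is not affected by affine parts, so it
    detects second derivatives when nothing is known about the first. *)
Definition second_diff f t h := f (t + h) + f (t - h) - 2 * f t.

Lemma second_diff_bound f t (C d : R) : smooth f ->
  (forall h, `|h| < d -> `|derive1n 2 f (t + h)| <= C) -> forall h, `|h| < d ->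
  `|second_diff f t h| <= 2 * C * h ^+ 2.
Proof.
move=> sf H h hd; have T1 := taylor2 sf H hd.
have T2 : `|f (t - h) - f t - - h * derive1 f t| <= C * (- h) ^+ 2.
  by apply: (taylor2 sf H); rewrite normrN.
rewrite sqrrN in T2.
rewrite /second_diff (_ : _ - _ = (f (t + h) - f t - h * derive1 f t) +
  (f (t - h) - f t - - h * derive1 f t)); last by ring.
by apply: le_trans (ler_normD _ _) _; lra.
Qed.

Lemma second_diff_large f t (L : R) : smooth f -> L < `|derive1n 2 f t| ->
  exists h : R, [/\ h != 0, `|h| <= 1 & L * h ^+ 2 < `|second_diff f t h|].
Proof.
move=> sf HL.
have [d d0 Hd] := cont_bounded (@smooth_continuous _ _ (smooth_derive1n 3 sf) t).
set C := `|_| + 1 in Hd.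
have C0 : 0 < C by apply: ltr_wpDl; [exact: normr_ge0|exact: ltr01].
have HL' : 0 < `|derive1n 2 f t| - L by rewrite subr_gt0; exact: HL.
set f2 := derive1n 2 f t in HL HL' *; clearbody C.
pose h := Num.min (Num.min 1 (d / 2)) ((`|f2| - L) / (4 * C)).
have h0 : 0 < h by rewrite !lt_min ltr01 !divr_gt0 // mulr_gt0.
have h1 : h <= 1 by rewrite /h !ge_min lexx.
have hd : `|h| < d.
  rewrite gtr0_norm //; apply: le_lt_trans (_ : d / 2 < _); last by lra.
  by rewrite /h !ge_min lexx orbT.
have hC : h * (4 * C) <= `|f2| - L.
  by rewrite -ler_pdivlMr ?mulr_gt0 // /h ge_min lexx orbT.
exists h; split; [by rewrite gt_eqF|by rewrite gtr0_norm|].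
have T1 := taylor3 sf Hd hd.
have hd' : `|- h| < d by rewrite normrN.
have T2 := taylor3 sf Hd hd'.
rewrite normrN in T2; rewrite -/f2 in T1 T2.
have h0' : `|h| = h by rewrite gtr0_norm.
clearbody h f2; rewrite h0' in T1 T2.
have : `|second_diff f t h - h ^+ 2 * f2| <= 2 * C * h ^+ 3.
  rewrite /second_diff (_ : _ - _ = (f (t + h) - f t - h * derive1 f t - h ^+ 2 / 2 * f2) +
    (f (t - h) - f t - - h * derive1 f t - (- h) ^+ 2 / 2 * f2)).
    by apply: le_trans (ler_normD _ _) _; have := lerD T1 T2; lra.
  by field.
move=> T3.
have : `|h ^+ 2 * f2| <= `|second_diff f t h| + 2 * C * h ^+ 3.
  rewrite -[h ^+ 2 * f2](subKr (second_diff f t h)).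
  by apply: le_trans (ler_normB _ _) _; rewrite lerD2l.
rewrite normrM ger0_norm ?sqr_ge0 // => T4.
have h2 : 0 < h ^+ 2 by rewrite exprn_gt0.
have T5 : L * h ^+ 2 + h * (4 * C) * h ^+ 2 <= `|f2| * h ^+ 2.
  by rewrite -mulrDl ler_pM2r //; lra.
have : 0 < C * h ^+ 3 by rewrite mulr_gt0 // exprn_gt0.
move: T4 T5; rewrite !exprS expr0 !mulr1; nra.
Qed.

Definition pw n : R := 2^-1 ^+ n.
Lemma pw_gt0 n : 0 < pw n.
Proof. by rewrite exprn_gt0. Qed.
(** All series below are dominated by multiples of one geometric series, so
    that summation stays elementary. *)
Definition geo C u := forall n, `|u n| <= C * pw n.
Definition ssum u : R := limn (series u).

Lemma geo_cvg0 (C : R) : cvgn (series (fun n => C * pw n)) /\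
   limn (series (fun n => C * pw n)) = C * 2.
Proof.
have E : (fun n => C * pw n) = geometric C 2^-1 by [].
have h : `|2^-1 : R| < 1 by rewrite ger0_norm ?invr_ge0 //; lra.
have := @cvg_geometric_series R C 2^-1 h.
have -> : 1 - 2^-1 = 2^-1 :> R by lra.
rewrite invrK.
by rewrite -E => H; split; [apply/cvg_ex; exists (C * 2)|apply/cvg_lim].
Qed.

Lemma geo_ncvg C u : geo C u -> cvgn [normed series u].
Proof.
move=> H; apply: series_le_cvg (geo_cvg0 C).1; [|move=> n..|exact: H].
  by move=> n; exact: normr_ge0.
exact: le_trans (normr_ge0 _) (H n).
Qed.

Lemma geo_cvg C u : geo C u -> cvgn (series u).
Proof. by move=> /geo_ncvg/normed_cvg. Qed.

Lemma ssum_bound C u : geo C u -> `|ssum u| <= C * 2.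
Proof.
move=> H; apply: le_trans (lim_series_norm (geo_ncvg H)) _.
rewrite -(geo_cvg0 C).2; apply: lim_series_le => //; first exact: geo_ncvg H.
exact: (geo_cvg0 C).1.
Qed.

Lemma ssumD C D u v : geo C u -> geo D v -> ssum (fun n => u n + v n) = ssum u + ssum v.
Proof. by move=> /geo_cvg cu /geo_cvg cv; exact: (lim_seriesD cu cv). Qed.

Lemma ssumZ C k u : geo C u -> ssum (fun n => k * u n) = k * ssum u.
Proof. by move=> /geo_cvg cu; exact: (lim_seriesZ k cu). Qed.

Lemma geoD C D u v : geo C u -> geo D v -> geo (C + D) (fun n => u n + v n).
Proof.
by move=> Hu Hv n; apply: le_trans (ler_normD _ _) _; rewrite mulrDl lerD.
Qed.

Lemma geoZ C k u : geo C u -> geo (`|k| * C) (fun n => k * u n).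
Proof. by move=> Hu n; rewrite normrM -mulrA ler_wpM2l. Qed.

Lemma geoS C u : geo C u -> geo (C / 2) (fun n => u n.+1).
Proof. by move=> Hu n; apply: le_trans (Hu n.+1) _; rewrite /pw exprS mulrA. Qed.

Lemma ssum_recl C u : geo C u -> ssum u = u 0%N + ssum (fun n => u n.+1).
Proof.
move=> H; apply: cvg_lim => //.
rewrite -cvg_shiftS.
have -> : [sequence series u n.+1]_n = (fun=> u 0%N) \+ series (fun n => u n.+1).
  by apply/funext => n; rewrite /series /= big_nat_recl.
apply: cvgD; first exact: cvg_cst.
by have /geo_cvg := geoS H.
Qed.

Lemma ssum_split C k u : geo C u ->
  ssum u = \sum_(i < k) u i + ssum (fun n => u (k + n)%N).
Proof.
elim: k C u => [|k IHk] C u H; first by rewrite big_ord0 add0r.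
rewrite big_ord_recl (ssum_recl H) (IHk _ _ (geoS H)) addrA; congr (_ + _).
Qed.

Lemma ssum1 x : ssum (fun n => (n == 0%N)%:R * x) = x.
Proof.
have H : geo `|x| (fun n => (n == 0%N)%:R * x).
  case=> [|n]; first by rewrite mul1r /pw expr0 mulr1.
  by rewrite mul0r normr0 mulr_ge0 // ltW ?pw_gt0.
rewrite (ssum_recl H) mul1r -[RHS]addr0; congr (_ + _).
have H0 : geo 0 (fun n : nat => 0 * x).
  by move=> n; rewrite !mul0r normr0.
by have := ssum_bound H0; rewrite (mul0r 2) normr_le0 => /eqP.
Qed.

(** A sequence of functions, seen as a curve in a space of bounded sequences,
    that becomes smooth when paired with any small sequence of weights.  The
    reindexing k makes the condition stable under passing to subsequences. *)
Definition wsmooth (F : nat -> R -> R) :=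
  [/\ forall n, smooth (F n),
      forall t, exists B : R, forall n, `|F n t| <= B &
      forall (e : nat -> R) (k : nat -> nat), (forall n, `|e n| <= pw n) ->
        smooth (fun t => ssum (fun n => e n * F (k n) t))].

Lemma geo_mul e u B : (forall n, `|e n| <= pw n) -> (forall n, `|u n| <= B) ->
  geo B (fun n => e n * u n).
Proof.
by move=> He Hu n; rewrite normrM mulrC ler_pM.
Qed.

Lemma ssum3 C u v w (a b c : R) : geo C u -> geo C v -> geo C w ->
  ssum (fun n => a * u n + b * v n + c * w n) = a * ssum u + b * ssum v + c * ssum w.
Proof.
move=> Hu Hv Hw.
rewrite (ssumD (geoD (geoZ a Hu) (geoZ b Hv)) (geoZ c Hw)).
by rewrite (ssumD (geoZ a Hu) (geoZ b Hv)) (ssumZ a Hu) (ssumZ b Hv) (ssumZ c Hw).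
Qed.

(** If the second derivatives were unbounded, one could choose indices n_k,
    points t_k and increments h_k inductively such that the weighted second
    difference of F_{n_k} at t_k dominates those of the earlier terms, whose
    second derivatives are bounded, and then take the later weights so small
    that the later terms cannot compensate it.  The weighted sum, although
    smooth, would have unbounded second difference quotients. *)
Lemma gliding_hump F (A : R) : wsmooth F ->
  exists C, forall n t, `|t| <= A -> `|derive1n 2 (F n) t| <= C.
Proof.
move=> [sF /choice[B HB] wF]; apply: contrapT => N.
have /choice[Cf HCf] : forall n, exists C : R, 0 <= C /\
    forall t, `|t| <= A + 2 -> `|derive1n 2 (F n) t| <= C.
  move=> n; have [C HC] := seg_bounded (- (A + 2)) (A + 2)
    (smooth_continuous (smooth_derive1n 2 (sF n))).
  exists (Num.max C 0); split; first by rewrite le_max lexx orbT.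
  by move=> t; rewrite ler_norml => /HC H; rewrite le_max H.
have /choice[pick Hp] : forall s : R * R * nat, exists p : nat * R * R, 0 < s.1.1 ->
    [/\ `|p.1.2| <= A, p.2 != 0, `|p.2| <= 1 &
      (s.2%:R + s.1.2 + 1) * p.2 ^+ 2 < s.1.1 * `|second_diff (F p.1.1) p.1.2 p.2|].
  move=> [[E a] k] /=; have [E0|E0] := ltP 0 E; last by exists (0%N, 0, 0).
  have [n [t [tA Ht]]] : exists n t, `|t| <= A /\ (k%:R + a + 1) / E < `|derive1n 2 (F n) t|.
    apply: contrapT => N'; apply: N; exists ((k%:R + a + 1) / E) => n t tA.
    by rewrite leNgt; apply/negP => L; apply: N'; exists n, t.
  have [h [h0 h1 Hh]] := second_diff_large (sF n) Ht.
  exists (n, t, h) => _ /=; split=> //.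
  by move: Hh; rewrite -(ltr_pM2l E0) mulrA [E * (_ / E)]mulrC divfK ?gt_eqF.
pose D (p : nat * R * R) : R := `|B (p.1.2 + p.2)| + `|B (p.1.2 - p.2)| + 2 * `|B p.1.2|.
(* the state consists of the next weight, a bound for the second derivative
   of the partial sum, and the number of the step *)
pose nxt (s : R * R * nat) : R * R * nat :=
  let p := pick s in
  (Num.min (s.1.1 / 2) (p.2 ^+ 2 / (2 * (1 + D p))),
   s.1.2 + s.1.1 * (2 * Cf p.1.1), s.2.+1).
pose st k := iter k nxt (1, 0, 0%N).
pose E k := (st k).1.1; pose a k := (st k).1.2; pose p k := pick (st k).
have D0 q : 0 <= D q by rewrite /D !addr_ge0 // mulr_ge0.
have st2 k : (st k).2 = k by elim: k => //= k ->.
have E0 k : 0 < E k /\ (p k).2 != 0.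
  suff Ek : 0 < E k by split=> //; have [] := Hp (st k) Ek.
  elim: k => [|k IHk]; first exact: ltr01.
  rewrite /E /= lt_min divr_gt0 //=.
  have [_ h0 _ _] := Hp _ IHk.
  apply: divr_gt0; first by rewrite exprn_even_gt0.
  by apply: mulr_gt0 => //; rewrite ltr_pwDl.
have ES k : E k.+1 <= E k / 2 by rewrite /E /= ge_min lexx.
have ED k : E k.+1 * (2 * (1 + D (p k))) <= (p k).2 ^+ 2.
  rewrite -ler_pdivlMr ?mulr_gt0 //; last by rewrite ltr_pwDl.
  by rewrite /E /= ge_min lexx orbT.
have Epw m k : E (m + k)%N <= E m * pw k.
  elim: k => [|k IHk]; first by rewrite addn0 /pw expr0 mulr1.
  rewrite addnS; apply: le_trans (ES _) _.
  by rewrite /pw exprS mulrCA [2^-1 * _]mulrC ler_wpM2r.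
have aE k : a k = \sum_(m < k) E m * (2 * Cf (p m).1.1).
  elim: k => [|k IHk]; first by rewrite big_ord0.
  by rewrite big_ord_recr /= -IHk.
pose nn k := (p k).1.1.
have He k : `|E k| <= pw k.
  have [Ek _] := E0 k; rewrite gtr0_norm //.
  by have := Epw 0%N k; rewrite add0n {2}/E /= mul1r.
have sS := wF E nn He; set S := (fun t => _) in sS.
have [CS HCS] := seg_bounded (- (A + 2)) (A + 2)
    (smooth_continuous (smooth_derive1n 2 sS)).
have [k kC] : exists k : nat, 2 * CS < k%:R.
  exists (Num.bound `|2 * CS|).
  by apply: le_lt_trans (ler_norm _) (archi_boundP _).
have [Ek h0] := E0 k; have [] := Hp (st k) Ek.
rewrite -/(p k) -/(E k) st2 -/(a k); set t := (p k).1.2; set h := (p k).2 => tA _ h1 L.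
have h2 : 0 < h ^+ 2 by rewrite exprn_even_gt0.
have inA y : `|y| < 2 -> `|t + y| <= A + 2.
  by move=> y2; apply: le_trans (ler_normD _ _) _; lra.
have h12 : `|h| < 2 by lra.
have US : `|second_diff S t h| <= 2 * CS * h ^+ 2.
  by apply: (second_diff_bound sS _ h12) => y /inA; rewrite ler_norml; exact: HCS.
have Uf n : `|second_diff (F n) t h| <= 2 * Cf n * h ^+ 2.
  by apply: (second_diff_bound (sF n) _ h12) => y /inA; exact: (HCf n).2.
have Ud n : `|second_diff (F n) t h| <= D (p k).
  have bb x : `|F n x| <= `|B x| by apply: le_trans (HB x n) (ler_norm _).
  rewrite /second_diff; apply: le_trans (ler_normB _ _) _; rewrite normrM ger0_norm //.
  apply: le_trans (lerD (ler_normD _ _) (lexx _)) _.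
  by rewrite /D -/t -/h !lerD // ler_wpM2l.
have SE : second_diff S t h = ssum (fun n => E n * second_diff (F (nn n)) t h).
  pose G x n := E n * F (nn n) x.
  pose M := `|B (t + h)| + `|B (t - h)| + `|B t|.
  have gM x : `|B x| <= M -> geo M (G x).
    move=> BM; apply: geo_mul => // n.
    exact: le_trans (HB x _) (le_trans (ler_norm _) BM).
  have n1 := normr_ge0 (B (t + h)); have n2 := normr_ge0 (B (t - h)).
  have n3 := normr_ge0 (B t).
  rewrite /second_diff /S -[2 * _]opprK -mulNr.
  have := @ssum3 M (G (t + h)) (G (t - h)) (G t) 1 1 (-2).
  rewrite !mul1r mulNr opprK => <-; last 3 first.
  - by apply: gM; rewrite /M; lra.
  - by apply: gM; rewrite /M; lra.
  - by apply: gM; rewrite /M; lra.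
  by congr ssum; apply/funext => n; rewrite /G; ring.
have gS : geo (D (p k)) (fun n => E n * second_diff (F (nn n)) t h) by exact: geo_mul.
move: US; rewrite SE (ssum_split k gS).
have gS' : geo (D (p k) / 2 ^+ k) (fun n => E (k + n)%N * second_diff (F (nn (k + n)%N)) t h).
  move=> n; apply: le_trans (gS _) _; rewrite /pw exprD mulrA exprVn //.
rewrite (ssum_recl gS') addn0.
set Z1 := \sum_(i < k) _; set Z3 := ssum _.
have B1 : `|Z1| <= a k * h ^+ 2.
  apply: le_trans (ler_norm_sum _ _ _) _; rewrite aE mulr_suml.
  apply: ler_sum => i _; rewrite normrM gtr0_norm; last by have [] := E0 i.
  by rewrite -mulrA ler_wpM2l // ltW //; have [] := E0 i.
have B3 : `|Z3| <= h ^+ 2.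
  have g3 : geo (E k.+1 * D (p k)) (fun n => E (k + n.+1)%N * second_diff (F (nn (k + n.+1)%N)) t h).
    move=> n; rewrite normrM gtr0_norm; last by have [] := E0 (k + n.+1)%N.
    rewrite mulrAC; apply: ler_pM (Ud _) => //; first by apply: ltW; have [] := E0 (k + n.+1)%N.
    by rewrite addnS -addSn; exact: Epw.
  apply: le_trans (ssum_bound g3) _; apply: le_trans (ED k).
  have := (E0 k.+1).1 => Ek1; have := D0 (p k); nra.
have B2 : `|E k * second_diff (F (nn k)) t h| = E k * `|second_diff (F (nn k)) t h|.
  by rewrite normrM gtr0_norm.
move: L; rewrite -/(nn k) -B2; set Z2 := E k * _ => L US.
have : `|Z2| <= 2 * CS * h ^+ 2 + a k * h ^+ 2 + h ^+ 2.
  rewrite (_ : Z2 = (Z1 + (Z2 + Z3)) - Z1 - Z3); last by ring.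
  apply: le_trans (ler_normB _ _) _; apply: lerD B3.
  by apply: le_trans (ler_normB _ _) _; exact: lerD.
have : 2 * CS * h ^+ 2 < k%:R * h ^+ 2 by rewrite ltr_pM2r.
by move: L; rewrite !mulrDl mul1r; lra.
Qed.

(** Differentiation term by term, the error of each term being controlled by
    the uniform bound on second derivatives. *)
Lemma ssum_quad (F : nat -> R -> R) (e : nat -> R) C t :
  (forall n, smooth (F n)) -> (forall n, `|e n| <= pw n) ->
  (forall x, exists B : R, forall n, `|F n x| <= B) ->
  (exists B : R, forall n, `|derive1 (F n) t| <= B) ->
  (forall n h, `|h| < 1 -> `|derive1n 2 (F n) (t + h)| <= C) ->
  is_derive t 1 (fun t => ssum (fun n => e n * F n t))
    (ssum (fun n => e n * derive1 (F n) t)).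
Proof.
move=> sF He /choice[B HB] [B' HB'] HC.
apply: (@is_derive_quad _ _ _ _ (C * 2) 1) => // h h1.
pose M := `|B (t + h)| + `|B t| + `|B'|.
have n1 := normr_ge0 (B (t + h)); have n2 := normr_ge0 (B t); have n3 := normr_ge0 B'.
have g1 : geo M (fun n => e n * F n (t + h)).
  apply: geo_mul => // n; apply: le_trans (HB _ n) _.
  by apply: le_trans (ler_norm _) _; rewrite /M; lra.
have g2 : geo M (fun n => e n * F n t).
  apply: geo_mul => // n; apply: le_trans (HB _ n) _.
  by apply: le_trans (ler_norm _) _; rewrite /M; lra.
have g3 : geo M (fun n => e n * derive1 (F n) t).
  apply: geo_mul => // n; apply: le_trans (HB' n) _.
  by apply: le_trans (ler_norm _) _; rewrite /M; lra.
have := ssum3 1 (-1) (- h) g1 g2 g3; rewrite mul1r mulN1r mulNr => <-.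
rewrite [_ * _ * _]mulrAC; apply: ssum_bound => n.
rewrite (_ : _ + _ = e n * (F n (t + h) - F n t - h * derive1 (F n) t)); last by ring.
rewrite normrM mulrC; apply: ler_pM => //.
exact: (taylor2 (sF n) (HC n)).
Qed.

(** The first derivative at 0 is controlled by the values at 0 and 1 and the
    bound on second derivatives; the mean value inequality spreads the bound. *)
Lemma wsmooth_bd1 F (A : R) : wsmooth F ->
  exists C : R, forall n t, `|t| <= A -> `|derive1 (F n) t| <= C.
Proof.
move=> wF; have [sF HB _] := wF.
have [C HC] := gliding_hump (`|A| + 2) wF.
have [B0 HB0] := HB 0; have [B1 HB1] := HB 1.
have A0 := normr_ge0 A.
have d0 n : `|derive1 (F n) 0| <= C + B1 + B0.
  have T : `|F n (0 + 1) - F n 0 - 1 * derive1 (F n) 0| <= C * 1 ^+ 2.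
    apply: (@taylor2 _ _ _ 2 (sF n)); last by rewrite normr1; lra.
    by move=> h h2; apply: HC; rewrite add0r; lra.
  rewrite expr1n mulr1 mul1r add0r in T.
  rewrite (_ : derive1 _ 0 = F n 1 - F n 0 - (F n 1 - F n 0 - derive1 (F n) 0)); last by ring.
  have := HB0 n; have := HB1 n => L1 L0.
  apply: le_trans (ler_normB _ _) _; have := ler_normB (F n 1) (F n 0); lra.
exists (C + B1 + B0 + C * `|A|) => n t tA.
have tA' : `|t| <= `|A| by apply: le_trans tA (ler_norm _).
have L : `|derive1 (F n) (0 + t) - derive1 (F n) 0| <= C * `|t|.
  apply: mean_value_ineq => y; rewrite subr0 => yt; split.
    exact/smooth_derivable/smooth_derive1.
  by apply: HC; lra.
rewrite add0r in L.
have C0 : 0 <= C by apply: le_trans (HC 0%N 0 _); rewrite ?normr0 //; lra.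
rewrite -[derive1 (F n) t](subrK (derive1 (F n) 0)).
apply: le_trans (ler_normD _ _) _; have := d0 n.
have : C * `|t| <= C * `|A| by rewrite ler_wpM2l.
by lra.
Qed.

Lemma wsmooth_bd0 F (A : R) : wsmooth F ->
  exists C : R, forall n t, `|t| <= A -> `|F n t| <= C.
Proof.
move=> wF; have [sF HB _] := wF.
have [C HC] := wsmooth_bd1 `|A| wF; have [B0 HB0] := HB 0.
exists (B0 + C * `|A|) => n t tA.
have tA' : `|t| <= `|A| by apply: le_trans tA (ler_norm _).
have L : `|F n (0 + t) - F n 0| <= C * `|t|.
  apply: mean_value_ineq => y; rewrite subr0 => yt; split; first exact/smooth_derivable.
  by apply: HC; lra.
rewrite add0r in L.
have C0 : 0 <= C by apply: le_trans (HC 0%N 0 _); rewrite ?normr0.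
rewrite -[F n t](subrK (F n 0)).
apply: le_trans (ler_normD _ _) _; have := HB0 n.
have : C * `|t| <= C * `|A| by rewrite ler_wpM2l.
by lra.
Qed.

(** The class is stable under differentiation, so that the bounds of the
    preceding lemmas hold for derivatives of all orders. *)
Lemma wsmooth_derive F : wsmooth F -> wsmooth (fun n => derive1 (F n)).
Proof.
move=> wF; have [sF HB wS] := wF; split.
- by move=> n; exact: smooth_derive1.
- by move=> t; have [C HC] := wsmooth_bd1 `|t| wF; exists C => n; exact: HC.
- move=> e k He; have sS := wS e k He; have := smooth_derive1 sS.
  rewrite (_ : derive1 _ = fun t => ssum (fun n => e n * derive1 (F (k n)) t)) //.
  apply/funext => t; apply: is_derive1E.
  have [C HC] := gliding_hump (`|t| + 1) wF.
  apply: (@ssum_quad (fun n => F (k n)) e C).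
  + by move=> n; exact: sF.
  + exact: He.
  + by move=> x; have [B HB'] := HB x; exists B => n; exact: HB'.
  + by have [B HB'] := wsmooth_bd1 `|t| wF; exists B => n; exact: HB'.
  + move=> n h h1; apply: HC; apply: le_trans (ler_normD _ _) _.
    by rewrite lerD2l ltW.
Qed.

Lemma wsmooth_bd F i (A : R) : wsmooth F ->
  exists C : R, forall n t, `|t| <= A -> `|derive1n i (F n) t| <= C.
Proof.
elim: i F => [|i IHi] F wF; first exact: wsmooth_bd0.
have [C HC] := IHi _ (wsmooth_derive wF); exists C => n t tA.
by rewrite derive1Sn; exact: HC.
Qed.

(** This is what makes g |-> sum_n e_n g(s_n) a smooth function on a space of
    smooth functions, hence an admissible test in the definition of [wsm2]. *)
Lemma BS2_ssum F (s e : nat -> R) (A : R) : BS2 F ->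
  (forall n, `|s n| <= A) -> (forall n, `|e n| <= pw n) ->
  smooth (fun t => ssum (fun n => e n * F t (s n))).
Proof.
move=> BF Hs He; apply/ndiffP => m; elim: m F BF => //= m IHm F BF.
have D t : is_derive t 1 (fun t => ssum (fun n => e n * F t (s n)))
   (ssum (fun n => e n * derive1 (F^~ (s n)) t)).
  have A0 := normr_ge0 A.
  have sA n x : `|s n| <= `|A| + `|x| + 1.
    by have := normr_ge0 x; have := Hs n; have := ler_norm A; lra.
  have [C HC] := BS2_bounded (`|A| + `|t| + 1) (BS2_d1 (BS2_d1 BF)).
  apply: (@ssum_quad (fun n => F^~ (s n)) e C).
  + by move=> n; exact: BS2_smoothl.
  + exact: He.
  + move=> x; have [B HB] := BS2_bounded (`|A| + `|x| + 1) BF.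
    by exists B => n; apply: HB; [have := normr_ge0 x; lra|exact: sA].
  + have [B HB] := BS2_bounded (`|A| + `|t| + 1) (BS2_d1 BF).
    by exists B => n; apply: HB; [lra|exact: sA].
  + move=> n h h1; apply: HC; last exact: sA.
    by apply: le_trans (ler_normD _ _) _; lra.
split=> [t|]; first by have [] := D t.
rewrite (_ : derive1 _ = fun t => ssum (fun n => e n * derive1 (F^~ (s n)) t)).
  exact: (IHm _ (BS2_d1 BF)).
by apply/funext => t; exact: is_derive1E (D t).
Qed.

(** Families t |-> K t of smooth functions that are smooth in t when tested
    against the functionals g |-> sum_n e_n g^(j)(s_n); nothing is assumed
    about t and s jointly. *)
Definition wsm2 (K : R -> R -> R) :=
  (forall t, smooth (K t)) /\
  forall j (s : nat -> R) (A : R), (forall n, `|s n| <= A) ->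
    wsmooth (fun n t => derive1n j (K t) (s n)).

Lemma wsm2_d2 K : wsm2 K -> wsm2 (fun t => derive1 (K t)).
Proof.
move=> [sK wK]; split=> [t|j s A Hs]; first exact: smooth_derive1.
have := wK j.+1 s A Hs.
by congr wsmooth; apply/funext => n; apply/funext => t; rewrite derive1Sn.
Qed.

Lemma wsm2_bd K i (A : R) : wsm2 K ->
  exists C : R, forall t s, `|t| <= A -> `|s| <= A -> `|derive1n i (K^~ s) t| <= C.
Proof.
move=> [_ wK]; apply: contrapT => N.
have /choice[p Hp] : forall n : nat, exists p : R * R,
    [/\ `|p.1| <= A, `|p.2| <= A & n%:R < `|derive1n i (K^~ p.2) p.1|].
  move=> n; apply: contrapT => N'; apply: N; exists n%:R => t s tA sA.
  by rewrite leNgt; apply/negP => L; apply: N'; exists (t, s).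
have Hs n : `|(p n).2| <= A by have [] := Hp n.
have [C HC] := wsmooth_bd i A (wK 0%N _ A Hs).
have [_ _ L] := Hp (Num.bound `|C|).
have := HC (Num.bound `|C|) (p (Num.bound `|C|)).1.
have [-> _ _] := Hp (Num.bound `|C|); move=> /(_ isT).
rewrite leNgt => /negP; apply; apply: lt_trans L.
by apply: le_lt_trans (ler_norm _) (archi_boundP _).
Qed.

Lemma is_derive_lip f t l (C d : R) : 0 < d -> is_derive t 1 f l ->
  (forall h, `|h| < d -> `|f (t + h) - f t| <= C * `|h|) -> `|l| <= C.
Proof.
move=> d0 [df <-] H; rewrite leNgt; apply/negP => L.
have /cvgrPdist_lt /(_ (`|'D_1 f t| - C)) := df.
rewrite subr_gt0 => /(_ L) /= /nbhs_ballP[r /= r0 Hr].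
pose h := Num.min (r / 2) (d / 2).
have h0 : 0 < h by rewrite lt_min !divr_gt0.
have hd : `|h| < d.
  rewrite gtr0_norm //; apply: le_lt_trans (_ : d / 2 < _); last by lra.
  by rewrite /h ge_min lexx orbT.
have hr : ball 0 r h.
  rewrite /ball /= sub0r normrN gtr0_norm //; apply: le_lt_trans (_ : r / 2 < _); last by lra.
  by rewrite /h ge_min lexx.
have := Hr h hr (lt0r_neq0 h0); rewrite /shift /= /GRing.scale /= mulr1 [h + t]addrC.
apply/negP; rewrite -leNgt lerBlDr.
set D := lim _; have := H h hd; set y := f (t + h) - f t => Hy.
rewrite -lerBlDl; apply: le_trans (_ : `|h^-1 * y| <= _); last first.
  by rewrite normrM normfV ler_pdivrMl ?normr_gt0 ?gt_eqF // mulrC.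
have -> : D = 'D_1 f t by [].
rewrite lerBlDr addrC -[X in `|X| <= _](subrK (h^-1 * y)).
exact: ler_normD.
Qed.

(** The two derivatives may be exchanged because the Taylor error in s is
    Lipschitz in t, by the bounds of [wsm2_bd]. *)
Lemma wsm2_d12 K t (s : R) : wsm2 K ->
  is_derive s 1 (fun s => derive1 (K^~ s) t)
    (derive1 ((fun t => derive1 (K t))^~ s) t).
Proof.
move=> wK; have [sK _] := wK.
have wK1 := wsm2_d2 wK; have wK2 := wsm2_d2 wK1.
have [C HC] := wsm2_bd 1 (`|t| + `|s| + 1) wK2.
have t0 := normr_ge0 t; have s0 := normr_ge0 s.
have smt K' s' : wsm2 K' -> smooth (K'^~ s').
  move=> [_ /(_ 0%N (fun=> s') `|s'|)] [//|/(_ 0%N)].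
  by [].
apply: (@is_derive_quad _ _ _ _ C 1) => // k k1.
pose E t := K t (s + k) - K t s - k * derive1 (K t) s.
have DE : is_derive t 1 E (derive1 (K^~ (s + k)) t - derive1 (K^~ s) t -
     k * derive1 ((fun t => derive1 (K t))^~ s) t).
  have D1 := smooth_is_derive t (smt _ (s + k) wK).
  have D2 := smooth_is_derive t (smt _ s wK).
  have D3 := smooth_is_derive t (smt _ s wK1).
  have D4 := @is_deriveM1 _ (fun=> k) _ _ _ _ (is_derive_cst k t 1) D3.
  have := is_deriveB (is_deriveB D1 D2) D4.
  by congr (is_derive _ _ _ _); rewrite mulr0 addr0.
apply: (is_derive_lip ltr01 DE) => h h1.
pose g s := K (t + h) s - K t s.
have sg : smooth g := smoothB (sK _) (sK _).
have g1 y : derive1 g y = derive1 (K (t + h)) y - derive1 (K t) y.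
  apply: is_derive1E.
  exact: (is_deriveB (smooth_is_derive y (sK _)) (smooth_is_derive y (sK _))).
have g2 y : derive1n 2 g y = derive1n 2 (K (t + h)) y - derive1n 2 (K t) y.
  have {}g1 : derive1 g = (fun y => derive1 (K (t + h)) y - derive1 (K t) y).
    exact/funext.
  change (derive1 (derive1 g) y = derive1 (derive1 (K (t + h))) y - derive1 (derive1 (K t)) y).
  rewrite g1; apply: is_derive1E.
  exact: (is_deriveB (smooth_is_derive y (smooth_derive1 (sK _)))
    (smooth_is_derive y (smooth_derive1 (sK _)))).
have := @taylor2 g s (C * `|h|) 1 sg _ k k1.
rewrite g1 /g => T.
rewrite (_ : E (t + h) - E t = K (t + h) (s + k) - K t (s + k) - (K (t + h) s - K t s) -
  k * (derive1 (K (t + h)) s - derive1 (K t) s)); last by rewrite /E; ring.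
rewrite mulrAC; apply: T => h' h'1; rewrite g2.
apply: (@mean_value_ineq _ (fun t => derive1n 2 (K t) (s + h'))) => y yh; split.
  exact/smooth_derivable/(smt _ _ wK2).
apply: HC.
  by rewrite -[y](subrK t); apply: le_trans (ler_normD _ _) _; lra.
by apply: le_trans (ler_normD _ _) _; lra.
Qed.

Lemma wsm2_d2n K j : wsm2 K -> wsm2 (fun t => derive1n j (K t)).
Proof.
elim: j K => [K wK|j IHj K wK]; first exact: wK.
have := IHj _ (wsm2_d2 wK); congr wsm2; apply/funext => t.
by rewrite derive1Sn.
Qed.

Lemma wsm2_d1 K : wsm2 K -> wsm2 (fun t s => derive1 (K^~ s) t).
Proof.
move=> wK.
have E t j : derive1n j (fun s => derive1 (K^~ s) t) =
    (fun s => derive1 ((fun t => derive1n j (K t))^~ s) t).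
  elim: j => [|j IHj]; first by [].
  rewrite derive1nS IHj; apply/funext => s.
  apply: is_derive1E; have := @wsm2_d12 _ t s (wsm2_d2n j wK).
  by [].
split=> [t|j s A Hs].
  apply: (@smooth_coind _ (fun g => exists j, g =
     (fun s => derive1 ((fun t => derive1n j (K t))^~ s) t))); last by exists 0%N.
  move=> _ [j ->]; exists (fun s => derive1 ((fun t => derive1n j.+1 (K t))^~ s) t).
    by exists j.+1.
  by move=> s; exact: (@wsm2_d12 _ t s (wsm2_d2n j wK)).
rewrite (_ : (fun n t => _) = fun n => derive1 (fun t => derive1n j (K t) (s n))).
  by apply: wsmooth_derive; exact: wK.2 Hs.
by apply/funext => n; apply/funext => t; rewrite E.
Qed.

Lemma wsm2_diag_derive K t : wsm2 K -> is_derive t 1 (fun t => K t t)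
  (derive1 (K^~ t) t + derive1 (K t) t).
Proof.
move=> wK; have [sK _] := wK.
have wK1 := wsm2_d2 wK; have wK2 := wsm2_d2 wK1.
have smt K' s' : wsm2 K' -> smooth (K'^~ s').
  move=> [_ /(_ 0%N (fun=> s') `|s'|)] [//|/(_ 0%N)].
  by [].
pose A := `|t| + 1.
have [C1 H1] := wsm2_bd 0 A wK2; have [C2 H2] := wsm2_bd 1 A wK1.
have [C3 H3] := wsm2_bd 2 A wK.
have in1 h : `|h| < 1 -> `|t + h| <= A.
  by move=> h1; apply: le_trans (ler_normD _ _) _; rewrite /A; lra.
have tA : `|t| <= A by rewrite /A; lra.
apply: (@is_derive_quad _ _ _ _ (C1 + C2 + C3) 1) => // h h1.
have T1 : `|K (t + h) (t + h) - K (t + h) t - h * derive1 (K (t + h)) t| <= C1 * h ^+ 2.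
  apply: (@taylor2 _ _ _ 1 (sK _)) => // y y1.
  by apply: (H1 (t + h) (t + y)); apply: in1.
have T2 : `|derive1 (K (t + h)) t - derive1 (K t) t| <= C2 * `|h|.
  apply: (@mean_value_ineq _ (fun x => derive1 (K x) t)) => y yh; split.
    exact/smooth_derivable/(smt _ _ wK1).
  apply: H2 => //; rewrite -[y](subrK t) addrC; apply: in1; lra.
have T3 : `|K (t + h) t - K t t - h * derive1 (K^~ t) t| <= C3 * h ^+ 2.
  apply: (@taylor2 (K^~ t) _ _ 1 (smt _ _ wK)) => // y y1.
  by apply: H3 => //; exact: in1.
rewrite (_ : _ - h * _ = (K (t + h) (t + h) - K (t + h) t - h * derive1 (K (t + h)) t) +
   h * (derive1 (K (t + h)) t - derive1 (K t) t) +
   (K (t + h) t - K t t - h * derive1 (K^~ t) t)); last by ring.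
apply: le_trans (ler_normD _ _) _; rewrite mulrDl; apply: lerD T3.
apply: le_trans (ler_normD _ _) _; rewrite mulrDl; apply: lerD T1 _.
rewrite normrM -[h ^+ 2]real_normK ?num_real // expr2 mulrA [_ * `|h|]mulrC.
by rewrite ler_wpM2l.
Qed.

(** The scalar core of cartesian closedness.  By [wsm2_diag_derive] the
    derivative of a diagonal is a sum of two diagonals of families of the same
    kind. *)
Theorem wsm2_diag K : wsm2 K -> smooth (fun t => K t t).
Proof.
move=> wK; apply/ndiffP => n; elim: n K wK => //= n IHn K wK.
have D t := wsm2_diag_derive t wK.
split=> [t|]; first by have [] := D t.
rewrite (_ : derive1 _ = (fun t => derive1 (K^~ t) t) \+ (fun t => derive1 (K t) t)).
  apply: ndiffD; first exact: (IHn _ (wsm2_d1 wK)).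
  exact: (IHn _ (wsm2_d2 wK)).
by apply/funext => t; exact: is_derive1E (D t).
Qed.

End Hump.

Local Open Scope quotient_scope.

(** * Taylor expansion in rings of smooth functions *)

Section Cinf.
Variable R : realType.
Local Notation Cinf := (Cinf R).
Local Notation euclid := (euclid R).
Local Notation line := (line R).

Lemma curves_euclid n (c : R -> 'rV[R]_n) :
  @curves R (euclid n) c <-> forall i, smooth (fun s => c s 0 i).
Proof.
split=> [H i|H g [i _ <-]]; last exact: H.
by have := H (fun v => v 0 i); apply; exists i.
Qed.

Lemma curves_line (c : R -> R) : @curves R line c <-> smooth c.
Proof. by split=> [H|H g ->]; [exact: (H id)|exact: H]. Qed.

Lemma curves_fprod (X Y : frolicher R) (c : R -> X * Y) :
  @curves R (fprod X Y) c <->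
  curves (fun s => (c s).1) /\ curves (fun s => (c s).2).
Proof.
split=> [H|[H1 H2] g [[f Ff <-]|[f Ff <-]]].
- split; apply/curvesP => f Ff.
    by apply: (H (fun z => f z.1)); left; exists f.
  by apply: (H (fun z => f z.2)); right; exists f.
- exact: (curvesP _).1 H1 f Ff.
- exact: (curvesP _).1 H2 f Ff.
Qed.

Lemma curves_comp (X : frolicher R) (c : R -> X) (a : R -> R) :
  curves c -> smooth a -> curves (c \o a).
Proof.
move=> cc sa; apply/curvesP => f Ff.
exact: (smooth_comp ((curvesP c).1 cc f Ff) sa).
Qed.

Section Ops.
Variable n : nat.
Implicit Types (g : 'rV[R]_n -> R) (k : R -> 'rV[R]_n -> R) (x : 'rV[R]_n).

Definition unit_vec (i : 'I_n) : 'rV[R]_n := delta_mx 0 i.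
Local Notation e := unit_vec.

(** One-parameter families of functions on R^n that are smooth when the
    parameter and the point both move along smooth curves. *)
Definition jsm k := forall (a : R -> R) (c : R -> 'rV[R]_n),
  smooth a -> @curves R (euclid n) c -> smooth (fun s => k (a s) (c s)).

Lemma jsm_cst (f : Cinf n) : jsm (fun _ x => f x).
Proof. by move=> a c _ cc; exact: Cinf_smooth. Qed.

(** The quotient (g(x + z e_i) - g(x)) / z, for z = 0 the partial derivative. *)
Definition had i g x (z : R) : R := hquot (fun=> fun t => g (x + t *: e i)) 0 z.

Lemma curve_shift i (c : R -> 'rV[R]_n) (z : R -> R) :
  @curves R (euclid n) c -> smooth z -> @curves R (euclid n) (fun s => c s + z s *: e i).
Proof.
move=> /curves_euclid cc sz; apply/curves_euclid => j.
rewrite (_ : (fun s => _) = (fun s => c s 0 j) \+ (fun s => (j == i)%:R * z s)).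
  exact: (smoothD (cc j) (smoothZ _ sz)).
by apply/funext => s; rewrite !mxE eqxx mulrC.
Qed.

Lemma had_BS2 i k (a : R -> R) (c : R -> 'rV[R]_n) : jsm k -> smooth a ->
  @curves R (euclid n) c -> BS2 (fun u t => k (a u) (c u + t *: e i)).
Proof.
move=> H sa cc u t su st; apply: (H (a \o u)); first exact: smooth_comp.
apply: (@curve_shift i (c \o u)) st; exact: (curves_comp cc su).
Qed.

Lemma had_eq i g g' x z : (forall t, g (x + t *: e i) = g' (x + t *: e i)) ->
  had i g x z = had i g' x z.
Proof.
move=> H; have E : (fun t => g (x + t *: e i)) = (fun t => g' (x + t *: e i)).
  by apply/funext.
by rewrite /had E.
Qed.

Lemma hadE i (f : Cinf n) x z : f (x + z *: e i) - f x = z * had i f x z :> R.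
Proof.
have B : BS2 (fun _ t : R => (f (x + t *: e i) : R)).
  apply: (@had_BS2 i (fun _ x => f x) (fun=> 0) (fun=> x)).
  - exact: jsm_cst.
  - exact: smooth_cst.
  - by apply/curves_euclid => j; exact: smooth_cst.
by have := hquotE 0 z B; rewrite scale0r addr0.
Qed.

Lemma had_smooth i k (a z : R -> R) (c : R -> 'rV[R]_n) : jsm k -> smooth a ->
  smooth z -> @curves R (euclid n) c -> smooth (fun s => had i (k (a s)) (c s) (z s)).
Proof.
move=> H sa sz cc; have B := hquot_BS2 (@had_BS2 i k a c H sa cc).
exact: (B id z (@smooth_id R) sz).
Qed.

(** The restriction to x_i = 0, and below the quotient by x_i of what it
    leaves over. *)
Definition res i g x : R := g (x - x 0 i *: e i).
Definition dquot i g x : R := had i g (x - x 0 i *: e i) (x 0 i).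

Lemma curve_zero i (c : R -> 'rV[R]_n) : @curves R (euclid n) c ->
  @curves R (euclid n) (fun s => c s - c s 0 i *: e i).
Proof.
move=> cc; under eq_fun do rewrite -scaleNr.
by apply: (curve_shift cc); apply: smoothN; exact: (curves_euclid c).1.
Qed.

Lemma jsm_res i k : jsm k -> jsm (fun s => res i (k s)).
Proof.
move=> H a c sa cc; apply: H; first exact: sa.
exact: curve_zero.
Qed.

Lemma jsm_dquot i k : jsm k -> jsm (fun s => dquot i (k s)).
Proof.
move=> H a c sa cc; apply: (had_smooth H sa); first exact: (curves_euclid c).1.
exact: curve_zero.
Qed.

Lemma res_dquot i (f : Cinf n) x : f x = res i f x + x 0 i * dquot i f x :> R.
Proof. by rewrite /dquot /res -hadE subrK addrC subrK. Qed.

Definition indep i g := forall x z, g (x + z *: e i) = g x.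

Lemma indep_res i g : indep i (res i g).
Proof.
move=> x z; rewrite /res; congr g; rewrite !mxE !eqxx mulr1 scalerDl opprD.
by rewrite addrACA subrr addr0.
Qed.

Lemma indep_res_pres i j g : indep i g -> indep i (res j g).
Proof.
move=> H x z; have [->|ij] := eqVneq i j; first exact: indep_res.
rewrite /res -[RHS](H _ z); congr g; rewrite !mxE eqxx eq_sym (negbTE ij) mulr0 addr0.
by rewrite addrAC.
Qed.

Lemma had_const i g x z z' : indep i g -> had i g x z = had i g x z'.
Proof.
move=> H; rewrite /had /hquot.
have -> : derive1 (fun t => g (x + t *: e i)) = (fun=> 0).
  apply/funext => t; rewrite (_ : (fun t => _) = (fun=> g x)) ?derive1_cst //.
  by apply/funext => s; rewrite H.
by [].
Qed.

Lemma indep_dquot i j g : indep i g -> indep i (dquot j g).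
Proof.
have [->|ij] := eqVneq i j => H x z; rewrite /dquot.
  rewrite (_ : x + z *: e j - _ = x - x 0 j *: e j).
    exact: had_const.
  rewrite !mxE !eqxx mulr1 scalerDl opprD.
  by rewrite addrACA subrr addr0.
rewrite !mxE eqxx eq_sym (negbTE ij) mulr0 addr0 [x + _ + _]addrAC.
rewrite /had (_ : (fun t => _) = fun t => g (x - x 0 j *: e j + t *: e j)) //.
by apply/funext => t; rewrite [_ + z *: _ + _]addrAC H.
Qed.

Lemma indep_all (f : 'rV[R]_n -> R) : (forall i, indep i f) -> forall x, f x = f 0.
Proof.
move=> H x; rewrite [x]row_sum_delta.
elim/big_rec: _ => // i y _; rewrite addrC => <-; exact: H.
Qed.

(** Taylor coefficients are obtained by iterating restrictions and quotients.
    Since these preserve jointly smooth families, the coefficients of a family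
    depend smoothly on its parameter. *)
Record jop := Jop {
  jfun :> ('rV[R]_n -> R) -> 'rV[R]_n -> R ;
  jopP : forall k, jsm k -> jsm (fun s => jfun (k s)) }.

Fact japp_subproof (o : jop) (f : Cinf n) (c : R -> 'rV[R]_n) :
  @curves R (euclid n) c -> smooth (o f \o c).
Proof. by move=> cc; exact: (@jopP o _ (@jsm_cst f) _ c (@smooth_cst _ 0) cc). Qed.
Definition japp (o : jop) (f : Cinf n) : Cinf n := Cinf_mk (@japp_subproof o f).

Definition jid : jop := @Jop id (fun k H => H).
Definition jcomp (o o' : jop) : jop := @Jop (o \o o') (fun k H => @jopP o _ (@jopP o' k H)).
Definition jres i : jop := @Jop (res i) (@jsm_res i).
Definition jdquot i : jop := @Jop (dquot i) (@jsm_dquot i).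

Lemma res_dquotC i (f : Cinf n) : f = japp (jres i) f + coord R i * japp (jdquot i) f.
Proof. by apply: smap_eq => x /=; exact: res_dquot. Qed.

End Ops.

Section Taylor.
Variables (n : nat) (J : idealr (Cinf n)).
Hypothesis sqJ : forall i, coord R i ^+ 2 \in J.
Local Notation e := (@unit_vec n).

(** Expand in the variables of L one after the other: f is its restriction to
    x_i = 0 plus x_i q, and modulo x_i^2 the function q may be replaced by its
    own restriction.  The operators involve the variables of L only, which is
    the content of the three clauses on independence and locality. *)
Lemma taylor_seq (L : seq 'I_n) : exists P : seq (Cinf n * jop n),
  [/\ forall p, List.In p P -> forall g i, indep i g -> indep i (p.2 g),
      forall p, List.In p P -> forall g i, i \in L -> indep i (p.2 g),
      forall p, List.In p P -> forall g g' (x : 'rV[R]_n), (forall z : 'rV[R]_n,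
        (forall j, j \notin L -> z 0 j = x 0 j) -> g z = g' z) -> p.2 g x = p.2 g' x &
      forall f, f - \sum_(p <- P) p.1 * japp p.2 f \in J].
Proof.
elim: L => [|i L [P [H1 H2 HL H3]]].
  exists [:: (1, jid n)]; split=> [p [<-|//] g i gi|p _ g i|p [<-|//] g g' x H|f].
  - exact: gi.
  - by rewrite in_nil.
  - exact: H.
  rewrite big_seq1 mul1r (_ : japp _ _ = f) ?subrr ?rpred0 //.
  exact: smap_eq.
exists ([seq (p.1, jcomp p.2 (jres i)) | p <- P] ++
        [seq (coord R i * p.1, jcomp p.2 (jcomp (jres i) (jdquot i))) | p <- P]).
split.
- move=> p /(List.in_app_or _ _ _) => -[] /(List.in_map_iff _ _ _).1 => -[q [<- qP]] g j gj /=.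
    by apply: (H1 q qP); apply: indep_res_pres.
  by apply: (H1 q qP); apply: indep_res_pres; apply: indep_dquot.
- move=> p /(List.in_app_or _ _ _) => -[] /(List.in_map_iff _ _ _).1 => -[q [<- qP]] g j /=;
    rewrite inE => /orP[/eqP ->|jL]; try exact: (H2 q qP);
    by apply: (H1 q qP); apply: indep_res.
- have off (g g' : 'rV[R]_n -> R) (x z : 'rV[R]_n) w : (forall z : 'rV[R]_n, (forall j, j \notin i :: L -> z 0 j = x 0 j) -> g z = g' z) ->
      (forall j, j \notin L -> z 0 j = x 0 j) -> g (z + w *: e i) = g' (z + w *: e i).
    move=> H Hz; apply: H => j; rewrite inE negb_or => /andP[ji jL].
    by rewrite !mxE eqxx (negbTE ji) mulr0 addr0; exact: Hz.
  move=> p /(List.in_app_or _ _ _) => -[] /(List.in_map_iff _ _ _).1 => -[q [<- qP]] g g' x H /=;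
    apply: (HL q qP) => z Hz; rewrite /res -scaleNr.
    exact: off H Hz.
  rewrite /dquot; apply: had_eq => t.
  by rewrite -scaleNr -!addrA -!scalerDl; exact: off H Hz.
- move=> f; rewrite big_cat !big_map /=.
  have E1 := H3 (japp (jres i) f).
  have E2 := H3 (japp (jres i) (japp (jdquot i) f)).
  have E3 : coord R i * (japp (jdquot i) f - japp (jres i) (japp (jdquot i) f)) * coord R i \in J.
    rewrite mulrAC -expr2 mulrC idealMr //; exact: sqJ.
  have E4 : f - japp (jres i) f - coord R i * japp (jres i) (japp (jdquot i) f) \in J.
    have -> : f - japp (jres i) f - coord R i * japp (jres i) (japp (jdquot i) f) =
      coord R i ^+ 2 * japp (jdquot i) (japp (jdquot i) f).
      rewrite {1}(res_dquotC i f) [_ + _ - japp _ _]addrAC subrr add0r -mulrBr.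
      rewrite {1}(res_dquotC i (japp (jdquot i) f)) [_ + _ - _]addrAC subrr add0r.
      by rewrite mulrA expr2.
    by rewrite mulrC idealMr //; exact: sqJ.
  have := rpredD (rpredD E4 E1) (idealMr (coord R i) E2).
  congr (_ \in J); rewrite mulrBr mulr_sumr.
  have -> : \sum_(p <- P) coord R i * (p.1 * japp p.2 (japp (jres i) (japp (jdquot i) f))) =
    \sum_(p <- P) coord R i * p.1 * japp (jcomp p.2 (jcomp (jres i) (jdquot i))) f.
    by apply: eq_bigr => p _; rewrite mulrA; congr (_ * _); exact: smap_eq.
  have -> : \sum_(p <- P) p.1 * japp p.2 (japp (jres i) f) =
    \sum_(p <- P) p.1 * japp (jcomp p.2 (jres i)) f.
    by apply: eq_bigr => p _; congr (_ * _); exact: smap_eq.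
  set a := japp _ f; set b := _ * japp _ _; set S1 := \sum_(p <- P) _; set S2 := \sum_(p <- P) _.
  ring.
Qed.

(** When all variables are expanded, the coefficients are constants. *)
Lemma taylor_sq : exists P : seq (Cinf n * jop n),
  forall f : Cinf n, f - \sum_(p <- P) (p.2 f 0) *: p.1 \in J.
Proof.
have [P [_ H2 _ H3]] := taylor_seq (enum 'I_n).
exists P => f; have := H3 f; congr (_ - _ \in J).
have : forall p, List.In p P -> p.1 * japp p.2 f = p.2 f 0 *: p.1.
  move=> p pP; apply: smap_eq => x /=; rewrite mulrC; congr (_ * _).
  by apply: indep_all => i; apply: (H2 p pP); rewrite mem_enum.
elim: P {H2 H3} => [|p P IHP] H; first by rewrite !big_nil.
rewrite !big_cons H; last by left.
by rewrite IHP // => q qP; apply: H; right.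
Qed.

End Taylor.

(** Set the variables to zero one at a time; each step changes the function by
    a multiple of a coordinate. *)
Lemma hadamard0 n (f : Cinf n) : exists g : 'I_n -> Cinf n,
  f = Cinf_cst n (f 0 : R) + \sum_i coord R i * g i.
Proof.
have H (L : seq 'I_n) : exists (h : Cinf n) (g : 'I_n -> Cinf n),
   [/\ f = h + \sum_i coord R i * g i, h 0 = f 0 & forall i, i \in L -> indep i h].
  elim: L => [|i L [h [g [E h0 HL]]]].
    exists f, (fun=> 0); split=> //.
    by rewrite big1 ?addr0 // => i _; rewrite mulr0.
  exists (japp (jres i) h), (fun j => g j + (j == i)%:R * japp (jdquot i) h); split.
  - rewrite {1}E {1}(res_dquotC i h) -addrA; congr (_ + _).
    under [RHS]eq_bigr do rewrite mulrDr.
    rewrite big_split /= addrC; congr (_ + _).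
    rewrite (bigD1 i) //= eqxx mul1r big1 ?addr0 // => j ji.
    by rewrite (negbTE ji) mul0r mulr0.
  - by rewrite /= /res mxE scale0r subr0.
  - move=> j; rewrite inE => /orP[/eqP ->|jL]; first exact: indep_res.
    by apply: indep_res_pres; apply: HL.
have [h [g [E h0 HL]]] := H (enum 'I_n).
exists g; rewrite {1}E; congr (_ + _); apply: smap_eq => x /=; rewrite -h0.
by apply: indep_all => i; apply: HL; rewrite mem_enum.
Qed.

Definition ccomp n m (f : Cinf n) (g : smap (euclid m) (euclid n)) : Cinf m :=
  scomp f g.

(** Change one coordinate at a time and apply the difference quotient in that
    coordinate. *)
Lemma Cinf_congr n m (J : idealr (Cinf m)) (f : Cinf n) (g g' : 'I_n -> Cinf m) :
  (forall i, g i - g' i \in J) ->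
  ccomp f (srow g) - ccomp f (srow g') \in J.
Proof.
move=> H.
pose h (L : seq 'I_n) i := if i \in L then g' i else g i.
suff HL (L : seq 'I_n) : ccomp f (srow g) - ccomp f (srow (h L)) \in J.
  have := HL (enum 'I_n); congr (_ - _ \in J); apply: smap_eq => x.
  by congr (f _); apply/rowP => i; rewrite !mxE /h mem_enum.
elim: L => [|i L IHL].
  rewrite (_ : ccomp f (srow (h [::])) = ccomp f (srow g)) ?subrr ?rpred0 //.
rewrite -[X in X - _](subrK (ccomp f (srow (h L)))) -addrA; apply: (rpredD IHL).
have [iL|iL] := boolP (i \in L).
  rewrite (_ : ccomp f (srow (h (i :: L))) = ccomp f (srow (h L))) ?subrr ?rpred0 //.
  apply: smap_eq => x; congr (f _); apply/rowP => j; rewrite !mxE /h inE.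
  by have [->|//] := eqVneq j i; rewrite iL.
pose z : Cinf m := g i - g' i.
pose p := srow (h (i :: L)).
have rs (c : R -> 'rV[R]_m) : @curves R (euclid m) c ->
    smooth ((fun x => had i f (p x) (z x)) \o c).
  move=> cc; apply: (@had_smooth n i (fun=> f) (fun=> 0) (z \o c) (p \o c)).
  - exact: jsm_cst.
  - exact: smooth_cst.
  - exact: Cinf_smooth.
  - exact: (smap_smooth p).
rewrite (_ : _ - _ = Cinf_mk rs * z); first by apply: idealMr; exact: H.
have E (x : 'rV[R]_m) : f (srow (h L) x) - f (p x) = (z x : R) * had i f (p x) (z x) :> R.
  rewrite -hadE; congr ((f _ : R) - _); apply/rowP => j; rewrite !mxE eqxx /h inE.
  have [->|ji] := eqVneq j i; last by rewrite mulr0 addr0.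
  by rewrite (negbTE iL) mulr1 /z /= mulN1r addrC subrK.
by apply: smap_eq => x; rewrite /= mulN1r mulrC; exact: E.
Qed.

End Cinf.

(** * Jets and their functoriality *)

Section Quot.
Variable R : realType.
Local Notation Cinf := (Cinf R).
Local Notation euclid := (euclid R).
Local Notation line := (line R).
Local Notation wpres := (wpres R).

Lemma Cinf_subE n (f g : Cinf n) x : (f - g) x = (f x : R) - (g x : R) :> R.
Proof. by rewrite /= mulN1r. Qed.

Section Walg.
Variable W : wpres.
Local Notation n := (wdim W).

Lemma walg_eqP (f g : Cinf n) :
  f - g \in wideal W <-> \pi_(walg W) f = \pi_(walg W) g.
Proof. by rewrite Quotient.idealrBE; split=> [/eqP|/eqP]. Qed.

Lemma walg_pi0 (f : Cinf n) : f \in wideal W -> \pi_(walg W) f = 0.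
Proof.
move=> fI; have /walg_eqP : f - 0 \in wideal W by rewrite subr0.
by move=> ->; rewrite rmorph0.
Qed.

Lemma walg_piZ a (f : Cinf n) : \pi_(walg W) (a *: f) = a *: \pi_(walg W) f.
Proof. by rewrite [RHS]qscale_pi. Qed.

End Walg.

Section Pullback.
Variables (W W' : wpres) (g : smap (euclid (wdim W')) (euclid (wdim W))).
Hypothesis Hg : forall f, f \in wideal W -> ccomp f g \in wideal W'.

(** The algebra map induced by a map g of infinitesimal objects; it is indexed
    by the compatibility proof so that the morphism structure can be attached
    to it. *)
Definition gstar & (forall f, f \in wideal W -> ccomp f g \in wideal W') :=
  fun w : walg W => \pi_(walg W') (ccomp (repr w) g).

Lemma gstar_pi f : gstar Hg (\pi_(walg W) f) = \pi_(walg W') (ccomp f g).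
Proof.
apply/walg_eqP; have : ccomp (repr (\pi_(walg W) f) - f) g \in wideal W'.
  by apply: Hg; apply/walg_eqP; rewrite reprK.
by congr (_ \in wideal W'); apply: smap_eq.
Qed.

Fact gstar_zmod : zmod_morphism (gstar Hg).
Proof.
move=> x y; rewrite -[x]reprK -[y]reprK -rmorphB !gstar_pi -rmorphB.
by congr (\pi _); apply: smap_eq.
Qed.
HB.instance Definition _ := GRing.isZmodMorphism.Build _ _ (gstar Hg) gstar_zmod.

Fact gstar_monoid : monoid_morphism (gstar Hg).
Proof.
split=> [|x y].
  have -> : (1 : walg W) = \pi 1 by rewrite rmorph1.
  rewrite gstar_pi (_ : ccomp 1 g = 1) ?rmorph1 //; exact: smap_eq.
rewrite -[x]reprK -[y]reprK -rmorphM !gstar_pi -rmorphM.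
by congr (\pi _); apply: smap_eq.
Qed.
HB.instance Definition _ := GRing.isMonoidMorphism.Build _ _ (gstar Hg) gstar_monoid.

Fact gstar_scalable : scalable (gstar Hg).
Proof.
move=> a x; rewrite -[x]reprK -walg_piZ !gstar_pi -walg_piZ.
by congr (\pi _); apply: smap_eq.
Qed.
HB.instance Definition _ := GRing.isScalable.Build R _ _ _ (gstar Hg) gstar_scalable.

End Pullback.

Section Jets.
Variables (X : frolicher R) (W : wpres).
Local Notation n := (wdim W).

(** Composition with a function, with values in the ring of smooth functions
    rather than in a bare set of maps. *)
Definition hc m (h : smap X line) (f : smap (euclid m) X) : Cinf m := scomp h f.

Lemma jet_eqP (f g : smap (euclid n) X) :
  \pi_(jets X W) f = \pi_(jets X W) g <->
  f 0 = g 0 /\ forall h, hc h f - hc h g \in wideal W.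
Proof.
split.
- by move/eqquotP => /asboolP.
- by move=> H; apply/eqquotP; apply/asboolP.
Qed.

Lemma jet_evalE h (f : smap (euclid n) X) :
  jet_eval h (\pi_(jets X W) f) = \pi_(walg W) (hc h f).
Proof.
apply/walg_eqP; have /jet_eqP[_ H] : \pi_(jets X W) (repr (\pi_(jets X W) f)) = \pi f.
  by rewrite reprK.
exact: H.
Qed.

Lemma footE (f : smap (euclid n) X) : foot (\pi_(jets X W) f : prol X W) = f 0.
Proof.
have /jet_eqP[H _] : \pi_(jets X W) (repr (\pi_(jets X W) f)) = \pi f by rewrite reprK.
exact: H.
Qed.

Lemma prol_ind (P : prol X W -> Prop) :
  (forall f : smap (euclid n) X, P (\pi_(jets X W) f)) -> forall u, P u.
Proof. by move=> H u; rewrite -[u](@reprK _ (jets X W)); exact: H. Qed.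

Lemma foot_zero (x : X) : foot (zero_jet W x) = x.
Proof. exact: footE. Qed.

End Jets.

Lemma smoothenE (X Y : frolicher R) (f0 g : smap X Y) : smoothen f0 g = g.
Proof.
rewrite /smoothen; case: pselect => [pg|]; first exact: smap_eq.
by case; exact: smap_smooth.
Qed.

Lemma smoothenP (X Y : frolicher R) (f0 : smap X Y) (g : X -> Y) (sg : smooth_map g) :
  smoothen f0 g = Smap sg.
Proof. exact: (smoothenE f0 (Smap sg)). Qed.

Lemma hcA (X Y : frolicher R) n (h : smap Y line) (F : smap X Y) (f : smap (euclid n) X) :
  hc h (scomp F f) = hc (scomp h F) f.
Proof. exact: smap_eq. Qed.

Lemma prol_mapE (X Y : frolicher R) (W : wpres) (F : smap X Y) (f : smap (euclid (wdim W)) X) :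
  prol_map F (\pi_(jets X W) f : prol X W) = \pi_(jets Y W) (scomp F f).
Proof.
rewrite /prol_map; set r := repr _.
have /jet_eqP[H0 H] : \pi_(jets X W) r = \pi f by rewrite reprK.
rewrite (smoothenE _ (scomp F r)); apply/jet_eqP; split; first by rewrite /= H0.
by move=> h; rewrite !hcA; exact: H.
Qed.

Lemma prol_map_comp (X Y Z : frolicher R) (W : wpres) (F : smap X Y) (G : smap Y Z)
  (u : prol X W) : prol_map G (prol_map F u) = prol_map (scomp G F) u.
Proof.
elim/prol_ind: u => f; rewrite !prol_mapE.
by congr (\pi _); apply: smap_eq.
Qed.

Lemma foot_map (X Y : frolicher R) (W : wpres) (F : smap X Y) (u : prol X W) :
  foot (prol_map F u) = F (foot u).
Proof. by elim/prol_ind: u => f; rewrite prol_mapE !footE. Qed.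

Section Pull.
Variables (W W' : wpres) (g : smap (euclid (wdim W')) (euclid (wdim W))).
Hypothesis Hg : forall f, f \in wideal W -> ccomp f g \in wideal W'.
Hypothesis g0 : g 0 = 0.

Lemma pullE (X : frolicher R) (f : smap (euclid (wdim W)) X) :
  pull g (\pi_(jets X W) f : prol X W) = \pi_(jets X W') (scomp f g).
Proof.
rewrite /pull; set r := repr _.
have /jet_eqP[H0 H] : \pi_(jets X W) r = \pi f by rewrite reprK.
apply/jet_eqP; split; first by rewrite /= g0.
move=> h; have := Hg (H h); congr (_ \in wideal W'); exact: smap_eq.
Qed.

Lemma jet_eval_pull (X : frolicher R) h (u : prol X W) :
  jet_eval h (pull g u : jets X W') = gstar Hg (jet_eval h (u : jets X W)).
Proof.
elim/prol_ind: u => f; rewrite pullE !jet_evalE gstar_pi.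
by congr (\pi _); apply: smap_eq.
Qed.

Lemma pull_map (X Y : frolicher R) (F : smap X Y) (u : prol X W) :
  pull g (prol_map F u) = prol_map F (pull g u).
Proof.
elim/prol_ind: u => f; rewrite pullE !prol_mapE pullE.
by congr (\pi _); apply: smap_eq.
Qed.

Lemma pull_smooth (X : frolicher R) : @smooth_map R (prol X W) (prol X W') (pull g).
Proof.
move=> c cc _ [h [l ->]].
have := cc (l \o gstar Hg \o jet_eval h).
rewrite (_ : (l \o gstar Hg \o jet_eval h) \o c = (l \o jet_eval h) \o (pull g \o c)).
  by apply; exists h, (l \o gstar Hg : {scalar walg W}).
by apply/funext => s /=; rewrite jet_eval_pull.
Qed.

(** The components of [lift_hom] are arbitrary representatives of the images
    of the coordinates, so they agree with those of g modulo the ideal, and by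
    [Cinf_congr] this persists after composition with h o f. *)
Lemma prol_homE (X : frolicher R) (u : prol X W) : prol_hom (gstar Hg) u = pull g u.
Proof.
rewrite /prol_hom /pull; set f := repr _; apply/jet_eqP; split.
  congr (f _); apply/rowP => i.
  have := @wcentred R W' (repr (gstar Hg (\pi_(walg W) (coord R i))) - ccomp (coord R i) g).
  rewrite Quotient.idealrBE reprK gstar_pi eqxx => /(_ isT).
  rewrite -gstar_pi => /eqP; rewrite Cinf_subE subr_eq0 => /eqP E.
  by rewrite /lift_hom /= mxE E.
move=> h; pose gi i : Cinf _ := ccomp (coord R i) g.
have -> : hc h (scomp f g) = ccomp (hc h f) (srow gi).
  apply: smap_eq => x; congr (h (f _)); apply/rowP => i; by rewrite mxE.
have -> : hc h (scomp f (lift_hom (gstar Hg))) = ccomp (hc h f)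
    (srow (fun i => repr (gstar Hg (\pi_(walg W) (coord R i))))).
  exact: smap_eq.
apply: (@Cinf_congr _ _ _ (wideal W') (hc h f)) => i.
by apply/walg_eqP; rewrite reprK gstar_pi.
Qed.

End Pull.

End Quot.

(** * Weil algebras with square-zero coordinates *)

Section SquareZero.
Variable R : realType.
Local Notation euclid := (euclid R).
Local Notation line := (line R).
Local Notation wpres := (wpres R).

(** The presentations of the infinitesimal objects that occur here all satisfy
    this; it reduces Taylor expansions to multilinear terms. *)
Definition sqW (W : wpres) := forall i, coord R i ^+ 2 \in wideal W.

Lemma expr_sum2 (A : comNzRingType) (x y : A) k : y ^+ 2 = 0 ->
  (x + y) ^+ k.+1 = x ^+ k.+1 + x ^+ k * y *+ k.+1.
Proof.
move=> y0; elim: k => [|k IHk]; first by rewrite !expr1 expr0 mul1r mulr1n.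
rewrite exprS IHk mulrDl !mulrDr -!exprS.
have -> : y * (x ^+ k * y *+ k.+1) = 0.
  by rewrite -mulrnAr mulrCA mulrnAr -expr2 y0 mul0rn mulr0.
by rewrite addr0 -mulrnAr mulrA -exprS mulrnAr -addrA -[y * _]mulrC -mulrSr.
Qed.

Lemma nilp_sum (A : comNzRingType) (I : Type) (r : seq I) (F : I -> A) :
  (forall i, F i ^+ 2 = 0) -> exists k, (\sum_(i <- r) F i) ^+ k = 0.
Proof.
move=> H; elim: r => [|i r [k IHk]]; first by exists 1%N; rewrite big_nil expr0n.
exists k.+1; rewrite big_cons addrC expr_sum2; last exact: H.
by rewrite exprS IHk mulr0 mul0r mul0rn addr0.
Qed.

Section WeilSq.
Variable W : wpres.
Hypothesis sqIW : sqW W.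

Lemma coord_sq0 i : \pi_(walg W) (coord R i) ^+ 2 = 0.
Proof. by rewrite -rmorphXn; apply: walg_pi0; exact: sqIW. Qed.

Lemma at0_nilpotent (w : walg W) : at0_walg w = 0 -> exists k, w ^+ k = 0.
Proof.
rewrite -[w]reprK at0_walg_pi => w0; have [g ->] := hadamard0 (repr w).
rewrite w0 rmorphD rmorph_sum /=.
rewrite [X in X + _](_ : _ = 0); last exact: (walg_pi0 (rpred0 (wideal W))).
rewrite add0r; apply: nilp_sum => i.
rewrite rmorphM exprMn [X in X * _](_ : _ = 0); last exact: coord_sq0.
by rewrite mul0r.
Qed.

Definition wmax : {pred walg W} := fun w => at0_walg w == 0.

Lemma at0_walgM (x y : walg W) : at0_walg (x * y) = at0_walg x * at0_walg y.
Proof. by rewrite -[x]reprK -[y]reprK -rmorphM !at0_walg_pi. Qed.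

Lemma at0_walg1 : at0_walg (1 : walg W) = 1.
Proof. by rewrite -(rmorph1 (\pi_(walg W))) at0_walg_pi. Qed.

Lemma at0_walgA (c : R) : at0_walg (c%:A : walg W) = c.
Proof. rewrite linearZ /= at0_walg1; exact: mulr1. Qed.

Fact wmax_idealr : idealr_closed wmax.
Proof.
split; rewrite ?unfold_in /= ?linear0 ?at0_walg1 ?oner_eq0 //.
by move=> a x y /eqP x0 /eqP y0; rewrite unfold_in linearD /= at0_walgM x0 y0 mulr0 addr0.
Qed.
HB.instance Definition _ := isIdealr.Build (walg W) wmax wmax_idealr.

Lemma ideal_wmax (J : idealr (walg W)) : {subset J <= wmax}.
Proof.
move=> x xJ; apply/negPn/negP => c0; have [k xk] : exists k, (1 - (at0_walg x)^-1 *: x) ^+ k = 0.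
  apply: at0_nilpotent; rewrite linearB linearZ /= at0_walg1.
  by apply/eqP; rewrite subr_eq0 eq_sym; apply/eqP; exact: mulVf.
have : (1 - (1 - (at0_walg x)^-1 *: x) ^+ k) \in J.
  rewrite -{1}(expr1n _ k) subrXX subKr -scalerAl scalerAr mulrC.
  by rewrite idealMr.
by rewrite xk subr0 idealr1.
Qed.

(** Finite dimension is [taylor_sq].  By [hadamard0] an element that vanishes
    at 0 is a sum of elements of square zero, hence nilpotent, so every proper
    ideal consists of elements vanishing at 0. *)
Lemma sq_is_weil : is_weil W.
Proof.
have [P HP] := taylor_sq (J := wideal W) sqIW; split.
  exists (size P), (fun i => \pi_(walg W) (tnth (in_tuple P) i).1) => a.
  exists (fun i => (tnth (in_tuple P) i).2 (repr a) 0).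
  have /walg_eqP := HP (repr a); rewrite reprK => E; rewrite [LHS]E.
  rewrite rmorph_sum big_tnth; apply: eq_bigr => i _.
  by rewrite [LHS]walg_piZ.
exists wmax; split.
- by move=> J _; exact: ideal_wmax.
- by move=> J mJ w; apply/idP/idP; [exact: ideal_wmax|exact: (mJ wmax (@ideal_wmax J))].
- exists (fun q => at0_walg (repr q)) => [c|q].
    have : repr (\pi_{ideal_quot wmax} (c%:A : walg W)) - c%:A \in (wmax : idealr _).
      by rewrite Quotient.idealrBE reprK.
    by rewrite unfold_in linearB /= at0_walgA subr_eq0 => /eqP.
  rewrite -[RHS]reprK; apply/eqP; rewrite -Quotient.idealrBE unfold_in.
  by rewrite linearB /= at0_walgA subrr.
Qed.

End WeilSq.

Lemma smap_line (X : frolicher R) (h : smap X line) (c : R -> X) :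
  curves c -> smooth (fun s => h (c s) : R).
Proof. by move=> cc; apply/(curves_line (fun s => h (c s))); exact: smap_smooth h c cc. Qed.

(** A linear functional of a jet is a finite combination of Taylor
    coefficients, which depend smoothly on the parameter. *)
Lemma jet_param (Z X : frolicher R) (W : wpres) (Phi : Z -> smap (euclid (wdim W)) X) :
  sqW W -> @smooth_map R (fprod Z (euclid (wdim W))) X (fun z => Phi z.1 z.2) ->
  @smooth_map R Z (prol X W) (fun z => \pi_(jets X W) (Phi z)).
Proof.
move=> sq sP c cc _ [h [l ->]].
have [P HP] := taylor_sq (J := wideal W) sq.
have E s : (l \o jet_eval h) (\pi_(jets X W) (Phi (c s))) =
   \sum_(p <- P) (p.2 (fun x => h (Phi (c s) x)) 0 * l (\pi_(walg W) p.1)) :> R.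
  rewrite /= jet_evalE; have /walg_eqP -> := HP (hc h (Phi (c s))).
  rewrite rmorph_sum linear_sum; apply: eq_bigr => p _.
  rewrite [X in l X](_ : _ = p.2 (hc h (Phi (c s))) 0 *: \pi_(walg W) p.1);
    last exact: walg_piZ.
  exact: linearZ.
rewrite (_ : _ \o _ = fun s => \sum_(p <- P) (p.2 (fun x => h (Phi (c s) x)) 0 *
   l (\pi_(walg W) p.1) : R)); last by apply/funext => s; exact: E.
apply: smooth_sum => p _.
have J : jsm (fun s x => h (Phi (c s) x) : R).
  move=> a d sa cd.
  apply: (@smap_line _ h (fun s => Phi (c (a s)) (d s))).
  apply: (sP (fun s => (c (a s), d s))); apply/curves_fprod; split=> //.
  exact: (curves_comp cc).
have S := @jopP _ _ p.2 _ J id (fun=> 0) (@smooth_id R).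
have C0 : @curves R (euclid (wdim W)) (fun=> 0).
  by apply/curves_euclid => i; exact: smooth_cst.
exact: (smoothM (S C0) (@smooth_cst _ _)).
Qed.

End SquareZero.

(** * Cartesian closedness *)

Section CC.
Variable R : realType.
Local Notation line := (line R).

Lemma fhom_curry (Z X Y : frolicher R) (F : Z -> smap X Y) :
  @smooth_map R (fprod Z X) Y (fun z => F z.1 z.2) -> @smooth_map R Z (fhom X Y) F.
Proof.
move=> H c cc f Ff; apply: Ff => d /curves_fprod[/curves_line d1 d2].
apply: (H (fun s => (c (d s).1, (d s).2))); apply/curves_fprod; split=> //.
exact: (curves_comp cc d1).
Qed.

Lemma BS2_d2n F j : @BS2 R F -> BS2 (fun u t => derive1n j (F u) t).
Proof.
move=> H; elim: j => [|j IHj]; first exact: H.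
exact: (BS2_d2 IHj).
Qed.

(** After composition with a function on Y and a curve in X this is
    [wsm2_diag].  Its hypotheses hold because a curve for the final structure
    is smooth against every function that is smooth on the generating curves,
    and by [BS2_ssum] the weighted sums of derivatives are such functions. *)
Lemma fhom_curve (X Y : frolicher R) (c : R -> fhom X Y) : curves c ->
  forall (a : R -> R) (x : R -> X), smooth a -> curves x ->
  curves (fun s => (c (a s) : smap X Y) (x s)).
Proof.
move=> cc a x sa cx; apply/curvesP => f Ff.
pose K t s := f ((c (a t) : smap X Y) (x s)) : R.
apply: (@wsm2_diag R K); split=> [t|].
  exact: (curvesP _).1 (smap_smooth (c (a t)) cx) f Ff.
move=> j s A Hs.
have main (e : nat -> R) (k : nat -> nat) : (forall n, `|e n| <= pw R n) ->
    smooth (fun t => ssum (fun n => e n * derive1n j (K t) (s (k n)))).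
  move=> He.
  pose L (g : smap X Y) : R := ssum (fun n => e n * derive1n j (fun t => f (g (x t)) : R) (s (k n))).
  have FL : @final_funs R _ [set c : R -> smap X Y |
      @smooth_map R (fprod line X) Y (fun z => c z.1 z.2)] L.
    move=> d second_diff; apply: (@BS2_ssum R (fun u t => derive1n j (fun t => f (d u (x t)) : R) t)
      (s \o k) e A) => //; last by move=> n; exact: Hs.
    apply: BS2_d2n => u v su sv.
    have Cuv : @curves R (fprod line X) (fun s => (u s, x (v s))).
      apply/(curves_fprod (X := line)); split; last exact: (curves_comp cx sv).
      exact: ((curves_line u).2 su).
    exact: (curvesP _).1 (second_diff _ Cuv) f Ff.
  exact: (smooth_comp (cc L FL) sa).
have sn n : smooth (fun t => derive1n j (K t) (s n)).
  have := main (fun m => (m == 0%N)%:R) (fun=> n).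
  rewrite (_ : (fun t => ssum _) = (fun t => derive1n j (K t) (s n))); last first.
    by apply/funext => t; rewrite ssum1.
  apply; case=> [|m]; first by rewrite normr1 /pw expr0.
  by rewrite normr0 ltW ?pw_gt0.
split=> // t.
have sKt : smooth (derive1n j (K t)).
  have sK : smooth (K t) by exact: (curvesP _).1 (smap_smooth (c (a t)) cx) f Ff.
  exact: smooth_derive1n.
have [B HB] := seg_bounded (- A) A (smooth_continuous sKt).
by exists B => n; apply: HB; rewrite -ler_norml; exact: Hs.
Qed.

Lemma fhom_uncurry (Z X Y : frolicher R) (F : Z -> smap X Y) :
  @smooth_map R Z (fhom X Y) F -> @smooth_map R (fprod Z X) Y (fun z => F z.1 z.2).
Proof.
move=> H c /curves_fprod[c1 c2].
exact: (fhom_curve (H _ c1) (@smooth_id R) c2).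
Qed.

Lemma ev_smooth (X Y : frolicher R) (x : X) :
  @smooth_map R (fhom X Y) Y (fun f => (f : smap X Y) x).
Proof.
move=> c cc; apply: (fhom_curve cc (@smooth_id R) (x := fun=> x)).
by apply/curvesP => f _; exact: smooth_cst.
Qed.
Definition ev (X Y : frolicher R) (x : X) : smap (fhom X Y) Y := Smap (@ev_smooth X Y x).

End CC.

(** * Ideals of infinitesimal objects *)

Section Ideals.
Variable R : realType.
Local Notation Cinf := (Cinf R).
Local Notation euclid := (euclid R).
Local Notation wpres := (wpres R).
Local Notation "''x[' n ]_ k" := (coord R (@Ordinal n k isT))
  (at level 8, k at level 2, format "''x[' n ]_ k").

Lemma gen_mem n (G : set (Cinf n)) (G0 : forall f, G f -> f 0 = 0 :> R) f :
  G f -> f \in wideal (wgen G0).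
Proof. by move=> Gf; apply/asboolP => J HJ; exact: HJ. Qed.

Lemma gen_sub n (G : set (Cinf n)) (G0 : forall f, G f -> f 0 = 0 :> R)
    (J : idealr (Cinf n)) f :
  (forall g, G g -> g \in J) -> f \in wideal (wgen G0) -> f \in J.
Proof. by move=> H /asboolP; apply. Qed.

Lemma ccompM n m (f g : Cinf n) (k : smap (euclid m) (euclid n)) :
  ccomp (f * g) k = ccomp f k * ccomp g k.
Proof. exact: smap_eq. Qed.
Lemma ccompD n m (f g : Cinf n) (k : smap (euclid m) (euclid n)) :
  ccomp (f + g) k = ccomp f k + ccomp g k.
Proof. exact: smap_eq. Qed.
Lemma ccompB n m (f g : Cinf n) (k : smap (euclid m) (euclid n)) :
  ccomp (f - g) k = ccomp f k - ccomp g k.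
Proof. exact: smap_eq. Qed.
Lemma ccompZ n m a (f : Cinf n) (k : smap (euclid m) (euclid n)) :
  ccomp (a *: f) k = a *: ccomp f k.
Proof. exact: smap_eq. Qed.
Lemma ccomp_coord n m (g : 'I_n -> Cinf m) i : ccomp (coord R i) (srow g) = g i.
Proof. by apply: smap_eq => x /=; rewrite mxE. Qed.

Section Preimage.
Variables (n m : nat) (k : smap (euclid m) (euclid n)) (J : idealr (Cinf m)).
Definition preideal : {pred Cinf n} := fun f => ccomp f k \in J.
Fact preideal_idealr : idealr_closed preideal.
Proof.
split=> [||a f g fJ gJ].
- change (ccomp 0 k \in J); rewrite (_ : ccomp 0 k = 0) ?rpred0 //; exact: smap_eq.
- change (ccomp 1 k \notin J); rewrite (_ : ccomp 1 k = 1) ?idealr1 //; exact: smap_eq.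
- change (ccomp (a * f + g) k \in J).
  by rewrite ccompD ccompM; apply: rpredD gJ; apply: idealMr.
Qed.
HB.instance Definition _ := isIdealr.Build (Cinf n) preideal preideal_idealr.
End Preimage.

(** The preimage of an ideal is an ideal, so generators suffice. *)
Lemma gen_compat n (G : set (Cinf n)) (G0 : forall f, G f -> f 0 = 0 :> R)
    (W' : wpres) (k : smap (euclid (wdim W')) (euclid n)) :
  (forall g, G g -> ccomp g k \in wideal W') ->
  forall f, f \in wideal (wgen G0) -> ccomp f k \in wideal W'.
Proof. by move=> H f /(@gen_sub _ _ _ (preideal k (wideal W'))); apply. Qed.

Definition vec n (s : seq R) : 'rV[R]_n := \row_i nth 0 s i.

Lemma vec_curve n (s : seq (R -> R)) : (forall i, smooth (nth (fun=> 0) s i)) ->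
  @curves R (euclid n) (fun t => vec n [seq f t | f <- s]).
Proof.
move=> H; apply/curves_euclid => i.
rewrite (_ : (fun t => _) = nth (fun=> 0) s i); first exact: H.
apply/funext => t; rewrite mxE; have [lt|le] := ltnP i (size s).
  by rewrite (nth_map (fun=> 0)).
by rewrite !nth_default ?size_map.
Qed.

Lemma vec1_curve (f : R -> R) : smooth f -> @curves R (euclid 1) (fun t => vec 1 [:: f t]).
Proof.
by move=> sf; apply: (@vec_curve 1 [:: f]) => -[|i]; [|rewrite /= nth_nil; exact: smooth_cst].
Qed.

Lemma vec2_curve (f g : R -> R) : smooth f -> smooth g ->
  @curves R (euclid 2) (fun t => vec 2 [:: f t; g t]).
Proof.
move=> sf sg; apply: (@vec_curve 2 [:: f; g]) => -[|[|i]]; [exact: sf|exact: sg|].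
by rewrite /= nth_nil; exact: smooth_cst.
Qed.

Lemma vec1_0 : vec 1 [:: 0] = 0.
Proof. by apply/rowP => i; rewrite !mxE ord1. Qed.
Lemma vec2_0 : vec 2 [:: 0; 0] = 0.
Proof. by apply/rowP => -[[|[|[]]] //= ?]; rewrite !mxE. Qed.

Definition dz (f : R -> R) : R := derive1 f 0.

Lemma dzM f g : smooth f -> smooth g -> dz (fun t => f t * g t) = f 0 * dz g + g 0 * dz f.
Proof.
move=> sf sg; apply: is_derive1E; apply: is_deriveM1; exact: smooth_is_derive.
Qed.
Lemma dzD f g : smooth f -> smooth g -> dz (fun t => f t + g t) = dz f + dz g.
Proof.
move=> sf sg; apply: is_derive1E; apply: is_deriveD; exact: smooth_is_derive.
Qed.
Lemma dz_cst (a : R) : dz (fun=> a) = 0.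
Proof. by apply: is_derive1E; exact: is_derive_cst. Qed.
Lemma dz_id : dz id = 1.
Proof. by apply: is_derive1E; exact: is_derive_id. Qed.
Lemma dzZ (a : R) f : smooth f -> dz (fun t => a * f t) = a * dz f.
Proof. by move=> sf; rewrite (dzM (@smooth_cst _ a) sf) dz_cst mulr0 addr0. Qed.
Lemma dzX f : smooth f -> dz (fun t => t * f t) = f 0.
Proof. by move=> sf; rewrite (dzM (@smooth_id R) sf) dz_id mul0r add0r mulr1. Qed.
Lemma dzXX f : smooth f -> dz (fun t => t ^+ 2 * f t) = 0.
Proof.
move=> sf; rewrite (_ : (fun t => _) = fun t => t * (t * f t)).
  by rewrite (dzX (smoothM (@smooth_id R) sf)) /= mul0r.
by apply/funext => t; rewrite mulrA expr2.
Qed.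
Lemma dzB f g : smooth f -> smooth g -> dz (fun t => f t - g t) = dz f - dz g.
Proof.
move=> sf sg; rewrite (dzD sf (smoothN sg)); congr (_ + _).
by rewrite -mulN1r -(dzZ _ sg); congr dz; apply/funext => t; rewrite mulN1r.
Qed.

(** The coefficient of x in W_D and, below, the coefficient of xy in W_{D^2},
    read off as derivatives at the origin. *)
Definition c1 (f : Cinf 1) : R := dz (fun t => f (vec 1 [:: t])).
Definition c2 (f : Cinf 2) : R := dz (fun s => dz (fun t => f (vec 2 [:: s; t]))).

Lemma Cinf1_smooth (f : Cinf 1) : smooth (fun t => f (vec 1 [:: t]) : R).
Proof. apply: (@Cinf_smooth _ _ f); exact: (vec1_curve (@smooth_id R)). Qed.
Lemma Cinf2_BS2 (f : Cinf 2) : BS2 (fun s t => f (vec 2 [:: s; t]) : R).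
Proof. by move=> a b sa sb; apply: (@Cinf_smooth _ _ f); exact: (vec2_curve sa sb). Qed.

Arguments Cinf1_smooth : clear implicits.
Arguments Cinf2_BS2 : clear implicits.
Lemma Cinf2_smooth (f : Cinf 2) s : smooth (fun t => f (vec 2 [:: s; t]) : R).
Proof. exact: (@BS2_smooth R _ s (Cinf2_BS2 f)). Qed.
Lemma Cinf2_smoothl (f : Cinf 2) t : smooth (fun s => f (vec 2 [:: s; t]) : R).
Proof. exact: (@BS2_smoothl R _ t (Cinf2_BS2 f)). Qed.
Arguments Cinf2_smooth : clear implicits.
Arguments Cinf2_smoothl : clear implicits.

Lemma BS2_dz F : @BS2 R F -> smooth (fun s => dz (F s)).
Proof. by move=> /BS2_d2 H; exact: (H id (fun=> 0) (@smooth_id R) (@smooth_cst _ 0)). Qed.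

Lemma c1D (f g : Cinf 1) : c1 (f + g) = c1 f + c1 g.
Proof.
have H := dzD (Cinf1_smooth f) (Cinf1_smooth g).
exact: H.
Qed.
Lemma c1Z a (f : Cinf 1) : c1 (a *: f) = a * c1 f.
Proof. exact: dzZ (Cinf1_smooth f). Qed.
Lemma c1B (f g : Cinf 1) : c1 (f - g) = c1 f - c1 g.
Proof. by rewrite -[- g]scaleN1r c1D c1Z mulN1r. Qed.
Lemma c1_coordM (f : Cinf 1) : c1 ('x[1]_0 * f) = f 0.
Proof.
rewrite -vec1_0 -(dzX (Cinf1_smooth f)); congr dz; apply/funext => t.
by rewrite /= mxE.
Qed.

Lemma c2D (f g : Cinf 2) : c2 (f + g) = c2 f + c2 g.
Proof.
rewrite /c2 -(dzD (BS2_dz (Cinf2_BS2 f)) (BS2_dz (Cinf2_BS2 g))).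
congr dz; apply/funext => s.
exact: dzD (Cinf2_smooth f s) (Cinf2_smooth g s).
Qed.
Lemma c2Z a (f : Cinf 2) : c2 (a *: f) = a * c2 f.
Proof.
rewrite /c2 -(dzZ _ (BS2_dz (Cinf2_BS2 f))); congr dz; apply/funext => s.
exact: dzZ (Cinf2_smooth f s).
Qed.
Lemma c2B (f g : Cinf 2) : c2 (f - g) = c2 f - c2 g.
Proof. by rewrite -[- g]scaleN1r c2D c2Z mulN1r. Qed.
Lemma c2_coordM (f : Cinf 2) : c2 ('x[2]_0 * 'x[2]_1 * f) = f 0.
Proof.
rewrite -vec2_0 -(dzX (Cinf2_smoothl f 0)); congr dz; apply/funext => s.
rewrite -(dzX (Cinf2_smooth f s)).
have sX : smooth (fun t => t * f (vec 2 [:: s; t])).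
  exact: smoothM (@smooth_id R) (Cinf2_smooth f s).
rewrite -(dzZ s sX); congr dz; apply/funext => t.
by rewrite /= !mxE /= mulrA.
Qed.
Lemma c2_sq (i : 'I_2) (f : Cinf 2) : c2 (coord R i ^+ 2 * f) = 0.
Proof.
rewrite /c2; case: i => [[|[|[]]] //= lt].
  rewrite -(dzXX (BS2_dz (Cinf2_BS2 f))); congr dz; apply/funext => s.
  rewrite -(dzZ _ (Cinf2_smooth f s)); congr dz; apply/funext => t.
  by rewrite /= !mxE.
rewrite -(dz_cst 0); congr dz; apply/funext => s.
rewrite -(dzXX (Cinf2_smooth f s)); congr dz; apply/funext => t.
by rewrite /= !mxE.
Qed.

(** An ideal by construction; that it contains the squares of the coordinates
    shows that c2 is defined on W_{D^2}. *)
Definition c2_null : {pred Cinf 2} := fun f => `[< forall g, c2 (f * g) = 0 >].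
Fact c2_null_idealr : idealr_closed c2_null.
Proof.
split.
- apply/asboolP => g; rewrite mul0r -[0]subr0 c2B; exact: subrr.
- apply/negP => /asboolP /(_ ('x[2]_0 * 'x[2]_1 * 1)) /eqP.
  by rewrite mul1r c2_coordM /= oner_eq0.
- move=> a u v /asboolP Hu /asboolP Hv; apply/asboolP => g.
  by rewrite mulrDl c2D [a * u]mulrC -mulrA Hu Hv addr0.
Qed.
HB.instance Definition _ := isIdealr.Build (Cinf 2) c2_null c2_null_idealr.

Lemma c2_ideal (f : Cinf 2) : f \in wideal (WD R 2) -> c2 f = 0.
Proof.
move=> /(@gen_sub _ _ _ c2_null) H.
have /asboolP /(_ 1) : f \in c2_null.
  by apply: H => _ [i _ <-]; apply/asboolP => g; exact: c2_sq.
by rewrite mulr1.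
Qed.

Definition c1_null : {pred Cinf 1} := fun f => `[< forall g, c1 (f * g) = 0 >].
Fact c1_null_idealr : idealr_closed c1_null.
Proof.
split.
- apply/asboolP => g; rewrite mul0r -[0]subr0 c1B; exact: subrr.
- apply/negP => /asboolP /(_ ('x[1]_0 * 1)) /eqP.
  by rewrite mul1r c1_coordM /= oner_eq0.
- move=> a u v /asboolP Hu /asboolP Hv; apply/asboolP => g.
  by rewrite mulrDl c1D [a * u]mulrC -mulrA Hu Hv addr0.
Qed.
HB.instance Definition _ := isIdealr.Build (Cinf 1) c1_null c1_null_idealr.

Lemma c1_ideal (f : Cinf 1) : f \in wideal (WD R 1) -> c1 f = 0.
Proof.
move=> /(@gen_sub _ _ _ c1_null) H.
have /asboolP /(_ 1) : f \in c1_null.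
  apply: H => _ [i _ <-]; apply/asboolP => g.
  have -> : i = Ordinal (isT : (0 < 1)%N) by apply: val_inj; rewrite /= ord1.
  by rewrite expr2 -mulrA c1_coordM /= mxE mul0r.
by rewrite mulr1.
Qed.

(** Apply [hadamard0] twice. *)
Lemma affine_mod n (J : idealr (Cinf n)) : (forall i j, coord R i * coord R j \in J) ->
  forall f : Cinf n, exists a : 'I_n -> R,
    f - (Cinf_cst n (f 0 : R) + \sum_i a i *: coord R i) \in J.
Proof.
move=> H f; have [g E] := hadamard0 f; exists (fun i => g i 0).
rewrite {1}E opprD addrACA subrr add0r -sumrB; apply: rpred_sum => i _.
have [k {1}->] := hadamard0 (g i).
rewrite mulrDr mulr_sumr (_ : _ * Cinf_cst n _ = g i 0 *: coord R i); last first.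
  by apply: smap_eq => x /=; rewrite mulrC.
rewrite [_ + _ - _]addrAC subrr add0r; apply: rpred_sum => j _.
by rewrite mulrA mulrC; apply: idealMr; exact: H.
Qed.

Lemma WD_sq n : sqW (WD R n).
Proof. by move=> i; apply: gen_mem; exists i. Qed.

Lemma WD2_prod (i j : 'I_2) : coord R i * coord R j \in wideal (WD2 R).
Proof.
have Hmem k : k \in [:: 'x[2]_0 ^+ 2; 'x[2]_1 ^+ 2; 'x[2]_0 * 'x[2]_1] -> k \in wideal (WD2 R).
  by move=> Hk; apply: gen_mem; exact: Hk.
have E0 lt : coord R (@Ordinal 2 0 lt) = 'x[2]_0 by congr coord; exact: val_inj.
have E1 lt : coord R (@Ordinal 2 1 lt) = 'x[2]_1 by congr coord; exact: val_inj.
case: i j => [[|[|[]]] //= ?] [[|[|[]]] //= ?]; rewrite ?E0 ?E1 -?expr2;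
  rewrite ?[X in X \in _](mulrC 'x[2]_1); apply: Hmem; rewrite !inE eqxx ?orbT //.
Qed.

Lemma WD2_sq : sqW (WD2 R).
Proof. by move=> i; rewrite expr2; exact: WD2_prod. Qed.

Lemma WD1_prod (i j : 'I_1) : coord R i * coord R j \in wideal (WD R 1).
Proof. by rewrite [i]ord1 [j]ord1 -expr2; exact: WD_sq. Qed.

Lemma WD2D_mem k : k \in [:: 'x[3]_0 ^+ 2; 'x[3]_1 ^+ 2; 'x[3]_2 ^+ 2;
            'x[3]_0 * 'x[3]_2; 'x[3]_1 * 'x[3]_2] -> k \in wideal (WD2D R).
Proof. by move=> Hk; apply: gen_mem; exact: Hk. Qed.

Lemma ord3E (i : 'I_3) : [\/ i = Ordinal (isT : (0 < 3)%N), i = Ordinal (isT : (1 < 3)%N) |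
   i = Ordinal (isT : (2 < 3)%N)].
Proof.
by case: i => [[|[|[|[]]]] //= ?]; [constructor 1|constructor 2|constructor 3]; exact: val_inj.
Qed.

Lemma WD2D_sq : sqW (WD2D R).
Proof.
by move=> i; apply: WD2D_mem; case: (ord3E i) => ->; rewrite !inE eqxx ?orbT.
Qed.

Lemma WD2D_prod (i : 'I_3) : coord R i * 'x[3]_2 \in wideal (WD2D R).
Proof.
by apply: WD2D_mem; case: (ord3E i) => ->; rewrite -?expr2 !inE eqxx ?orbT.
Qed.

Lemma ideal1P (f : Cinf 1) : f 0 = 0 :> R -> c1 f = 0 -> f \in wideal (WD R 1).
Proof.
move=> f0 cf; have [a Ha] := affine_mod WD1_prod f.
have a0 : a ord0 = 0.
  have := c1_ideal Ha; rewrite c1B cf sub0r => /eqP; rewrite oppr_eq0 c1D big_ord1 c1Z => /eqP.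
  rewrite [c1 (Cinf_cst _ _)]dz_cst add0r => <-.
  rewrite (_ : c1 (coord R ord0) = 1) ?mulr1 //.
  rewrite -[RHS]dz_id; congr dz; apply/funext => t; by rewrite /= mxE.
move: Ha; rewrite f0 big_ord1 a0 scale0r addr0.
by rewrite (_ : Cinf_cst 1 0 = 0) ?subr0.
Qed.

(** The ideals of W_{D(2)} and W_{D^2} differ by the multiples of xy, and
    modulo the latter ideal only constant multiples matter. *)
Lemma ideal2_const (f : Cinf 2) : f \in wideal (WD2 R) ->
  exists c : R, f - c *: ('x[2]_0 * 'x[2]_1) \in wideal (WD R 2).
Proof.
pose K : {pred Cinf 2} := fun f => `[< exists c : R, f - c *: ('x[2]_0 * 'x[2]_1) \in wideal (WD R 2) >].
have HK : idealr_closed K.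
  have S i : coord R i ^+ 2 \in wideal (WD R 2) by exact: WD_sq.
  split.
  - by apply/asboolP; exists 0; rewrite scale0r subrr rpred0.
  - apply/negP => /asboolP[c /wcentred] /eqP; rewrite /= !mxE !mul0r !mulr0 addr0.
    by rewrite oner_eq0.
  - move=> a u v /asboolP[c Hu] /asboolP[d Hv]; apply/asboolP.
    exists ((a 0 : R) * c + d).
    have [g Eg] := hadamard0 a.
    have H1 : (a - (a 0 : R)%:A) * ('x[2]_0 * 'x[2]_1) \in wideal (WD R 2).
      have -> : a - (a 0 : R)%:A = \sum_i coord R i * g i.
        rewrite {1}Eg (_ : Cinf_cst 2 _ = (a 0 : R)%:A) ?[_ + _ - _]addrAC ?subrr ?add0r //.
        by apply: smap_eq => x /=; rewrite mulr1.
      rewrite mulr_suml; apply: rpred_sum => i _.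
      have E0 lt : coord R (@Ordinal 2 0 lt) = 'x[2]_0 by congr coord; exact: val_inj.
      have E1 lt : coord R (@Ordinal 2 1 lt) = 'x[2]_1 by congr coord; exact: val_inj.
      have E3 (x y k : Cinf 2) : x * k * (x * y) = (k * y) * x ^+ 2 by ring.
      case: i => [[|[|k]] lt] //; rewrite ?E0 ?E1.
        by rewrite E3; apply: idealMr; exact: S.
      by rewrite [X in _ * X]mulrC E3; apply: idealMr; exact: S.
    have := rpredD (rpredD (idealMr a Hu) Hv) (idealMr c%:A H1).
    congr (_ \in wideal (WD R 2)); set P : Cinf 2 := 'x[2]_0 * 'x[2]_1.
    have -> : ((a 0 : R) * c + d) *: P = ((a 0 : R)%:A * c%:A + d%:A) * P.
      by rewrite mulrDl -mulrA !mulr_algl scalerDl scalerA.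
    rewrite -(mulr_algl c P) -(mulr_algl d P); ring.
pose KI : idealr (Cinf 2) := HB.pack K (isIdealr.Build (Cinf 2) K HK).
have inK (h : Cinf 2) (c : R) : h - c *: ('x[2]_0 * 'x[2]_1) \in wideal (WD R 2) -> h \in KI.
  by move=> Hh; apply/asboolP; exists c.
move=> /(@gen_sub _ _ _ KI) H; apply/asboolP; apply: H => g Gg.
have : g \in [:: 'x[2]_0 ^+ 2; 'x[2]_1 ^+ 2; 'x[2]_0 * 'x[2]_1] by exact: Gg.
rewrite !in_cons in_nil orbF => /or3P[] /eqP ->.
- by apply: (inK _ 0); rewrite scale0r subr0; exact: WD_sq.
- by apply: (inK _ 0); rewrite scale0r subr0; exact: WD_sq.
- by apply: (inK _ 1); rewrite scale1r subrr rpred0.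
Qed.

End Ideals.

(** * Limits of Weil algebras *)

Section Limits.
Variable R : realType.
Local Notation Cinf := (Cinf R).
Local Notation euclid := (euclid R).
Local Notation wpres := (wpres R).
Local Notation "''x[' n ]_ k" := (coord R (@Ordinal n k isT))
  (at level 8, k at level 2, format "''x[' n ]_ k").

(** The maps of infinitesimal objects that enter the definitions of the sum
    and of the strong difference. *)
Definition in1 : smap (euclid 1) (euclid 2) := polymap [tuple 'x[1]_0; 0].
Definition in2 : smap (euclid 1) (euclid 2) := polymap [tuple 0; 'x[1]_0].
Definition diag2 : smap (euclid 1) (euclid 2) := polymap [tuple 'x[1]_0; 'x[1]_0].
Definition phi3 : smap (euclid 2) (euclid 3) := polymap [tuple 'x[2]_0; 'x[2]_1; 0].
Definition psi3 : smap (euclid 2) (euclid 3) :=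
  polymap [tuple 'x[2]_0; 'x[2]_1; 'x[2]_0 * 'x[2]_1].
Definition eps3 : smap (euclid 1) (euclid 3) := polymap [tuple 0; 0; 'x[1]_0].
Definition pr32 : smap (euclid 3) (euclid 2) := polymap [tuple 'x[3]_0; 'x[3]_1].
Definition pr1 : smap (euclid 2) (euclid 1) := polymap [tuple 'x[2]_0].
Definition pr2 : smap (euclid 2) (euclid 1) := polymap [tuple 'x[2]_1].
Definition zero01 : smap (euclid 0) (euclid 1) := srow (fun=> 0).
Definition id22 : smap (euclid 2) (euclid 2) := srow (@coord R 2).

Lemma square_in n (J : idealr (Cinf n)) (x k : Cinf n) : x ^+ 2 \in J -> x * (x * k) \in J.
Proof. by move=> H; rewrite mulrA -expr2 mulrC idealMr. Qed.

Ltac pm0 := apply/rowP => -[[|[|[|?]]] ?] //; rewrite !mxE /= ?mxE ?mul0r //.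

Lemma in1_0 : in1 0 = 0. Proof. by pm0. Qed.
Lemma in2_0 : in2 0 = 0. Proof. by pm0. Qed.
Lemma diag2_0 : diag2 0 = 0. Proof. by pm0. Qed.
Lemma phi3_0 : phi3 0 = 0. Proof. by pm0. Qed.
Lemma psi3_0 : psi3 0 = 0. Proof. by pm0. Qed.
Lemma eps3_0 : eps3 0 = 0. Proof. by pm0. Qed.
Lemma pr1_0 : pr1 0 = 0. Proof. by pm0. Qed.
Lemma pr2_0 : pr2 0 = 0. Proof. by pm0. Qed.
Lemma zero01_0 : zero01 0 = 0. Proof. by pm0. Qed.
Lemma id22_0 : id22 0 = 0. Proof. by pm0. Qed.

Lemma WD_compat n (W' : wpres) (t : 'I_n -> Cinf (wdim W')) :
  (forall i, t i ^+ 2 \in wideal W') ->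
  forall f, f \in wideal (WD R n) -> ccomp f (srow t) \in wideal W'.
Proof.
move=> H; apply: gen_compat => _ [i _ <-].
by rewrite !expr2 ccompM ccomp_coord -expr2.
Qed.

Lemma WD2_compat (W' : wpres) (t : 'I_2 -> Cinf (wdim W')) :
  (forall i j, t i * t j \in wideal W') ->
  forall f, f \in wideal (WD2 R) -> ccomp f (srow t) \in wideal W'.
Proof.
move=> H; apply: gen_compat => g Gg.
have : g \in [:: 'x[2]_0 ^+ 2; 'x[2]_1 ^+ 2; 'x[2]_0 * 'x[2]_1] by exact: Gg.
by rewrite !in_cons in_nil orbF => /or3P[] /eqP ->; rewrite ?expr2 ccompM !ccomp_coord.
Qed.

Lemma WD2D_compat (W' : wpres) (t : 'I_3 -> Cinf (wdim W')) :
  (forall i, t i ^+ 2 \in wideal W') ->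
  (forall i, t i * t (Ordinal (isT : (2 < 3)%N)) \in wideal W') ->
  forall f, f \in wideal (WD2D R) -> ccomp f (srow t) \in wideal W'.
Proof.
move=> H H2; apply: gen_compat => g Gg.
have : g \in [:: 'x[3]_0 ^+ 2; 'x[3]_1 ^+ 2; 'x[3]_2 ^+ 2; 'x[3]_0 * 'x[3]_2; 'x[3]_1 * 'x[3]_2].
  by exact: Gg.
rewrite !in_cons in_nil orbF => /or4P[| | |/orP[]] /eqP ->; rewrite ?expr2 ccompM !ccomp_coord //;
  by rewrite -expr2.
Qed.

Ltac ordc := case=> [[|[|[|?]]] ?] //.

Lemma in1_ok f : f \in wideal (WD2 R) -> ccomp f in1 \in wideal (WD R 1).
Proof.
rewrite /in1 /polymap; apply: (@WD2_compat (WD R 1));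
  have := (@WD_sq R 1 : forall i, coord R i ^+ 2 \in wideal (WD R 1));
  move: (wideal (WD R 1)) => J S.
by ordc; ordc; rewrite !(tnth_nth 0) /= ?mul0r ?mulr0 ?rpred0 // -expr2 S.
Qed.
Lemma in2_ok f : f \in wideal (WD2 R) -> ccomp f in2 \in wideal (WD R 1).
Proof.
rewrite /in2 /polymap; apply: (@WD2_compat (WD R 1));
  have := (@WD_sq R 1 : forall i, coord R i ^+ 2 \in wideal (WD R 1));
  move: (wideal (WD R 1)) => J S.
by ordc; ordc; rewrite !(tnth_nth 0) /= ?mul0r ?mulr0 ?rpred0 // -expr2 S.
Qed.
Lemma diag2_ok f : f \in wideal (WD2 R) -> ccomp f diag2 \in wideal (WD R 1).
Proof.
rewrite /diag2 /polymap; apply: (@WD2_compat (WD R 1));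
  have := (@WD_sq R 1 : forall i, coord R i ^+ 2 \in wideal (WD R 1));
  move: (wideal (WD R 1)) => J S.
by ordc; ordc; rewrite !(tnth_nth 0) /= -expr2 S.
Qed.
Lemma zero01_ok f : f \in wideal (WD R 1) -> ccomp f zero01 \in wideal (WD R 0).
Proof.
rewrite /zero01; apply: (@WD_compat 1 (WD R 0));
  have := (@WD_sq R 0 : forall i, coord R i ^+ 2 \in wideal (WD R 0));
  move: (wideal (WD R 0)) => J S.
by move=> i; rewrite expr2 mul0r rpred0.
Qed.
Lemma id22_ok f : f \in wideal (WD R 2) -> ccomp f id22 \in wideal (WD2 R).
Proof.
rewrite /id22; apply: (@WD_compat 2 (WD2 R));
  have := (@WD2_sq R : forall i, coord R i ^+ 2 \in wideal (WD2 R));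
  move: (wideal (WD2 R)) => J S.
exact: S.
Qed.
Lemma pr1_ok f : f \in wideal (WD R 1) -> ccomp f pr1 \in wideal (WD R 2).
Proof.
rewrite /pr1 /polymap; apply: (@WD_compat 1 (WD R 2));
  have := (@WD_sq R 2 : forall i, coord R i ^+ 2 \in wideal (WD R 2));
  move: (wideal (WD R 2)) => J S.
by ordc; rewrite !(tnth_nth 0) /= S.
Qed.
Lemma pr2_ok f : f \in wideal (WD R 1) -> ccomp f pr2 \in wideal (WD R 2).
Proof.
rewrite /pr2 /polymap; apply: (@WD_compat 1 (WD R 2));
  have := (@WD_sq R 2 : forall i, coord R i ^+ 2 \in wideal (WD R 2));
  move: (wideal (WD R 2)) => J S.
by ordc; rewrite !(tnth_nth 0) /= S.
Qed.
Lemma pr32_ok f : f \in wideal (WD R 2) -> ccomp f pr32 \in wideal (WD2D R).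
Proof.
rewrite /pr32 /polymap; apply: (@WD_compat 2 (WD2D R));
  have := (@WD2D_sq R : forall i, coord R i ^+ 2 \in wideal (WD2D R));
  move: (wideal (WD2D R)) => J S.
by ordc; rewrite !(tnth_nth 0) /= S.
Qed.
Lemma eps3_ok f : f \in wideal (WD2D R) -> ccomp f eps3 \in wideal (WD R 1).
Proof.
rewrite /eps3 /polymap; apply: (@WD2D_compat (WD R 1));
  have := (@WD_sq R 1 : forall i, coord R i ^+ 2 \in wideal (WD R 1));
  move: (wideal (WD R 1)) => J S.
all: by ordc; rewrite !(tnth_nth 0) /= ?expr2 ?mul0r ?mulr0 ?rpred0 // -expr2 S.
Qed.
Lemma phi3_ok f : f \in wideal (WD2D R) -> ccomp f phi3 \in wideal (WD R 2).
Proof.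
rewrite /phi3 /polymap; apply: (@WD2D_compat (WD R 2));
  have := (@WD_sq R 2 : forall i, coord R i ^+ 2 \in wideal (WD R 2));
  move: (wideal (WD R 2)) => J S.
all: by ordc; rewrite !(tnth_nth 0) /= ?expr2 ?mul0r ?mulr0 ?rpred0 // -expr2 S.
Qed.
Lemma psi3_ok f : f \in wideal (WD2D R) -> ccomp f psi3 \in wideal (WD R 2).
Proof.
rewrite /psi3 /polymap; apply: (@WD2D_compat (WD R 2));
  have := (@WD_sq R 2 : forall i, coord R i ^+ 2 \in wideal (WD R 2));
  move: (wideal (WD R 2)) => J S.
all: ordc; rewrite !(tnth_nth 0) /=.
- exact: S.
- exact: S.
- by rewrite expr2 -mulrA; apply: idealMr; rewrite mulrCA; apply: idealMr; rewrite -expr2; exact: S.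
- apply: square_in; exact: S.
- rewrite [X in _ * X]mulrC; apply: square_in; exact: S.
- rewrite -mulrA [X in _ * X]mulrCA; apply: square_in; exact: S.
Qed.

Lemma ccompA n m l (f : Cinf n) (k : smap (euclid m) (euclid n)) (g : smap (euclid l) (euclid m)) :
  ccomp f (scomp k g) = ccomp (ccomp f k) g.
Proof. exact: smap_eq. Qed.

(** The universal arrow is chosen elementwise; joint injectivity makes it a
    morphism and makes it unique. *)
Lemma alg_limit_crit (V E : finType) (src tgt : E -> V) (D : V -> wpres)
    (d : forall e, {lrmorphism walg (D (src e)) -> walg (D (tgt e))})
    (L : wpres) (k : forall v, {lrmorphism walg L -> walg (D v)}) :
  (forall e, d e \o k (src e) =1 k (tgt e)) ->
  (forall w, (forall v, k v w = 0) -> w = 0) ->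
  (forall w : forall v, walg (D v), (forall e, d e (w (src e)) = w (tgt e)) ->
     exists z, forall v, k v z = w v) ->
  is_alg_limit d k.
Proof.
move=> Hc Hi Hs; split=> // A a Ha.
have H x : exists z, forall v, k v z = a v x.
  by apply: (Hs (fun v => a v x)) => e; exact: Ha.
pose u x := sval (cid (H x)).
have uP x v : k v (u x) = a v x by rewrite /u; case: cid.
have inj w w' : (forall v, k v w = k v w') -> w = w'.
  move=> K; apply/eqP; rewrite -subr_eq0; apply/eqP; apply: Hi => v.
  have <- : k v w - k v w' = 0 by rewrite K subrr.
  exact: rmorphB.
have u1 : zmod_morphism u.
  move=> x y; apply: inj => v; rewrite uP; apply: etrans (rmorphB (a v) x y) _.
  apply: etrans _ (esym (rmorphB (k v) (u x) (u y))).
  exact: (congr2 (fun s t => s - t) (esym (uP x v)) (esym (uP y v))).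
have u2 : monoid_morphism u.
  split; first by apply: inj => v; rewrite uP; exact: etrans (rmorph1 (a v)) (esym (rmorph1 (k v))).
  move=> x y; apply: inj => v; rewrite uP; apply: etrans (rmorphM (a v) x y) _.
  apply: etrans _ (esym (rmorphM (k v) (u x) (u y))).
  exact: (congr2 *%R (esym (uP x v)) (esym (uP y v))).
have u3 : scalable u.
  move=> c x; apply: inj => v; rewrite uP; apply: etrans (linearZZ (a v) c x) _.
  apply: etrans _ (esym (linearZZ (k v) c (u x))).
  exact: (congr1 ( *:%R c) (esym (uP x v))).
pose U : {lrmorphism A -> walg L} := HB.pack u (GRing.isZmodMorphism.Build _ _ u u1)
  (GRing.isMonoidMorphism.Build _ _ u u2) (GRing.isScalable.Build _ _ _ _ u u3).
exists U; split=> [v x|u' Hu' x]; first exact: uP.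
by apply: inj => v; rewrite [RHS]uP; exact: Hu'.
Qed.

Section Pullback.
Variables (W0 W1 L : wpres) (g : smap (euclid (wdim W0)) (euclid (wdim W1)))
  (k1 k2 : smap (euclid (wdim W1)) (euclid (wdim L))).
Hypotheses (Hg : forall f, f \in wideal W1 -> ccomp f g \in wideal W0)
  (Hk1 : forall f, f \in wideal L -> ccomp f k1 \in wideal W1)
  (Hk2 : forall f, f \in wideal L -> ccomp f k2 \in wideal W1).
Hypotheses (g0 : g 0 = 0) (k10 : k1 0 = 0) (k20 : k2 0 = 0).
Hypotheses (W0w : is_weil W0) (W1w : is_weil W1) (Lw : is_weil L).
Hypothesis Hcom : forall f, ccomp (ccomp f k1) g - ccomp (ccomp f k2) g \in wideal W0.
Hypothesis Hinj : forall f, ccomp f k1 \in wideal W1 -> ccomp f k2 \in wideal W1 -> f \in wideal L.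
Hypothesis Hsurj : forall f1 f2, ccomp (f1 - f2) g \in wideal W0 ->
  exists f, ccomp f k1 - f1 \in wideal W1 /\ ccomp f k2 - f2 \in wideal W1.

Let D (v : option bool) : wpres := if v is Some _ then W1 else W0.
Let src (e : bool) : option bool := Some e.
Let tgt (e : bool) : option bool := None.
Let d (e : bool) : {lrmorphism walg (D (src e)) -> walg (D (tgt e))} := gstar Hg.
Let Hk0 f (fL : f \in wideal L) : ccomp f (scomp k1 g) \in wideal W0.
Proof.
have := Hg (Hk1 fL); congr (_ \in wideal W0); exact: smap_eq.
Qed.
Let k (v : option bool) : {lrmorphism walg L -> walg (D v)} :=
  match v return {lrmorphism walg L -> walg (D v)} with
  | Some true => gstar Hk1 | Some false => gstar Hk2 | None => gstar Hk0 end.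

(** Both limits that are needed are pullbacks of a map along itself; the
    hypotheses say, on representatives, that the square commutes and is
    jointly injective and surjective. *)
Lemma pullback_alg_limit : is_alg_limit d k.
Proof.
apply: alg_limit_crit.
- case=> w; rewrite -[w]reprK; move: (repr w) => f.
    change (gstar Hg (gstar Hk1 (\pi_(walg L) f)) = gstar Hk0 (\pi_(walg L) f)).
    by rewrite (gstar_pi Hk1) (gstar_pi Hg) (gstar_pi Hk0) ccompA.
  change (gstar Hg (gstar Hk2 (\pi_(walg L) f)) = gstar Hk0 (\pi_(walg L) f)).
  rewrite (gstar_pi Hk2) (gstar_pi Hg) (gstar_pi Hk0) ccompA; apply/walg_eqP.
  by rewrite -opprB rpredN; exact: Hcom.
- move=> w H; rewrite -[w]reprK; apply: walg_pi0.
  have I1 := H (Some true); have I2 := H (Some false).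
  rewrite /= -[w]reprK gstar_pi in I1; rewrite /= -[w]reprK gstar_pi in I2.
  by apply: Hinj; rewrite -[X in X \in _]subr0; apply/walg_eqP; rewrite rmorph0.
- move=> w H; have H1 := H true; have H2 := H false.
  rewrite /= in H1 H2.
  have [f [F1 F2]] : exists f, ccomp f k1 - repr (w (Some true)) \in wideal W1 /\
      ccomp f k2 - repr (w (Some false)) \in wideal W1.
    apply: Hsurj; rewrite ccompB; apply/walg_eqP.
    by rewrite -!(gstar_pi Hg) !reprK H1 H2.
  exists (\pi f) => -[[]|] /=.
  + by rewrite gstar_pi -[RHS]reprK; apply/walg_eqP.
  + by rewrite gstar_pi -[RHS]reprK; apply/walg_eqP.
  + rewrite gstar_pi -H1 -[w (Some true)]reprK gstar_pi; apply/walg_eqP.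
    have := Hg F1; congr (_ \in wideal W0); exact: smap_eq.
Qed.

(** Microlinearity is used with an arbitrary source Y, which makes the lift
    smooth in the point of Y. *)
Lemma pullback_lift (M Y : frolicher R) (v1 v2 : smap Y (prol M W1)) :
  microlinear M -> (forall y, pull g (v1 y) = pull g (v2 y)) ->
  exists v : smap Y (prol M L), forall y, pull k1 (v y) = v1 y /\ pull k2 (v y) = v2 y.
Proof.
move=> Mm Hv; have [_ _ _ H] := Mm _ _ src tgt D d L k
  (fun v => match v return is_weil (D v) with Some _ => W1w | None => W0w end) Lw
  pullback_alg_limit.
pose v0 : smap Y (prol M W0) := scomp (Smap (@pull_smooth R W1 W0 g Hg g0 M)) v1.
have [|v [Ev _]] := H Y (fun v => match v return smap Y (prol M (D v)) with
   | Some true => v1 | Some false => v2 | None => v0 end).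
  by case=> y; rewrite /= prol_homE.
exists v => y; split.
  by have := Ev (Some true) y; rewrite /= prol_homE.
by have := Ev (Some false) y; rewrite /= prol_homE.
Qed.

End Pullback.
End Limits.

(** * The pullback squares for the sum and the strong difference *)

Section Infinitesimals.
Variable R : realType.
Local Notation Cinf := (Cinf R).
Local Notation euclid := (euclid R).
Local Notation "''x[' n ]_ k" := (coord R (@Ordinal n k isT))
  (at level 8, k at level 2, format "''x[' n ]_ k").

Lemma big_ord2 (V : nmodType) (F : 'I_2 -> V) :
  \sum_i F i = F (Ordinal (isT : (0 < 2)%N)) + F (Ordinal (isT : (1 < 2)%N)).
Proof.
rewrite big_ord_recl big_ord1; congr (F _ + F _); exact: val_inj.
Qed.

Ltac vecc := apply/rowP => -[[|[|[|?]]] ?] //; rewrite !mxE /= ?mxE.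

Lemma c1_affine (a b : R) : c1 (Cinf_cst 1 a + b *: 'x[1]_0) = b.
Proof.
rewrite c1D c1Z [c1 (Cinf_cst _ _)]dz_cst add0r (_ : c1 _ = 1) ?mulr1 //.
by rewrite -['x[1]_0]mulr1 c1_coordM.
Qed.

(** Modulo the ideal f is affine, and its coefficients are seen on the two
    axes. *)
Lemma ideal2P (f : Cinf 2) :
  ccomp f (in1 R) \in wideal (WD R 1) -> ccomp f (in2 R) \in wideal (WD R 1) ->
  f \in wideal (WD2 R).
Proof.
move=> H1 H2; have [a Ha] := affine_mod (@WD2_prod R) f.
have f0 : f 0 = 0 :> R.
  by rewrite -(wcentred H1); congr (f _); rewrite in1_0.
rewrite f0 big_ord2 in Ha; set a0 := a _ in Ha; set a1 := a _ in Ha.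
have E1 : a0 = 0.
  have := c1_ideal (in1_ok Ha); rewrite ccompB c1B (c1_ideal H1) sub0r => /eqP.
  rewrite oppr_eq0 => /eqP <-; rewrite -[LHS](c1_affine 0); congr c1.
  by apply: smap_eq => x; rewrite /= !mxE /= ?mxE mulr0 addr0.
have E2 : a1 = 0.
  have := c1_ideal (in2_ok Ha); rewrite ccompB c1B (c1_ideal H2) sub0r => /eqP.
  rewrite oppr_eq0 => /eqP <-; rewrite -[LHS](c1_affine 0); congr c1.
  by apply: smap_eq => x; rewrite /= !mxE /= ?mxE mulr0 !add0r.
move: Ha; rewrite E1 E2 !scale0r addr0 (_ : Cinf_cst 2 0 + 0 = 0) ?subr0 //.
by rewrite addr0.
Qed.

Lemma ideal0P (f : Cinf 0) : f 0 = 0 :> R -> f \in wideal (WD R 0).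
Proof.
move=> f0; rewrite (_ : f = 0) ?rpred0 //; apply: smap_eq => x.
by rewrite [x](_ : _ = 0) //; apply/rowP => -[].
Qed.

(** D(2) consists of two copies of D glued at 0: an affine function may be
    prescribed on both axes as soon as the constants agree. *)
Lemma WD2_lift (M Y : frolicher R) (v1 v2 : smap Y (prol M (WD R 1))) :
  microlinear M -> (forall y, @pull R M (WD R 1) (WD R 0) (zero01 R) (v1 y) =
    @pull R M (WD R 1) (WD R 0) (zero01 R) (v2 y)) ->
  exists v : smap Y (prol M (WD2 R)),
    forall y, @pull R M (WD2 R) (WD R 1) (in1 R) (v y) = v1 y /\
      @pull R M (WD2 R) (WD R 1) (in2 R) (v y) = v2 y.
Proof.
apply: (@pullback_lift R (WD R 0) (WD R 1) (WD2 R) (zero01 R) (in1 R) (in2 R)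
  (@zero01_ok R) (@in1_ok R) (@in2_ok R)).
- exact: zero01_0.
- exact: (sq_is_weil (@WD_sq R 0)).
- exact: (sq_is_weil (@WD_sq R 1)).
- exact: (sq_is_weil (@WD2_sq R)).
- move=> f; apply: ideal0P; rewrite Cinf_subE.
  have E (k : smap (euclid 1) (euclid 2)) : k 0 = 0 ->
    ccomp (ccomp f k) (zero01 R) 0 = f 0 :> R.
    by move=> k0; rewrite -[in RHS]k0 -[in RHS](zero01_0 R).
  by rewrite (E _ (in1_0 R)) (E _ (in2_0 R)) subrr.
- exact: ideal2P.
- move=> f1 f2 H12.
  have E0 : f1 0 = f2 0 :> R.
    have : (f1 - f2 : Cinf 1) (zero01 R 0) = 0 :> R by exact: (wcentred H12).
    by rewrite zero01_0 Cinf_subE => /eqP; rewrite subr_eq0 => /eqP.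
  have [a Ha] := affine_mod (@WD1_prod R) f1; have [b Hb] := affine_mod (@WD1_prod R) f2.
  rewrite big_ord1 in Ha; rewrite big_ord1 in Hb.
  exists (Cinf_cst 2 (f1 0 : R) + a ord0 *: 'x[2]_0 + b ord0 *: 'x[2]_1); split.
    rewrite -opprB rpredN; move: Ha; congr (_ - _ \in wideal (WD R 1)).
    apply: smap_eq => x; rewrite /= !mxE /= ?mxE mulr0 addr0; congr (_ + _ * x _ _).
    exact: val_inj.
  rewrite -opprB rpredN; move: Hb; congr (_ - _ \in wideal (WD R 1)).
  apply: smap_eq => x; rewrite /= !mxE /= ?mxE mulr0 addr0 E0; congr (_ + _ * x _ _).
  exact: val_inj.
Qed.

Lemma phi3_pr32 (f : Cinf 2) : ccomp (ccomp f (pr32 R)) (phi3 R) = f.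
Proof. by apply: smap_eq => x; congr (f _); vecc; congr (x _ _); exact: val_inj. Qed.
Lemma psi3_pr32 (f : Cinf 2) : ccomp (ccomp f (pr32 R)) (psi3 R) = f.
Proof. by apply: smap_eq => x; congr (f _); vecc; congr (x _ _); exact: val_inj. Qed.

Lemma psi3_z : ccomp 'x[3]_2 (psi3 R) = 'x[2]_0 * 'x[2]_1.
Proof. by rewrite /psi3 /polymap ccomp_coord (tnth_nth 0). Qed.
Lemma id22E (f : Cinf 2) : ccomp f (id22 R) = f.
Proof. by apply: smap_eq => x; congr (f _); vecc. Qed.

(** Divide by the third variable; the quotient may be replaced by its value at
    0, because the third coordinate annihilates all coordinates. *)
Lemma D2D_split (f : Cinf 3) : exists c : R,
  f - (ccomp (ccomp f (phi3 R)) (pr32 R) + c *: 'x[3]_2) \in wideal (WD2D R).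
Proof.
pose Q := japp (jdquot R (Ordinal (isT : (2 < 3)%N))) f.
exists (Q 0); have E := res_dquotC (Ordinal (isT : (2 < 3)%N)) f.
have E1 : japp (jres R (Ordinal (isT : (2 < 3)%N))) f = ccomp (ccomp f (phi3 R)) (pr32 R).
  apply: smap_eq => x; congr (f _); vecc; rewrite ?mulr0 ?subr0 ?mulr1.
  - by rewrite [RHS]/=; congr (x _ _); exact: val_inj.
  - by rewrite [RHS]/=; congr (x _ _); exact: val_inj.
  - apply/eqP; rewrite subr_eq0; apply/eqP; congr (x _ _); exact: val_inj.
rewrite {1}E E1 -/Q opprD addrACA subrr add0r.
have [g Eg] := hadamard0 Q.
have -> : 'x[3]_2 * Q - (Q 0 : R) *: 'x[3]_2 = \sum_i g i * (coord R i * 'x[3]_2).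
  rewrite {1}Eg mulrDr (_ : 'x[3]_2 * Cinf_cst 3 _ = (Q 0 : R) *: 'x[3]_2); last first.
    by apply: smap_eq => x /=; rewrite mulrC.
  rewrite addrAC subrr add0r mulr_sumr; apply: eq_bigr => i _.
  by rewrite mulrC -mulrA mulrCA mulrA.
by apply: rpred_sum => i _; apply: idealMr; exact: WD2D_prod.
Qed.

(** The coefficient of z is recovered as the coefficient of xy in f(x, y, xy). *)
Lemma ideal3P (f : Cinf 3) :
  ccomp f (psi3 R) \in wideal (WD R 2) -> ccomp f (phi3 R) \in wideal (WD R 2) ->
  f \in wideal (WD2D R).
Proof.
move=> H1 H2; have [c Hc] := D2D_split f.
have c0 : c = 0.
  have := c2_ideal (psi3_ok Hc); rewrite ccompB c2B (c2_ideal H1) sub0r => /eqP.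
  rewrite oppr_eq0 ccompD psi3_pr32 c2D (c2_ideal H2) add0r ccompZ c2Z psi3_z.
  by rewrite -['x[2]_0 * _]mulr1 c2_coordM mulr1 => /eqP.
move: Hc; rewrite c0 scale0r addr0 => Hc.
by rewrite -(subrK (ccomp (ccomp f (phi3 R)) (pr32 R)) f); apply: (rpredD Hc); exact: pr32_ok.
Qed.

(** Functions that agree on D(2) differ by a multiple of xy on D^2; the square
    is a pullback because this multiple can be assigned to z. *)
Lemma WD2D_lift (M Y : frolicher R) (v1 v2 : smap Y (prol M (WD R 2))) :
  microlinear M -> (forall y, @pull R M (WD R 2) (WD2 R) (id22 R) (v1 y) =
    @pull R M (WD R 2) (WD2 R) (id22 R) (v2 y)) ->
  exists v : smap Y (prol M (WD2D R)),
    forall y, @pull R M (WD2D R) (WD R 2) (psi3 R) (v y) = v1 y /\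
      @pull R M (WD2D R) (WD R 2) (phi3 R) (v y) = v2 y.
Proof.
apply: (@pullback_lift R (WD2 R) (WD R 2) (WD2D R) (id22 R) (psi3 R) (phi3 R)
  (@id22_ok R) (@psi3_ok R) (@phi3_ok R)).
- exact: id22_0.
- exact: (sq_is_weil (@WD2_sq R)).
- exact: (sq_is_weil (@WD_sq R 2)).
- exact: (sq_is_weil (@WD2D_sq R)).
- move=> f; have [c Hc] := D2D_split f.
  have := id22_ok (psi3_ok Hc); rewrite id22E ccompB ccompD psi3_pr32 ccompZ psi3_z => H.
  have P : c *: ('x[2]_0 * 'x[2]_1) \in wideal (WD2 R).
    rewrite -mulr_algl; apply: idealMr; exact: WD2_prod.
  have := rpredD H P; congr (_ \in wideal (WD2 R)).
  by rewrite !id22E opprD addrA subrK.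
- exact: ideal3P.
- move=> f1 f2 H12.
  rewrite id22E in H12; have [c Hc] := ideal2_const H12.
  exists (ccomp f2 (pr32 R) + c *: 'x[3]_2); split.
    rewrite ccompD psi3_pr32 ccompZ psi3_z.
    rewrite -opprB rpredN; move: Hc; congr (_ \in wideal (WD R 2)).
    by rewrite opprD addrA.
  rewrite ccompD phi3_pr32 ccompZ /phi3 /polymap ccomp_coord (tnth_nth 0).
  by rewrite scaler0 addr0 subrr rpred0.
Qed.

End Infinitesimals.

(** * Jets in a product *)

Section ProductJets.
Variable R : realType.
Local Notation Cinf := (Cinf R).
Local Notation euclid := (euclid R).
Local Notation line := (line R).
Local Notation wpres := (wpres R).

Fact spair_subproof (Z X Y : frolicher R) (f : smap Z X) (g : smap Z Y) :
  @smooth_map R Z (fprod X Y) (fun z => (f z, g z)).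
Proof.
by move=> c cc; apply/curves_fprod; split; [exact: (smap_smooth f)|exact: (smap_smooth g)].
Qed.
Definition spair (Z X Y : frolicher R) (f : smap Z X) (g : smap Z Y) :
  smap Z (fprod X Y) := Smap (@spair_subproof Z X Y f g).

Fact sswap_subproof (X Y : frolicher R) : @smooth_map R (fprod X Y) (fprod Y X) (fun z => (z.2, z.1)).
Proof. by move=> c /curves_fprod[c1 c2]; apply/curves_fprod. Qed.
Definition sswap (X Y : frolicher R) : smap (fprod X Y) (fprod Y X) := Smap (@sswap_subproof X Y).

Section PairWd.
Variables (X Y : frolicher R) (W : wpres).
Hypothesis sq : sqW W.
Local Notation n := (wdim W).

Let Delta : smap (euclid n) (euclid (n + n)) :=
  srow (fun i => match fintype.split i with inl j | inr j => coord R j end).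
Let lp : smap (euclid (n + n)) (euclid n) := srow (fun i => coord R (lshift n i)).
Let rp : smap (euclid (n + n)) (euclid n) := srow (fun i => coord R (rshift n i)).

Let lpD x : lp (Delta x) = x.
Proof. by apply/rowP => i; rewrite !mxE /= mxE (unsplitK (inl i)). Qed.
Let rpD x : rp (Delta x) = x.
Proof. by apply/rowP => i; rewrite !mxE /= mxE (unsplitK (inr i)). Qed.

Let A (h : smap (fprod X Y) line) (g : smap (euclid n) Y) (x : X) (z : 'rV[R]_(n + n)) : R :=
  h (x, g (rp z)).

Let A_jsm h g (c : R -> X) : curves c -> jsm (fun s => A h g (c s)).
Proof.
move=> cc a d sa cd; apply: (@smap_line R _ h (fun s => (c (a s), g (rp (d s))))).
apply/curves_fprod; split; first exact: (curves_comp cc sa).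
by apply: (smap_smooth g); exact: (smap_smooth rp).
Qed.

(** A function h on the product is not determined by functions on the factors,
    so the congruence of f and f' must be used in the presence of g.  Double
    the variables and expand h(f x, g y) modulo squares in y: each coefficient
    is a smooth function on X applied to f x, so f may be replaced by its
    congruent partner, and then one restricts to the diagonal. *)
Lemma pair_wdl (f f' : smap (euclid n) X) (g : smap (euclid n) Y) :
  \pi_(jets X W) f = \pi_(jets X W) f' ->
  \pi_(jets (fprod X Y) W) (spair f g) = \pi_(jets (fprod X Y) W) (spair f' g).
Proof.
move=> /jet_eqP[f0 ff]; apply/jet_eqP; split; first by rewrite /= f0.
move=> h; pose J : idealr (Cinf (n + n)) := preideal Delta (wideal W).
have sqJ i : coord R i ^+ 2 \in J.
  change (ccomp (coord R i ^+ 2) Delta \in wideal W); rewrite expr2 ccompM ccomp_coord.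
  by case: (fintype.split i) => j; rewrite -expr2; exact: sq.
have [P [H1 H2 HL H3]] := taylor_seq sqJ [seq rshift n j | j <- enum 'I_n].
(* f and f' enter separately, as the coefficient operators are not known to
   be additive *)
pose F (k : smap (euclid n) X) : Cinf (n + n) := scomp h (spair (scomp k lp) (scomp g rp)).
have FD k : ccomp (F k) Delta = hc h (spair k g).
  by apply: smap_eq => x /=; congr (h (k _, g _)); [exact: lpD|exact: rpD].
have key p : List.In p P -> forall k x, p.2 (F k) (Delta x) = p.2 (A h g (k x)) 0.
  move=> pP k x; rewrite (HL p pP (F k) (A h g (k x)) (Delta x)).
    apply: indep_all => i; rewrite -[i]splitK; case: (fintype.split i) => j /=.
      apply: (H1 p pP) => z w; rewrite /A; congr (h (_, g _)); apply/rowP => l.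
      by rewrite !mxE /= !mxE eqxx eq_sym eq_lrshift mulr0 addr0.
    by apply: (H2 p pP); apply: map_f; rewrite mem_enum.
  move=> z Hz; rewrite /A; congr (h (k _, _)); apply/rowP => i.
  rewrite mxE /= Hz ?mxE ?(unsplitK (inl i)) //.
  by apply/mapP => -[j _ /eqP]; rewrite eq_lrshift.
have L (p : Cinf (n + n) * jop R (n + n)) : exists l : smap X line, forall x, l x = p.2 (A h g x) 0 :> R.
  have sm : @smooth_map R X line (fun x => p.2 (A h g x) 0).
    move=> c cc; apply/curves_line.
    have S := @jopP _ _ p.2 _ (@A_jsm h g c cc) id (fun=> 0) (@smooth_id R).
    have C0 : @curves R (euclid (n + n)) (fun=> 0).
      by apply/curves_euclid => i; exact: smooth_cst.
    exact: (S C0).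
  by exists (Smap sm).
have := rpredB (H3 (F f)) (H3 (F f')).
rewrite opprB addrACA -opprD => H4.
have {H4} : ccomp (F f - F f') Delta - ccomp (\sum_(p <- P) p.1 * (japp p.2 (F f) - japp p.2 (F f'))) Delta \in wideal W.
  rewrite -ccompB; move: H4; congr (ccomp _ Delta \in wideal W).
  under [in RHS]eq_bigr do rewrite mulrBr.
  rewrite sumrB; move: (\sum_(p <- P) p.1 * japp p.2 (F f)) (\sum_(p <- P) p.1 * japp p.2 (F f')).
  by move: (F f) (F f') => a b c d; ring.
have S : ccomp (\sum_(p <- P) p.1 * (japp p.2 (F f) - japp p.2 (F f'))) Delta \in wideal W.
  change (\sum_(p <- P) p.1 * (japp p.2 (F f) - japp p.2 (F f')) \in J).
  elim: P key {H1 H2 HL H3} => [|p P IHP] key; first by rewrite big_nil rpred0.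
  rewrite big_cons rpredD //; last by apply: IHP => q qP; apply: key; right.
  apply: idealMr; have [l Hl] := L p.
  change (ccomp (japp p.2 (F f) - japp p.2 (F f')) Delta \in wideal W).
  have := ff l; congr (_ \in wideal W); rewrite ccompB.
  congr (_ - _); apply: smap_eq => x /=; rewrite Hl; symmetry; apply: key; by left.
by move=> H5; have := rpredD H5 S; rewrite subrK ccompB !FD.
Qed.
End PairWd.

Lemma jet_pairE (X Y : frolicher R) (W : wpres) (f : smap (euclid (wdim W)) X)
    (g : smap (euclid (wdim W)) Y) : sqW W ->
  jet_pair (\pi_(jets X W) f : prol X W) (\pi_(jets Y W) g : prol Y W) =
  \pi_(jets (fprod X Y) W) (spair f g).
Proof.
move=> sq; rewrite /jet_pair; set f' := repr _; set g' := repr _.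
rewrite (smoothenE _ (spair f' g')).
have Ef : \pi_(jets X W) f' = \pi f by rewrite reprK.
have Eg : \pi_(jets Y W) g' = \pi g by rewrite reprK.
rewrite (pair_wdl sq g' Ef).
have sw (k k' : smap (euclid (wdim W)) Y) : \pi_(jets (fprod X Y) W) (spair f k) =
   prol_map (sswap Y X) (\pi_(jets (fprod Y X) W) (spair k f) : prol _ _).
  by rewrite prol_mapE; congr (\pi _); apply: smap_eq.
by rewrite (sw g' g) (sw g g) (pair_wdl sq f Eg).
Qed.

End ProductJets.

(** * Jets in exponentials *)

Section Transposition.
Variable R : realType.
Local Notation Cinf := (Cinf R).
Local Notation euclid := (euclid R).
Local Notation line := (line R).
Local Notation wpres := (wpres R).

Lemma sliceE m n (t : 'rV[R]_n) (s : 'rV[R]_m) : slice m t s = row_mx s t.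
Proof.
apply/rowP => i; rewrite !mxE; case: (fintype.split i) => //= j; exact: mulr1.
Qed.

Lemma curve_row_mx m n (a : R -> 'rV[R]_m) (b : R -> 'rV[R]_n) :
  @curves R (euclid m) a -> @curves R (euclid n) b ->
  @curves R (euclid (m + n)) (fun s => row_mx (a s) (b s)).
Proof.
move=> /curves_euclid ca /curves_euclid cb; apply/curves_euclid => i.
rewrite -[i]splitK; case: (fintype.split i) => j /=.
  rewrite (_ : (fun s => _) = fun s => a s 0 j); first exact: ca.
  by apply/funext => s; rewrite row_mxEl.
rewrite (_ : (fun s => _) = fun s => b s 0 j); first exact: cb.
by apply/funext => s; rewrite row_mxEr.
Qed.

Section Curry.
Variables (X : frolicher R) (W1 W2 : wpres).
Hypothesis sq1 : sqW W1.

Fact curryS_subproof (f : smap (euclid (wdim W1 + wdim W2)) X) :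
  @smooth_map R (euclid (wdim W2)) (prol X W1)
    (fun t => \pi_(jets X W1) (scomp f (slice _ t))).
Proof.
apply: jet_param => // c /curves_fprod[c1 c2].
rewrite (_ : _ \o _ = fun s => f (row_mx (c s).2 (c s).1)).
  by apply: (smap_smooth f); exact: curve_row_mx.
by apply/funext => s /=; rewrite -sliceE.
Qed.
Definition curryS f : smap (euclid (wdim W2)) (prol X W1) := Smap (@curryS_subproof f).

Lemma curryE f : curry_jet f = \pi_(jets (prol X W1) W2) (curryS f).
Proof. by rewrite /curry_jet (smoothenE _ (curryS f)). Qed.
End Curry.

Lemma fhom_eval (X Y : frolicher R) :
  @smooth_map R (fprod (fhom X Y) X) Y (fun z => (z.1 : smap X Y) z.2).
Proof. exact: (@fhom_uncurry R (fhom X Y) X Y id (fun c cc => cc)). Qed.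

Fact postc_subproof (X Y Y' : frolicher R) (g : smap Y Y') :
  @smooth_map R (fhom X Y) (fhom X Y') (fun f => scomp g (f : smap X Y)).
Proof.
apply: fhom_curry => c cc; exact: (smap_smooth g (fhom_eval cc)).
Qed.
Definition postc (X Y Y' : frolicher R) (g : smap Y Y') : smap (fhom X Y) (fhom X Y') :=
  Smap (@postc_subproof X Y Y' g).

Definition footS (X : frolicher R) (W : wpres) : smap (prol X W) X := Smap (@foot_smooth R X W).

Fact zeroS_subproof (X : frolicher R) (W : wpres) : sqW W ->
  @smooth_map R X (prol X W) (@zero_jet R X W).
Proof. by move=> sq; apply: (jet_param sq) => c /curves_fprod[]. Qed.
Definition zeroS (X : frolicher R) (W : wpres) (sq : sqW W) : smap X (prol X W) :=
  Smap (@zeroS_subproof X W sq).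

Section Exponential.
Variables (M : frolicher R) (Mexp : weil_exponentiable M).
Variables (W : wpres) (sq : sqW W).
Local Notation n := (wdim W).
(** Weil exponentiability is used with W_1 = R only; this tensor product has
    the coordinates and the ideal of W. *)
Let T := wtensor (WD R 0) W.

Let ideal_T (f : Cinf n) : f \in wideal W <-> (f : Cinf (wdim T)) \in wideal T.
Proof.
split=> [fW|].
  apply: gen_mem; right; exists f; first exact: fW.
  apply: smap_eq => x; congr (f _); apply/rowP => i; rewrite mxE /=; congr (x _ _).
  exact: val_inj.
move=> /(@gen_sub _ _ _ _ (wideal W)); apply=> g [|] [k kI <-].
  rewrite (_ : scomp _ _ = (0 : Cinf n)) ?rpred0 //; apply: smap_eq => x.
  rewrite /= -[RHS](wcentred kI); congr (k _); by apply/rowP => -[].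
move: kI; congr (_ \in wideal W).
apply: smap_eq => x; congr (k _); apply/rowP => i; rewrite mxE /=; congr (x _ _).
exact: val_inj.
Qed.

Let idn : smap (euclid n) (euclid n) := srow (@coord R n).
Let idnE (X : frolicher R) (f : smap (euclid n) X) : scomp f idn = f.
Proof. by apply: smap_eq => x /=; congr (f _); apply/rowP => i; rewrite mxE. Qed.

Let jet_T (f g : smap (euclid n) M) :
  \pi_(jets M W) f = \pi_(jets M W) g <->
  \pi_(jets M T) (f : smap (euclid (wdim T)) M) = \pi_(jets M T) (g : smap (euclid (wdim T)) M).
Proof.
split=> /jet_eqP[E H]; apply/jet_eqP; split=> // h; exact: (ideal_T _).1 (H h) || exact: (ideal_T _).2 (H h).
Qed.

Let slice0 (x : 'rV[R]_n) : @slice R 0 n x 0 = x.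
Proof.
rewrite sliceE; apply/rowP => i; have E : rshift 0 i = i by apply: val_inj.
by rewrite -[in LHS]E; exact: row_mxEr.
Qed.

Let foot_curry (f : smap (euclid n) M) :
  prol_map (footS M (WD R 0)) (@curry_jet R M (WD R 0) W f) = \pi_(jets M W) f.
Proof.
rewrite (curryE (@WD_sq R 0)) prol_mapE; congr (\pi _); apply: smap_eq => x /=.
rewrite footE; congr (f _); exact: slice0.
Qed.

Let Phi_ev (Y : frolicher R) (Phi : smap (fhom Y (prol M T)) (prol (fhom Y (prol M (WD R 0))) W))
  (HPhi : forall (u : smap Y (prol M T)) (y : Y) (f : smap (euclid (wdim (WD R 0) + wdim W)) M),
    u y = \pi_(jets M T) f ->
    prol_map (fun v : fhom Y (prol M (WD R 0)) => (v : smap Y (prol M (WD R 0))) y) (Phi u) = curry_jet f)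
  (u : smap Y (prol M T)) (y : Y) (f : smap (euclid n) M) :
  u y = \pi_(jets M T) (f : smap (euclid (wdim T)) M) ->
  prol_map (@ev R Y M y) (prol_map (@postc Y _ _ (footS M (WD R 0))) (Phi u)) = \pi_(jets M W) f.
Proof.
move=> /HPhi H; rewrite -foot_curry.
have <- : prol_map (@ev R Y (prol M (WD R 0)) y) (Phi u) = @curry_jet R M (WD R 0) W f by [].
by rewrite !prol_map_comp; congr prol_map; apply: smap_eq.
Qed.

(** The identification of (M (x) W)^Y with M^Y (x) W holds on points: apply
    Weil exponentiability and remove the trivial factor by taking foot points. *)
Lemma transp_surj (Y : frolicher R) (v : smap Y (prol M W)) :
  exists u : prol (fhom Y M) W, forall y, prol_map (@ev R Y M y) u = v y.
Proof.
have [Phi [Psi [_ _ HPhi]]] := Mexp Y (sq_is_weil (@WD_sq R 0)) (sq_is_weil sq).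
have Hok f : f \in wideal W -> ccomp f idn \in wideal T.
  by move=> /ideal_T; rewrite /ccomp idnE.
have idn0 : idn 0 = 0 by apply/rowP => i; rewrite mxE.
pose v' : smap Y (prol M T) := scomp (Smap (@pull_smooth R W T idn Hok idn0 M)) v.
exists (prol_map (@postc Y _ _ (footS M (WD R 0))) (Phi v')) => y.
have [f Ef] : exists f, v y = \pi_(jets M W) f by exists (repr (v y : jets M W)); rewrite reprK.
rewrite (Phi_ev HPhi (f := f)) ?Ef // /= Ef (pullE Hok idn0).
congr (\pi _); exact: idnE.
Qed.

(** The trivial factor is inserted by zero jets, after which the inverse
    isomorphism shows that the jet is determined by its values at the points
    of Y. *)
Lemma transp_inj (Y : frolicher R) (u u' : prol (fhom Y M) W) :
  (forall y, prol_map (@ev R Y M y) u = prol_map (@ev R Y M y) u') -> u = u'.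
Proof.
move=> H; have [Phi [Psi [_ PsiK HPhi]]] := Mexp Y (sq_is_weil (@WD_sq R 0)) (sq_is_weil sq).
pose zz := @postc Y _ _ (zeroS M (@WD_sq R 0)).
pose ff := @postc Y _ _ (footS M (WD R 0)).
have K w : prol_map ff (Phi (Psi (prol_map zz w))) = w.
  rewrite PsiK prol_map_comp -[RHS](reprK (w : jets (fhom Y M) W)) -[in LHS](reprK (w : jets (fhom Y M) W)).
  rewrite prol_mapE; congr (\pi _); apply: smap_eq => x; apply: smap_eq => y /=.
  exact: foot_zero.
have key (w w' : smap Y (prol M T)) : (forall y, prol_map (@ev R Y M y) (prol_map ff (Phi w)) =
    prol_map (@ev R Y M y) (prol_map ff (Phi w'))) -> w = w'.
  move=> E; apply: smap_eq => y; have := E y.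
  have [f Ef] : exists f : smap (euclid n) M, w y = \pi_(jets M T) f.
    by exists (repr (w y : jets M T)); rewrite reprK.
  have [f' Ef'] : exists f : smap (euclid n) M, w' y = \pi_(jets M T) f.
    by exists (repr (w' y : jets M T)); rewrite reprK.
  move=> E'; have E2 := etrans (esym (Phi_ev HPhi Ef)) (etrans E' (Phi_ev HPhi Ef')).
  apply: etrans Ef _; apply: etrans _ (esym Ef'); exact: (jet_T f f').1 E2.
have E : Psi (prol_map zz u) = Psi (prol_map zz u').
  apply: key => y; apply: etrans (congr1 _ (K u)) _; apply: etrans (H y) _.
  exact: esym (congr1 _ (K u')).
apply: etrans (esym (K u)) _; apply: etrans _ (K u').
exact: (congr1 (fun w => prol_map ff (Phi w)) E).
Qed.

Lemma transp_smooth (Y : frolicher R) (u : prol (fhom Y M) W) :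
  @smooth_map R Y (prol M W) (fun y => prol_map (@ev R Y M y) u).
Proof.
elim/prol_ind: u => F.
rewrite (_ : (fun y => _) = (fun y => \pi_(jets M W) (scomp (@ev R Y M y) F))).
  apply: jet_param => // c /curves_fprod[c1 c2].
  apply: (@fhom_eval Y M (fun s => (F (c s).2, (c s).1))); apply/curves_fprod; split=> //.
  exact: (smap_smooth F).
by apply/funext => y; exact: prol_mapE.
Qed.

(** A curve of jets is a family of jets parametrised by the line, hence by
    [transp_surj] a jet in the space of curves in M, and a representative of
    the latter is a smooth family of representatives. *)
Lemma jet_lift (c : R -> prol M W) : @curves R (prol M W) c ->
  exists2 Phi : R -> smap (euclid n) M,
    @smooth_map R (fprod line (euclid n)) M (fun z => Phi z.1 z.2) &
    forall t, c t = \pi_(jets M W) (Phi t).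
Proof.
move=> cc; have sc : @smooth_map R line (prol M W) c.
  by move=> a /curves_line; exact: curves_comp.
have [u Hu] := transp_surj (Smap sc).
elim/prol_ind: u Hu => F Hu; exists (fun t => scomp (@ev R line M t) F).
  move=> a /curves_fprod[a1 a2].
  apply: (@fhom_eval line M (fun s => (F (a s).2, (a s).1))); apply/curves_fprod; split=> //.
  exact: (smap_smooth F).
by move=> t; rewrite -[LHS](Hu t) prol_mapE.
Qed.

End Exponential.

Lemma zero01_pull (X : frolicher R) (t1 t2 : prol X (WD R 1)) : foot t1 = foot t2 ->
  @pull R X (WD R 1) (WD R 0) (zero01 R) t1 = @pull R X (WD R 1) (WD R 0) (zero01 R) t2.
Proof.
elim/prol_ind: t1 => f; elim/prol_ind: t2 => g; rewrite !footE => E.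
rewrite !(pullE (@zero01_ok R) (zero01_0 R)); apply/jet_eqP.
have E' : scomp f (zero01 R) 0 = scomp g (zero01 R) 0 by change (f (zero01 R 0) = g (zero01 R 0)); rewrite zero01_0.
split=> // h; apply: ideal0P; rewrite Cinf_subE.
by apply/eqP; rewrite subr_eq0; apply/eqP; exact: (congr1 h E').
Qed.

Section Gamma.
Variables (M : frolicher R) (Mmicro : microlinear M) (Mexp : weil_exponentiable M).
Variable Y : frolicher R.
Local Notation X := (fhom Y M).

(** For each point of Y microlinearity of M gives gamma, smoothly in the
    point, and transposition makes it a jet in M^Y.  In particular the default
    value in the definition of the sum is not attained. *)
Lemma tadd_ex (t1 t2 : prol X (WD R 1)) : foot t1 = foot t2 ->
  exists G : smap (euclid 2) X,
    [/\ t1 = \pi_(jets X (WD R 1)) (scomp G (in1 R)),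
        t2 = \pi_(jets X (WD R 1)) (scomp G (in2 R)) &
        tadd t1 t2 = \pi_(jets X (WD R 1)) (scomp G (diag2 R))].
Proof.
move=> H.
have [|v Hv] := @WD2_lift R M Y (Smap (@transp_smooth M (WD R 1) (@WD_sq R 1) Y t1))
    (Smap (@transp_smooth M (WD R 1) (@WD_sq R 1) Y t2)) Mmicro.
  move=> y; apply: zero01_pull; apply: etrans (foot_map (@ev R Y M y) t1) _.
  exact: etrans (congr1 (@ev R Y M y) H) (esym (foot_map (@ev R Y M y) t2)).
have [g Hg] := transp_surj Mexp (@WD2_sq R) v.
have E1 : @pull R X (WD2 R) (WD R 1) (in1 R) g = t1.
  apply: (transp_inj Mexp (@WD_sq R 1)) => y.
  by rewrite -(pull_map (@in1_ok R) (in1_0 R)) Hg (Hv y).1.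
have E2 : @pull R X (WD2 R) (WD R 1) (in2 R) g = t2.
  apply: (transp_inj Mexp (@WD_sq R 1)) => y.
  by rewrite -(pull_map (@in2_ok R) (in2_0 R)) Hg (Hv y).2.
rewrite /tadd; case: xgetP => [g' _ [E1' E2']|/(_ g)[]]; last by split.
pose G := repr (g' : jets X (WD2 R)); exists G.
have Eg : g' = \pi_(jets X (WD2 R)) G by rewrite reprK.
split.
- by rewrite -E1' Eg; exact: (pullE (@in1_ok R) (in1_0 R)).
- by rewrite -E2' Eg; exact: (pullE (@in2_ok R) (in2_0 R)).
- by rewrite Eg; exact: (pullE (@diag2_ok R) (diag2_0 R)).
Qed.

Lemma strong_ex (g1 g2 : prol X (WD R 2)) :
  @pull R X (WD R 2) (WD2 R) (id22 R) g1 = @pull R X (WD R 2) (WD2 R) (id22 R) g2 ->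
  exists G : smap (euclid 3) X,
    [/\ g1 = \pi_(jets X (WD R 2)) (scomp G (psi3 R)),
        g2 = \pi_(jets X (WD R 2)) (scomp G (phi3 R)) &
        strong_diff g1 g2 = \pi_(jets X (WD R 1)) (scomp G (eps3 R))].
Proof.
move=> H.
have [|v Hv] := @WD2D_lift R M Y (Smap (@transp_smooth M (WD R 2) (@WD_sq R 2) Y g1))
    (Smap (@transp_smooth M (WD R 2) (@WD_sq R 2) Y g2)) Mmicro.
  move=> y; apply: etrans (pull_map (@id22_ok R) (id22_0 R) (@ev R Y M y) g1) _.
  apply: etrans (congr1 (prol_map (@ev R Y M y)) H) _.
  exact: esym (pull_map (@id22_ok R) (id22_0 R) (@ev R Y M y) g2).
have [g Hg] := transp_surj Mexp (@WD2D_sq R) v.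
have E1 : @pull R X (WD2D R) (WD R 2) (psi3 R) g = g1.
  apply: (transp_inj Mexp (@WD_sq R 2)) => y.
  by rewrite -(pull_map (@psi3_ok R) (psi3_0 R)) Hg (Hv y).1.
have E2 : @pull R X (WD2D R) (WD R 2) (phi3 R) g = g2.
  apply: (transp_inj Mexp (@WD_sq R 2)) => y.
  by rewrite -(pull_map (@phi3_ok R) (phi3_0 R)) Hg (Hv y).2.
rewrite /strong_diff; case: xgetP => [g' _ [E1' E2']|/(_ g)[]]; last by split.
pose G := repr (g' : jets X (WD2D R)); exists G.
have Eg : g' = \pi_(jets X (WD2D R)) G by rewrite reprK.
split.
- by rewrite -E1' Eg; exact: (pullE (@psi3_ok R) (psi3_0 R)).
- by rewrite -E2' Eg; exact: (pullE (@phi3_ok R) (phi3_0 R)).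
- by rewrite Eg; exact: (pullE (@eps3_ok R) (eps3_0 R)).
Qed.

End Gamma.
End Transposition.

(** * The two composites of operations *)

Section Operations.
Variable R : realType.
Local Notation euclid := (euclid R).
Local Notation line := (line R).
Variables (M : frolicher R) (Mexp : weil_exponentiable M).
Local Notation ops := (ops M).
Local Notation "'J_ p" := (jets M (WD R p)) (at level 8, p at level 2, format "''J_' p").

Lemma delta_pi p (f : smap (euclid p) M) : delta M p (\pi_('J_p) f) = f 0.
Proof. exact: (@footE R M (WD R p) f). Qed.

Section Reindex.
Variables (p q : nat) (rho : 'I_q -> 'I_p).

Definition rmap : smap (euclid p) (euclid q) := srow (fun i => coord R (rho i)).

Lemma rmapE x i : rmap x 0 i = x 0 (rho i). Proof. by rewrite mxE. Qed.
Lemma rmap0 : rmap 0 = 0. Proof. by apply/rowP => i; rewrite rmapE !mxE. Qed.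
Lemma rmap_ok f : f \in wideal (WD R q) -> ccomp f rmap \in wideal (WD R p).
Proof. by apply: (@WD_compat R q (WD R p)) => i; exact: WD_sq. Qed.

Definition rpull : prol M (WD R q) -> prol M (WD R p) := @pull R M (WD R q) (WD R p) rmap.
Lemma rpull_smooth : smooth_map rpull.
Proof. exact: (@pull_smooth R (WD R q) (WD R p) rmap rmap_ok rmap0 M). Qed.
Lemma rpull_pi (f : smap (euclid q) M) : rpull (\pi_('J_q) f) = \pi_('J_p) (scomp f rmap).
Proof. exact: (@pullE R (WD R q) (WD R p) rmap rmap_ok rmap0 M f). Qed.

Definition oper1 (eta : ops p) : ops q := scomp (eta : smap _ _) (Smap rpull_smooth).
Fact oper_subproof : @smooth_map R (ops p) (ops q) oper1.
Proof.
apply: fhom_curry => c /curves_fprod[c1 c2].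
apply: (@fhom_eval R _ _ (fun s => ((c s).1, rpull (c s).2))); apply/curves_fprod; split=> //.
exact: rpull_smooth.
Qed.
(** Permutations of coordinates, casts along equalities of dimensions and
    exchanges of blocks all act by such reindexings, so that they compose by
    composing maps of indices. *)
Definition oper : smap (ops p) (ops q) := Smap oper_subproof.

Lemma oper_pi (eta : ops p) (f : smap (euclid q) M) :
  (oper eta : smap _ _) (\pi_('J_q) f) = (eta : smap _ _) (\pi_('J_p) (scomp f rmap)).
Proof. by rewrite /= rpull_pi. Qed.

Lemma oper_delta : oper (delta M p) = delta M q.
Proof.
apply: smap_eq; elim/prol_ind => f; rewrite oper_pi !delta_pi.
by change (f (rmap 0) = f 0); rewrite rmap0.
Qed.

End Reindex.

Lemma opermE p (s : 'S_p) : @operm R M p s = oper s.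
Proof. by apply/funext => eta; rewrite /operm (smoothenE _ (oper s eta : smap _ _)). Qed.

Lemma icastE p q (e : p = q) (xi : prol (ops p) (WD R 1)) :
  icast e xi = prol_map (oper (cast_ord (esym e))) xi.
Proof.
case: q / e; elim/prol_ind: xi => f.
apply: etrans _ (esym (prol_mapE (oper (cast_ord (esym (erefl p)))) f)).
change (\pi_(jets (ops p) (WD R 1)) f =
  \pi_(jets (ops p) (WD R 1)) (scomp (oper (cast_ord (esym (erefl p)))) f)).
congr (\pi _); apply: smap_eq => x; apply: smap_eq; elim/prol_ind => g.
rewrite [RHS](oper_pi _ (f x)) /=; congr (f x _); congr (\pi _).
by apply: smap_eq => y /=; congr (g _); apply/rowP => i; rewrite mxE /= cast_ord_id.
Qed.

Section TStar.
Variables p q : nat.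

Lemma tensor_jet (f f' : smap (euclid (p + q)) M) :
  \pi_('J_(p + q)) f = \pi_('J_(p + q)) f' ->
  \pi_(jets M (wtensor (WD R p) (WD R q))) (f : smap (euclid (wdim (wtensor (WD R p) (WD R q)))) M)
  = \pi_(jets M (wtensor (WD R p) (WD R q))) f'.
Proof.
move=> /jet_eqP[E H]; apply/jet_eqP; split=> // h; move: (H h).
apply: (@gen_sub _ _ _ (@D_gens0 R (p + q)) (wideal (wtensor (WD R p) (WD R q)))) => _ [i _ <-].
rewrite -[i]splitK; case: (fintype.split i) => j; apply: gen_mem.
  left; exists (coord R j ^+ 2); first exact: (@WD_sq R p j).
  by apply: smap_eq => x; rewrite !expr2 /= !mxE.
right; exists (coord R j ^+ 2); first exact: (@WD_sq R q j).
by apply: smap_eq => x; rewrite !expr2 /= !mxE.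
Qed.

(** Weil exponentiability, applied to a constant family, expresses the
    currying of a representative by the class alone. *)
Lemma curry_wd (f f' : smap (euclid (p + q)) M) :
  \pi_('J_(p + q)) f = \pi_('J_(p + q)) f' ->
  @curry_jet R M (WD R p) (WD R q) f = @curry_jet R M (WD R p) (WD R q) f'.
Proof.
move=> /tensor_jet H.
have [Phi [Psi [_ _ HPhi]]] := Mexp line (sq_is_weil (@WD_sq R p)) (sq_is_weil (@WD_sq R q)).
pose u := scst line (\pi_(jets M (wtensor (WD R p) (WD R q))) (f : smap (euclid (wdim (wtensor (WD R p) (WD R q)))) M)
   : prol M (wtensor (WD R p) (WD R q))).
by rewrite -(HPhi u 0 f erefl) -(HPhi u 0 f' H).
Qed.

(** The map b |-> eta [a |-> f(a, b)]. *)
Definition inn (eta : ops p) (f : smap (euclid (p + q)) M) : smap (euclid q) M :=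
  scomp (eta : smap _ _) (@curryS R M (WD R p) (WD R q) (@WD_sq R p) f).

Definition tstarF (eta1 : ops p) (eta2 : ops q) (gamma : prol M (WD R (p + q))) : M :=
  (eta2 : smap _ _) (prol_map (eta1 : smap _ _) (split_jet gamma)).

Lemma tstarF_pi eta1 eta2 f : tstarF eta1 eta2 (\pi_('J_(p + q)) f) =
  (eta2 : smap _ _) (\pi_('J_q) (inn eta1 f)).
Proof.
rewrite /tstarF /split_jet; congr (smap_fun eta2 _).
rewrite (@curry_wd _ f) ?reprK // (curryE (@WD_sq R p)).
exact: prol_mapE.
Qed.

Lemma inn_curve (Phi : R -> smap (euclid (p + q)) M) (eta : R -> ops p) :
  @smooth_map R (fprod line (euclid (p + q))) M (fun z => Phi z.1 z.2) -> curves eta ->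
  @curves R (prol M (WD R q)) (fun s => \pi_('J_q) (inn (eta s) (Phi s))).
Proof.
move=> sP ce.
have S1 : @smooth_map R (fprod line (euclid q)) (prol M (WD R p))
    (fun z => \pi_('J_p) (scomp (Phi z.1) (slice _ z.2))).
  apply: (@jet_param R (fprod line (euclid q)) M (WD R p)
     (fun z => scomp (Phi z.1) (slice _ z.2)) (@WD_sq R p)) => c /curves_fprod[c1 c2].
  move: c1 => /(@curves_fprod R line (euclid q))[c1 c3].
  have := sP (fun s => ((c s).1.1, row_mx (c s).2 (c s).1.2)) _.
  rewrite (_ : _ \o _ = ((fun z => scomp (Phi z.1.1) (slice p z.1.2) z.2) \o c)).
    by apply; apply/curves_fprod; split=> //; exact: curve_row_mx.
  by apply/funext => s /=; rewrite -sliceE.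
have S2 : @smooth_map R line (prol M (WD R q)) (fun s => \pi_('J_q) (inn (eta s) (Phi s))).
  apply: (@jet_param R line M (WD R q) (fun s => inn (eta s) (Phi s)) (@WD_sq R q)).
  move=> c /curves_fprod[c1 c2].
  apply: (@fhom_eval R _ _ (fun s => (eta (c s).1, \pi_('J_p) (scomp (Phi (c s).1) (slice _ (c s).2)) : prol M (WD R p)))).
  apply/curves_fprod; split; first by move: c1 => /curves_line; exact: curves_comp.
  exact: (S1 c (proj2 (curves_fprod _) (conj c1 c2))).
by apply: (S2 id); apply/curves_line; exact: smooth_id.
Qed.

(** The curve of jets lifts to a smooth family of representatives, on which
    the composite is a chain of evaluations of smooth families. *)
Lemma tstarF_curve (eta1 : R -> ops p) (eta2 : R -> ops q) (gamma : R -> prol M (WD R (p + q))) :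
  curves eta1 -> curves eta2 -> curves gamma ->
  curves (fun s => tstarF (eta1 s) (eta2 s) (gamma s)).
Proof.
move=> c1 c2 cg; have [Phi sP Eg] := jet_lift Mexp (@WD_sq R (p + q)) cg.
apply: (@fhom_eval R _ _ (fun s => (eta2 s, prol_map (eta1 s : smap _ _) (split_jet (gamma s))))).
apply/curves_fprod; split=> //=; move: (inn_curve sP c1).
congr (curves _); apply/funext => s; rewrite Eg /split_jet.
rewrite (@curry_wd _ (Phi s)) ?reprK // (curryE (@WD_sq R p)).
symmetry; exact: prol_mapE.
Qed.

Lemma cst_curve (X : frolicher R) (x : X) : curves (fun _ : R => x).
Proof. by apply/curvesP => f _; exact: smooth_cst. Qed.

Lemma tstarE (z : fprod (ops p) (ops q)) gamma :
  (tstar z : smap _ _) gamma = tstarF z.1 z.2 gamma.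
Proof.
have sm : @smooth_map R (prol M (WD R (p + q))) M (tstarF z.1 z.2).
  by move=> c cc; apply: (tstarF_curve (cst_curve _) (cst_curve _) cc).
by rewrite /tstar (smoothenP _ sm).
Qed.

Lemma tstar_pi eta1 eta2 f : (tstar (eta1, eta2) : smap _ _) (\pi_('J_(p + q)) f) =
  (eta2 : smap _ _) (\pi_('J_q) (inn eta1 f)).
Proof. by rewrite tstarE tstarF_pi. Qed.

Fact tstar_smooth : @smooth_map R (fprod (ops p) (ops q)) (ops (p + q)) (@tstar R M p q).
Proof.
apply: fhom_curry => c /curves_fprod[/curves_fprod[c1 c2] c3].
rewrite (_ : _ \o _ = fun s => tstarF (c s).1.1 (c s).1.2 (c s).2); first exact: tstarF_curve.
by apply/funext => s /=; rewrite tstarE.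
Qed.
Definition tstarS : smap (fprod (ops p) (ops q)) (ops (p + q)) := Smap tstar_smooth.

End TStar.

Section Star.
Variables p q : nat.

(** [star] is [tstar] with the two operations and the two blocks of
    coordinates exchanged, so its properties follow. *)
Definition swap_ord (i : 'I_(p + q)) : 'I_(q + p) :=
  match fintype.split i with inl j => rshift q j | inr k => lshift p k end.

Lemma rmap_swap (a : 'rV[R]_p) (b : 'rV[R]_q) : rmap swap_ord (row_mx b a) = row_mx a b.
Proof.
apply/rowP => i; rewrite rmapE /swap_ord -[i]splitK unsplitK.
by case: (fintype.split i) => j /=; rewrite ?row_mxEl ?row_mxEr.
Qed.

Lemma starE (z : fprod (ops p) (ops q)) : star z = oper swap_ord (tstar (z.2, z.1)).
Proof.
rewrite /star; set F := (X in smoothen _ X).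
have -> : F = smap_fun (oper swap_ord (tstar (z.2, z.1)) : smap _ _); last exact: smoothenE.
apply/funext => g; rewrite /= tstarE /tstarF /F /split_jet /split_jet'.
congr (smap_fun z.1 (prol_map _ _)); apply: curry_wd.
rewrite reprK /rpull /pull; congr (\pi _).
apply: smap_eq => x /=; congr (smap_fun (repr _) _); apply/rowP => i; rewrite !mxE /swap_ord.
by case: (fintype.split i).
Qed.

Definition starS : smap (fprod (ops p) (ops q)) (ops (p + q)) :=
  scomp (oper swap_ord) (scomp (tstarS q p) (sswap _ _)).

Lemma starS_E : @star R M p q = starS.
Proof. by apply/funext => z; rewrite starE. Qed.

Lemma star_pi (eta1 : ops p) (eta2 : ops q) f :
  (star (eta1, eta2) : smap _ _) (\pi_('J_(p + q)) f) =
  (eta1 : smap _ _) (\pi_('J_p) (inn eta2 (scomp f (rmap swap_ord)))).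
Proof. by rewrite starE oper_pi tstar_pi. Qed.

End Star.

(** With the argument a bare function, iterated composites become nested
    applications of [ap] that can be compared by rewriting the innermost
    argument, without mention of smoothness. *)
Definition ap p (eta : ops p) (F : 'rV[R]_p -> M) : M :=
  (eta : smap _ _) (\pi_('J_p) (smoothen (scst (euclid p) (F 0)) F)).

Lemma apE p (eta : ops p) (F : smap (euclid p) M) : ap eta F = (eta : smap _ _) (\pi_('J_p) F).
Proof. by rewrite /ap smoothenE. Qed.

Lemma innE p q (eta : ops p) (f : smap (euclid (p + q)) M) b :
  inn eta f b = ap eta (fun a => f (row_mx a b)).
Proof.
rewrite (_ : (fun a => _) = scomp f (slice p b)) ?apE //.
by apply/funext => a /=; rewrite -sliceE.
Qed.

Lemma ap_tstar p q (eta1 : ops p) (eta2 : ops q) (f : smap (euclid (p + q)) M) :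
  ap (tstar (eta1, eta2)) f = ap eta2 (fun b => ap eta1 (fun a => f (row_mx a b))).
Proof.
by rewrite apE tstar_pi -apE; congr ap; apply/funext => b; rewrite innE.
Qed.

Lemma inn'E p q (eta : ops q) (f : smap (euclid (p + q)) M) a :
  inn eta (scomp f (rmap (@swap_ord p q))) a = ap eta (fun b => f (row_mx a b)).
Proof.
by rewrite innE; congr ap; apply/funext => b; congr (f _); exact: rmap_swap.
Qed.

Lemma ap_star p q (eta1 : ops p) (eta2 : ops q) (f : smap (euclid (p + q)) M) :
  ap (star (eta1, eta2)) f = ap eta1 (fun a => ap eta2 (fun b => f (row_mx a b))).
Proof.
by rewrite apE star_pi -apE; congr ap; apply/funext => a; rewrite inn'E.
Qed.

Lemma ap_oper p q (rho : 'I_q -> 'I_p) (eta : ops p) (f : smap (euclid q) M) :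
  ap (oper rho eta) f = ap eta (fun x => f (rmap rho x)).
Proof. by rewrite apE oper_pi -apE. Qed.

Lemma ap_delta p (F : 'rV[R]_p -> M) (sF : @smooth_map R (euclid p) M F) : ap (delta M p) F = F 0.
Proof. by rewrite -[F]/(smap_fun (Smap sF)) apE delta_pi. Qed.

Lemma ops_eq p (eta eta' : ops p) :
  (forall f : smap (euclid p) M, ap eta f = ap eta' f) -> eta = eta'.
Proof. by move=> H; apply: smap_eq; elim/prol_ind => f; have := H f; rewrite !apE. Qed.

Lemma row_smoothl p q (f : smap (euclid (p + q)) M) b :
  @smooth_map R (euclid p) M (fun a => f (row_mx a b)).
Proof.
move=> c cc; apply: (smap_smooth f); apply: curve_row_mx => //.
by apply/curves_euclid => i; exact: smooth_cst.
Qed.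
Lemma row_smoothr p q (f : smap (euclid (p + q)) M) a :
  @smooth_map R (euclid q) M (fun b => f (row_mx a b)).
Proof.
move=> c cc; apply: (smap_smooth f); apply: curve_row_mx => //.
by apply/curves_euclid => i; exact: smooth_cst.
Qed.

(** The projection picks the value at 0, so the order of application does not
    matter; together with the next lemma this is the agreement on D(2). *)
Lemma tstar_star_deltar p q (eta : ops p) :
  tstar (eta, delta M q) = star (eta, delta M q) :> ops (p + q).
Proof.
apply: ops_eq => f; rewrite ap_star ap_tstar.
rewrite (_ : (fun b => _) = inn eta f) ?apE ?delta_pi ?innE; last first.
  by apply/funext => b; rewrite innE.
by congr ap; apply/funext => a; rewrite (ap_delta (row_smoothr f a)).
Qed.

Lemma tstar_star_deltal p q (eta : ops q) :
  tstar (delta M p, eta) = star (delta M p, eta) :> ops (p + q).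
Proof.
apply: ops_eq => f; rewrite ap_star ap_tstar.
rewrite [in RHS](_ : (fun a => _) = inn eta (scomp f (rmap (@swap_ord p q)))); last first.
  by apply/funext => a; rewrite inn'E.
rewrite apE delta_pi inn'E.
by congr ap; apply/funext => b; rewrite (ap_delta (row_smoothl f b)).
Qed.

Lemma tstar_delta p q : tstar (delta M p, delta M q) = delta M (p + q).
Proof.
apply: ops_eq => f; rewrite ap_tstar.
rewrite (_ : (fun b => _) = inn (delta M p) f); last by apply/funext => b; rewrite innE.
by rewrite !apE !delta_pi innE (ap_delta (row_smoothl f 0)) row_mx0.
Qed.

End Operations.

(** * Iterated derivatives at the origin *)

Section IteratedDerivatives.
Variable R : realType.
Local Notation Cinf := (Cinf R).
Local Notation euclid := (euclid R).
Local Notation "''x[' n ]_ k" := (coord R (@Ordinal n k isT))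
  (at level 8, k at level 2, format "''x[' n ]_ k").

Definition swap22 : smap (euclid 2) (euclid 2) := polymap [tuple 'x[2]_1; 'x[2]_0].

Lemma swap22_ok f : f \in wideal (WD R 2) -> ccomp f swap22 \in wideal (WD R 2).
Proof.
rewrite /swap22 /polymap; apply: (@WD_compat R 2 (WD R 2)).
have := (@WD_sq R 2 : forall i, coord R i ^+ 2 \in wideal (WD R 2)).
move: (wideal (WD R 2)) => J S.
by case=> [[|[|[|?]]] ?] //; rewrite !(tnth_nth 0) /= S.
Qed.

Lemma c2_congr (f g : Cinf 2) : f - g \in wideal (WD R 2) -> c2 f = c2 g.
Proof. by move=> /c2_ideal /eqP; rewrite c2B subr_eq0 => /eqP. Qed.

Lemma c2_affine (a b c : R) : c2 (Cinf_cst 2 a + (b *: 'x[2]_0 + c *: 'x[2]_1)) = 0.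
Proof.
rewrite /c2 (_ : (fun s => _) = (fun=> c)); first exact: dz_cst.
apply/funext => s.
rewrite (_ : (fun t => _) = fun t => c * t + (a + b * s)).
  by rewrite (dzD (smoothZ c (@smooth_id R)) (@smooth_cst _ _)) dz_cst addr0 dzZ ?dz_id ?mulr1 //;
    exact: smooth_id.
by apply/funext => t; rewrite /= !mxE /= addrA addrC.
Qed.

(** Both sides are the coefficient of xy in an expansion modulo a symmetric
    ideal. *)
Lemma c2_swap (f : Cinf 2) : c2 (ccomp f swap22) = c2 f.
Proof.
have [a Ha] := affine_mod (@WD2_prod R) f; have [d Hd] := ideal2_const Ha.
rewrite big_ord2 in Hd; set a0 := a _ in Hd; set a1 := a _ in Hd.
have E : c2 f = d.
  have := c2_ideal Hd; rewrite !c2B c2_affine subr0 => /eqP; rewrite subr_eq0 => /eqP ->.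
  by rewrite c2Z -['x[2]_0 * _]mulr1 c2_coordM mulr1.
have H := c2_ideal (swap22_ok Hd).
rewrite E; move/eqP: H; rewrite !ccompB !c2B ccompZ c2Z.
have -> : ccomp (Cinf_cst 2 (f 0 : R) + (a0 *: 'x[2]_0 + a1 *: 'x[2]_1)) swap22 =
    Cinf_cst 2 (f 0 : R) + (a1 *: 'x[2]_0 + a0 *: 'x[2]_1).
  by apply: smap_eq => x; rewrite /= !mxE /= ?mxE; congr (_ + _); rewrite addrC.
have -> : ccomp ('x[2]_0 * 'x[2]_1) swap22 = 'x[2]_0 * 'x[2]_1 * 1.
  by apply: smap_eq => x; rewrite /= !mxE /= ?mxE mulr1 mulrC.
by rewrite c2_affine subr0 c2_coordM mulr1 subr_eq0 => /eqP.
Qed.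

Lemma dz_swap (K : R -> R -> R) : BS2 K ->
  dz (fun s => dz (fun t => K s t)) = dz (fun t => dz (fun s => K s t)).
Proof.
move=> BK; have sm (c : R -> 'rV[R]_2) : @curves R (euclid 2) c ->
    smooth ((fun v : 'rV[R]_2 => K (v 0 0) (v 0 1)) \o c).
  by move=> /curves_euclid cc; apply: BK; exact: cc.
pose F : Cinf 2 := Cinf_mk sm.
have -> : dz (fun s => dz (fun t => K s t)) = c2 F.
  by congr dz; apply/funext => s; congr dz; apply/funext => t; rewrite /= !mxE.
rewrite -c2_swap; congr dz; apply/funext => s; congr dz; apply/funext => t.
by rewrite /= !mxE /= ?mxE.
Qed.

Definition BS3 (Q : R -> R -> R -> R) := forall a b c : R -> R,
  smooth a -> smooth b -> smooth c -> smooth (fun s => Q (a s) (b s) (c s)).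
Definition D3 (Q : R -> R -> R -> R) := dz (fun s => dz (fun t => dz (fun u => Q s t u))).

Lemma BS3_dz Q : BS3 Q -> BS2 (fun s t => dz (fun u => Q s t u)).
Proof.
move=> H a b sa sb; apply: (@BS2_dz R (fun v u => Q (a v) (b v) u)) => c d sc second_diff.
exact: (H (a \o c) (b \o c) d (smooth_comp sa sc) (smooth_comp sb sc) second_diff).
Qed.

Lemma BS3_rot Q : BS3 Q -> BS3 (fun t u s => Q s t u).
Proof. by move=> H a b c sa sb sc; apply: H. Qed.

Lemma D3_rot Q : BS3 Q -> D3 (fun t u s => Q s t u) = D3 Q.
Proof.
move=> H; apply: etrans _ (esym (dz_swap (BS3_dz H))).
have E t : dz (fun u => dz (fun s => Q s t u)) = dz (fun s => dz (fun u => Q s t u)).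
  have B : BS2 (fun u s => Q s t u).
    by move=> b c sb sc; exact: (H c (fun=> t) b sc (@smooth_cst _ t) sb).
  exact: (dz_swap B).
have E' : (fun t => dz (fun u => dz (fun s => Q s t u))) =
    (fun t => dz (fun s => dz (fun u => Q s t u))) by apply/funext.
exact: (congr1 (@dz R) E').
Qed.

Lemma dz2B (F G : R -> R -> R) : BS2 F -> BS2 G ->
  dz (fun s => dz (F s) - dz (G s)) = dz (fun s => dz (F s)) - dz (fun s => dz (G s)).
Proof. by move=> BF BG; exact: (dzB (BS2_dz BF) (BS2_dz BG)). Qed.

End IteratedDerivatives.

(** * Differentiation along tangent vectors *)

Section Tangents.
Variable R : realType.
Local Notation Cinf := (Cinf R).
Local Notation euclid := (euclid R).
Local Notation line := (line R).
Local Notation "''x[' n ]_ k" := (coord R (@Ordinal n k isT))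
  (at level 8, k at level 2, format "''x[' n ]_ k").

Definition tderiv (X : frolicher R) (H : smap X line) (t : prol X (WD R 1)) : R :=
  c1 (hc H (repr (t : jets X (WD R 1)))).

Lemma tderiv_pi (X : frolicher R) (H : smap X line) (F : smap (euclid 1) X) :
  tderiv H (\pi_(jets X (WD R 1)) F) = dz (fun t => H (F (vec 1 [:: t]))).
Proof.
rewrite /tderiv; set F' := repr _.
have /jet_eqP[_ E] : \pi_(jets X (WD R 1)) F' = \pi F by rewrite reprK.
by have /eqP := c1_ideal (E H); rewrite c1B subr_eq0 => /eqP.
Qed.

Lemma tderiv_map (X Y : frolicher R) (K : smap X Y) (H : smap Y line) (t : prol X (WD R 1)) :
  tderiv H (prol_map K t) = tderiv (scomp H K) t.
Proof. by elim/prol_ind: t => F; rewrite prol_mapE !tderiv_pi. Qed.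

Lemma tderiv_zero (X : frolicher R) (H : smap X line) x : tderiv H (zero_jet (WD R 1) x) = 0.
Proof. exact: etrans (tderiv_pi H (scst (euclid 1) x)) (dz_cst (H x : R)). Qed.

(** The class of a function in W_D consists of its value and its derivative at
    0. *)
Lemma tangent_ext (X : frolicher R) (t t' : prol X (WD R 1)) :
  foot t = foot t' -> (forall H, tderiv H t = tderiv H t') -> t = t'.
Proof.
elim/prol_ind: t => F; elim/prol_ind: t' => F'; rewrite !footE => E HC.
apply/jet_eqP; split=> // h; apply: ideal1P.
  by apply/eqP; rewrite Cinf_subE subr_eq0; apply/eqP; exact: (congr1 h E).
by have := HC h; rewrite !tderiv_pi c1B => E'; apply/eqP; rewrite subr_eq0; apply/eqP.
Qed.

(** By [D2D_split], both sides are the coefficient of z. *)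
Lemma c1_eps (K : Cinf 3) :
  c1 (ccomp K (eps3 R)) = c2 (ccomp K (psi3 R)) - c2 (ccomp K (phi3 R)).
Proof.
have [c Hc] := D2D_split K.
have H1 := c1_ideal (eps3_ok Hc); have H2 := c2_ideal (psi3_ok Hc).
move: H1 H2; rewrite !ccompB !ccompD !ccompZ c1B c2B c1D c2D c1Z c2Z psi3_pr32 psi3_z.
rewrite -['x[2]_0 * _]mulr1 c2_coordM mulr1 => /eqP H1 /eqP H2.
move: H1 H2; rewrite !subr_eq0 => /eqP -> /eqP ->; rewrite [X in X - _]addrC addrK.
rewrite [X in X + _](_ : _ = 0) ?add0r.
  rewrite (_ : ccomp 'x[3]_2 (eps3 R) = 'x[1]_0 * 1) ?c1_coordM ?mulr1 //.
  by rewrite /eps3 /polymap ccomp_coord (tnth_nth 0).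
rewrite -[RHS](dz_cst (K 0)); congr dz; apply/funext => t; congr (K _).
by apply/rowP => -[[|[|[|?]]] ?] //; rewrite !mxE /= ?mxE /= ?mxE.
Qed.

Lemma c1_diag (K : Cinf 2) :
  c1 (ccomp K (diag2 R)) = c1 (ccomp K (in1 R)) + c1 (ccomp K (in2 R)).
Proof.
have [a Ha] := affine_mod (@WD2_prod R) K; rewrite big_ord2 in Ha.
set a0 := a _ in Ha; set a1 := a _ in Ha.
have := c1_ideal (diag2_ok Ha); have := c1_ideal (in1_ok Ha); have := c1_ideal (in2_ok Ha).
have E k : ccomp (Cinf_cst 2 (K 0 : R) + (a0 *: 'x[2]_0 + a1 *: 'x[2]_1)) k =
    Cinf_cst 1 (K 0 : R) + (a0 *: ccomp 'x[2]_0 k + a1 *: ccomp 'x[2]_1 k).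
  exact: smap_eq.
rewrite !ccompB !c1B !E /diag2 /in1 /in2 /polymap !ccomp_coord !(tnth_nth 0) /=.
rewrite !scaler0 add0r addr0 -scalerDl !c1_affine => /eqP + /eqP + /eqP.
by rewrite !subr_eq0 => /eqP -> /eqP -> /eqP ->.
Qed.

Variables (M : frolicher R) (Mmicro : microlinear M) (Mexp : weil_exponentiable M).

Lemma tadd_spec (Y : frolicher R) (t1 t2 : prol (fhom Y M) (WD R 1)) : foot t1 = foot t2 ->
  foot (tadd t1 t2) = foot t1 /\ forall H, tderiv H (tadd t1 t2) = tderiv H t1 + tderiv H t2.
Proof.
move=> /(tadd_ex Mmicro Mexp)[G [E1 E2 ->]]; rewrite E1 E2; split.
  by rewrite !footE; change (G (diag2 R 0) = G (in1 R 0)); rewrite diag2_0 in1_0.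
by move=> H; rewrite !tderiv_pi; exact: (c1_diag (hc H G)).
Qed.

Lemma strong_spec (Y : frolicher R) (G1 G2 : smap (euclid 2) (fhom Y M)) :
  G1 0 = G2 0 ->
  (forall h, hc h G1 - hc h G2 \in wideal (WD2 R)) ->
  let d := strong_diff (\pi_(jets (fhom Y M) (WD R 2)) G1 : prol _ _) (\pi_(jets _ (WD R 2)) G2) in
  foot d = G1 0 /\ forall H, tderiv H d = c2 (hc H G1) - c2 (hc H G2).
Proof.
move=> E0 E; have [|G [E1 E2 ->]] := strong_ex Mmicro Mexp
  (g1 := \pi_(jets (fhom Y M) (WD R 2)) G1) (g2 := \pi_(jets (fhom Y M) (WD R 2)) G2).
  rewrite !(pullE (@id22_ok R) (id22_0 R)); apply/jet_eqP; split.
    by change (G1 (id22 R 0) = G2 (id22 R 0)); rewrite id22_0.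
  move=> h; have := E h; congr (_ - _ \in wideal (WD2 R)).
    by apply: etrans (esym (id22E (hc h G1))) _; exact: smap_eq.
  by apply: etrans (esym (id22E (hc h G2))) _; exact: smap_eq.
have /jet_eqP[F1 H1] := E1; have /jet_eqP[F2 H2] := E2; split.
  by rewrite footE F1; change (G (eps3 R 0) = G (psi3 R 0)); rewrite eps3_0 psi3_0.
move=> H; rewrite tderiv_pi; apply: etrans (c1_eps (hc H G)) _.
have A1 : ccomp (hc H G) (psi3 R) = hc H (scomp G (psi3 R)) by exact: smap_eq.
have A2 : ccomp (hc H G) (phi3 R) = hc H (scomp G (phi3 R)) by exact: smap_eq.
have B1 := c2_congr (H1 H); have B2 := c2_congr (H2 H).
by rewrite A1 A2 B1 B2.
Qed.

End Tangents.

(** * Brackets as commutators *)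

Section Jacobi.
Variable R : realType.
Local Notation Cinf := (Cinf R).
Local Notation euclid := (euclid R).
Local Notation line := (line R).
Variables (M : frolicher R) (Mmicro : microlinear M) (Mexp : weil_exponentiable M).
Local Notation ops := (ops M).
Local Notation jet1 X f := (\pi_(jets X (WD R 1)) f : prol X (WD R 1)).
Local Notation tS := (tstarS Mexp).
Local Notation sS := (starS Mexp).
Local Notation "F @1 s" := (smap_fun F (vec 1 [:: s])) (at level 10, s at level 8).

Lemma pr1_vec s t : pr1 R (vec 2 [:: s; t]) = vec 1 [:: s].
Proof. by apply/rowP => -[[|?] ?] //; rewrite !mxE /= ?mxE. Qed.
Lemma pr2_vec s t : pr2 R (vec 2 [:: s; t]) = vec 1 [:: t].
Proof. by apply/rowP => -[[|?] ?] //; rewrite !mxE /= ?mxE. Qed.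

Section Bracket.
Variables (p q : nat) (F1 : smap (euclid 1) (ops p)) (F2 : smap (euclid 1) (ops q)).
Hypotheses (F10 : F1 0 = delta M p) (F20 : F2 0 = delta M q).

Let sp : smap (euclid 2) (fprod (ops p) (ops q)) :=
  spair (scomp F1 (pr1 R)) (scomp F2 (pr2 R)).

Lemma bipull_pi : bipull (jet1 (ops p) F1) (jet1 (ops q) F2) =
  \pi_(jets (fprod (ops p) (ops q)) (WD R 2)) sp.
Proof.
rewrite /bipull.
have E1 := @pullE R (WD R 1) (WD R 2) (pr1 R) (@pr1_ok R) (pr1_0 R) (ops p) F1.
have E2 := @pullE R (WD R 1) (WD R 2) (pr2 R) (@pr2_ok R) (pr2_0 R) (ops q) F2.
apply: etrans (congr2 (@jet_pair R (ops p) (ops q) (WD R 2)) E1 E2) _.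
exact: (jet_pairE _ _ (@WD_sq R 2)).
Qed.

Lemma c2_word (T : smap (fprod (ops p) (ops q)) (ops (p + q))) (H : smap (ops (p + q)) line) :
  c2 (hc H (scomp T sp)) = dz (fun s => dz (fun t => H (T (F1 @1 s, F2 @1 t)))).
Proof.
have E s t : (hc H (scomp T sp) (vec 2 [:: s; t]) : R) = H (T (F1 @1 s, F2 @1 t)).
  change ((H (T (F1 (pr1 R (vec 2 [:: s; t])), F2 (pr2 R (vec 2 [:: s; t])))) : R) =
    H (T (F1 @1 s, F2 @1 t))).
  by rewrite pr1_vec pr2_vec.
have E' : (fun s => dz (fun t => hc H (scomp T sp) (vec 2 [:: s; t]) : R)) =
    (fun s => dz (fun t => H (T (F1 @1 s, F2 @1 t)))).
  apply/funext => s; have E'' : (fun t => hc H (scomp T sp) (vec 2 [:: s; t]) : R) =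
    (fun t => H (T (F1 @1 s, F2 @1 t))) by apply/funext.
  exact: (congr1 (@dz R) E'').
exact: (congr1 (@dz R) E').
Qed.

(** Tested against H, the bracket is a commutator of the two families,
    differentiated once in each parameter. *)
Lemma lie_spec :
  let l := lie (jet1 (ops p) F1) (jet1 (ops q) F2) in
  foot l = delta M (p + q) /\ forall H, tderiv H l =
    dz (fun s => dz (fun t => H (tS p q (F1 @1 s, F2 @1 t)))) -
    dz (fun s => dz (fun t => H (sS p q (F1 @1 s, F2 @1 t)))).
Proof.
rewrite /lie bipull_pi (starS_E Mexp p q).
have E1 := prol_mapE (tS p q) (W := WD R 2) sp; have E2 := prol_mapE (sS p q) (W := WD R 2) sp.
rewrite [X in strong_diff X _](_ : _ = \pi_(jets (ops (p + q)) (WD R 2)) (scomp (tS p q) sp)); last exact: E1.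
rewrite [X in strong_diff _ X](_ : _ = \pi_(jets (ops (p + q)) (WD R 2)) (scomp (sS p q) sp)); last exact: E2.
have eqr (e : ops p) : tS p q (e, delta M q) = sS p q (e, delta M q).
  by rewrite -(starS_E Mexp p q); exact: tstar_star_deltar.
have eql (e : ops q) : tS p q (delta M p, e) = sS p q (delta M p, e).
  by rewrite -(starS_E Mexp p q); exact: tstar_star_deltal.
have P1 x : pr1 R (in2 R x) = 0.
  by apply/rowP => -[[|?] ?] //; rewrite !mxE /= ?mxE.
have P2 x : pr2 R (in1 R x) = 0.
  by apply/rowP => -[[|?] ?] //; rewrite !mxE /= ?mxE.
have S1 x : sp (in1 R x) = (F1 (pr1 R (in1 R x)), delta M q).
  by change ((F1 (pr1 R (in1 R x)), F2 (pr2 R (in1 R x))) = (F1 (pr1 R (in1 R x)), delta M q)); rewrite P2 F20.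
have S2 x : sp (in2 R x) = (delta M p, F2 (pr2 R (in2 R x))).
  by change ((F1 (pr1 R (in2 R x)), F2 (pr2 R (in2 R x))) = (delta M p, F2 (pr2 R (in2 R x)))); rewrite P1 F10.
have S0 : sp 0 = (delta M p, delta M q).
  by change ((F1 (pr1 R 0), F2 (pr2 R 0)) = (delta M p, delta M q)); rewrite pr1_0 pr2_0 F10 F20.
have [||Hf HC] := @strong_spec R M Mmicro Mexp (prol M (WD R (p + q))) (scomp (tS p q) sp) (scomp (sS p q) sp).
- by change (tS p q (sp 0) = sS p q (sp 0)); rewrite S0.
- move=> h; apply: ideal2P.
    rewrite (_ : ccomp _ _ = (0 : Cinf 1)) ?rpred0 //; apply: smap_eq => x.
    change ((hc h (scomp (tS p q) sp) - hc h (scomp (sS p q) sp)) (in1 R x) = 0 :> R).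
    rewrite Cinf_subE; apply/eqP; rewrite subr_eq0; apply/eqP.
    by change (h (tS p q (sp (in1 R x))) = h (sS p q (sp (in1 R x))) :> R); rewrite S1 eqr.
  rewrite (_ : ccomp _ _ = (0 : Cinf 1)) ?rpred0 //; apply: smap_eq => x.
  change ((hc h (scomp (tS p q) sp) - hc h (scomp (sS p q) sp)) (in2 R x) = 0 :> R).
  rewrite Cinf_subE; apply/eqP; rewrite subr_eq0; apply/eqP.
  by change (h (tS p q (sp (in2 R x))) = h (sS p q (sp (in2 R x))) :> R); rewrite S2 eql.
split=> [|H].
  apply: etrans Hf _; change (tS p q (sp 0) = delta M (p + q)); rewrite S0.
  exact: tstar_delta.
by apply: etrans (HC H) _; rewrite !c2_word.
Qed.

End Bracket.

Section Nested.
Variables (p q r : nat) (F1 : smap (euclid 1) (ops p)) (F2 : smap (euclid 1) (ops q))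
  (F3 : smap (euclid 1) (ops r)).
Hypotheses (F10 : F1 0 = delta M p) (F20 : F2 0 = delta M q) (F30 : F3 0 = delta M r).

(** The composite of the values at s, t, u of three families, tested against
    H. *)
Definition word (T : smap (fprod (ops p) (ops (q + r))) (ops (p + (q + r))))
    (T' : smap (fprod (ops q) (ops r)) (ops (q + r))) (H : smap (ops (p + (q + r))) line) s t u : R :=
  H (T (F1 @1 s, T' (F2 @1 t, F3 @1 u))).

Lemma F_curve n (F : smap (euclid 1) (ops n)) (a : R -> R) : smooth a -> curves (fun s => F @1 (a s)).
Proof. by move=> sa; apply: (smap_smooth F (vec1_curve sa)). Qed.

Lemma word_BS3 T T' H : BS3 (word T T' H).
Proof.
move=> a b c sa sb sc.
apply: (@smap_line R _ H (fun s => T (F1 @1 (a s), T' (F2 @1 (b s), F3 @1 (c s))))).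
apply: (smap_smooth T (c := fun s => (F1 @1 (a s), T' (F2 @1 (b s), F3 @1 (c s))))).
apply/curves_fprod; split; first exact: F_curve.
apply: (smap_smooth T' (c := fun s => (F2 @1 (b s), F3 @1 (c s)))).
by apply/curves_fprod; split; exact: F_curve.
Qed.

(** Expand the outer bracket with a representative of the inner one; for each
    value of the outer parameter the inner bracket is then expanded with the
    test function e |-> H (T (F1 s, e)). *)
Lemma lie_nested :
  let l := lie (jet1 (ops p) F1) (lie (jet1 (ops q) F2) (jet1 (ops r) F3)) in
  foot l = delta M (p + (q + r)) /\ forall H, tderiv H l =
    D3 (word (tS _ _) (tS _ _) H) - D3 (word (tS _ _) (sS _ _) H) -
    (D3 (word (sS _ _) (tS _ _) H) - D3 (word (sS _ _) (sS _ _) H)).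
Proof.
have [f23 C23] := lie_spec F20 F30; set l23 := lie _ _ in f23 C23 *.
pose G := repr (l23 : jets (ops (q + r)) (WD R 1)).
have EG : l23 = jet1 (ops (q + r)) G by rewrite reprK.
have G0 : G 0 = delta M (q + r) by exact: f23.
have [fl Cl] := lie_spec F10 G0; rewrite -EG in fl Cl; split=> // H.
apply: etrans (Cl H) _.
have key (T : smap (fprod (ops p) (ops (q + r))) (ops (p + (q + r)))) :
    dz (fun s => dz (fun t => H (T (F1 @1 s, G @1 t)))) =
    D3 (word T (tS _ _) H) - D3 (word T (sS _ _) H).
  have E s : dz (fun t => H (T (F1 @1 s, G @1 t))) =
      dz (fun t => dz (fun u => word T (tS _ _) H s t u)) -
      dz (fun t => dz (fun u => word T (sS _ _) H s t u)).
    have sm : @smooth_map R (ops (q + r)) line (fun e => H (T (F1 @1 s, e))).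
      move=> c cc; apply: (smap_smooth H); apply: (smap_smooth T (c := fun u => (F1 @1 s, c u))).
      by apply/curves_fprod; split=> //; exact: cst_curve.
    have := C23 (Smap sm); rewrite EG => <-.
    by rewrite tderiv_pi.
  have E' : (fun s => dz (fun t => H (T (F1 @1 s, G @1 t)))) = (fun s =>
      dz (fun t => dz (fun u => word T (tS _ _) H s t u)) -
      dz (fun t => dz (fun u => word T (sS _ _) H s t u))) by apply/funext.
  apply: etrans (congr1 (@dz R) E') _.
  exact: (dz2B (BS3_dz (@word_BS3 T (tS _ _) H)) (BS3_dz (@word_BS3 T (sS _ _) H))).
by rewrite (key (tS _ _)) (key (sS _ _)).
Qed.

End Nested.

Section Words.
Variables (p q r : nat) (e1 : ops p) (e2 : ops q) (e3 : ops r) (f : smap (euclid (p + (q + r))) M).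
Local Notation f3 a b c := (f (row_mx a (row_mx b c))).

(** The four composites in a nested bracket, as nested applications: in
    [tstar] the first operation acts first, in [star] the second one. *)
Lemma word_tt : ap (tS _ _ (e1, tS _ _ (e2, e3))) f =
  ap e3 (fun c => ap e2 (fun b => ap e1 (fun a => f3 a b c))).
Proof.
rewrite (ap_tstar Mexp) (_ : (fun b => _) = inn e1 f); last by apply/funext => b; rewrite innE.
rewrite (ap_tstar Mexp); congr ap; apply/funext => c; congr ap; apply/funext => b; exact: innE.
Qed.

Lemma word_ts : ap (tS _ _ (e1, sS _ _ (e2, e3))) f =
  ap e2 (fun b => ap e3 (fun c => ap e1 (fun a => f3 a b c))).
Proof.
rewrite (ap_tstar Mexp) (_ : (fun b => _) = inn e1 f); last by apply/funext => b; rewrite innE.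
rewrite -(starS_E Mexp) (ap_star Mexp).
congr ap; apply/funext => c; congr ap; apply/funext => b; exact: innE.
Qed.

Lemma word_st : ap (sS _ _ (e1, tS _ _ (e2, e3))) f =
  ap e1 (fun a => ap e3 (fun c => ap e2 (fun b => f3 a b c))).
Proof.
rewrite -(starS_E Mexp) (ap_star Mexp); congr ap; apply/funext => a.
exact: (ap_tstar Mexp e2 e3 (Smap (row_smoothr f a))).
Qed.

Lemma word_ss : ap (sS _ _ (e1, sS _ _ (e2, e3))) f =
  ap e1 (fun a => ap e2 (fun b => ap e3 (fun c => f3 a b c))).
Proof.
rewrite -!(starS_E Mexp) (ap_star Mexp); congr ap; apply/funext => a.
exact: (ap_star Mexp e2 e3 (Smap (row_smoothr f a))).
Qed.

End Words.

End Jacobi.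

(** * Rearrangement of coordinates *)

Section Rearrangement.
Variable R : realType.

Lemma row_mx_lE m n (a : 'rV[R]_m) (b : 'rV[R]_n) (k : 'I_(m + n)) (j : 'I_m) :
  k = j :> nat -> row_mx a b 0 k = a 0 j.
Proof. by move=> E; rewrite (_ : k = lshift n j) ?row_mxEl //; exact: val_inj. Qed.

Lemma row_mx_rE m n (a : 'rV[R]_m) (b : 'rV[R]_n) (k : 'I_(m + n)) (j : 'I_n) :
  k = (m + j)%N :> nat -> row_mx a b 0 k = b 0 j.
Proof. by move=> E; rewrite (_ : k = rshift m j) ?row_mxEr //; exact: val_inj. Qed.

Lemma sigma_l a b (k : 'I_(a + b)) (j : 'I_a) : k = j :> nat -> sigma a b k = (b + j)%N :> nat.
Proof.
move=> E; rewrite permE /sigma_fun (_ : k = lshift b j); last exact: val_inj.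
by rewrite (unsplitK (inl j)).
Qed.

Lemma sigma_r a b (k : 'I_(a + b)) (j : 'I_b) : k = (a + j)%N :> nat -> sigma a b k = j :> nat.
Proof.
move=> E; rewrite permE /sigma_fun (_ : k = rshift a j); last exact: val_inj.
by rewrite (unsplitK (inr j)).
Qed.

Variables p q r : nat.

(** This permutation, which comes with the second summand of the identity,
    brings (b, c, a) to the order (a, b, c). *)
Definition rho2 (e : (q + (r + p))%N = (p + (q + r))%N) (i : 'I_(p + (q + r))) : 'I_(q + (r + p)) :=
  cast_ord (esym e) (sigma p (q + r) i).

Lemma rho2_row e (a : 'rV[R]_p) (b : 'rV[R]_q) (c : 'rV[R]_r) :
  rmap R (rho2 e) (row_mx b (row_mx c a)) = row_mx a (row_mx b c).
Proof.
apply/rowP => i; rewrite rmapE -[i]splitK; case: (fintype.split i) => j /=.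
  rewrite row_mxEl (@row_mx_rE _ _ b (row_mx c a) _ (rshift r j)) ?row_mxEr //=.
  by rewrite (sigma_l (j := j)) // addnA.
rewrite row_mxEr -[j]splitK; case: (fintype.split j) => k /=.
  rewrite row_mxEl; apply: row_mx_lE => /=.
  by rewrite (sigma_r (j := lshift r k)).
rewrite row_mxEr (@row_mx_rE _ _ b (row_mx c a) _ (lshift p k)) ?row_mxEl //=.
by rewrite (sigma_r (j := rshift q k)).
Qed.

(** Likewise this one, which comes with the third summand, for (c, a, b). *)
Definition rho3 (e : (r + (p + q))%N = ((p + q) + r)%N) (e' : ((p + q) + r)%N = (p + (q + r))%N)
    (i : 'I_(p + (q + r))) : 'I_(r + (p + q)) :=
  cast_ord (esym e) (sigma (p + q) r (cast_ord (esym e') i)).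

Lemma rho3_row e e' (a : 'rV[R]_p) (b : 'rV[R]_q) (c : 'rV[R]_r) :
  rmap R (rho3 e e') (row_mx c (row_mx a b)) = row_mx a (row_mx b c).
Proof.
apply/rowP => i; rewrite rmapE -[i]splitK; case: (fintype.split i) => j /=.
  rewrite row_mxEl (@row_mx_rE _ _ c (row_mx a b) _ (lshift q j)) ?row_mxEl //=.
  by rewrite (sigma_l (j := lshift q j)).
rewrite row_mxEr -[j]splitK; case: (fintype.split j) => k /=.
  rewrite row_mxEl (@row_mx_rE _ _ c (row_mx a b) _ (rshift p k)) ?row_mxEr //=.
  by rewrite (sigma_l (j := rshift p k)).
rewrite row_mxEr; apply: row_mx_lE => /=.
by rewrite (sigma_r (j := k)) //= addnA.
Qed.

End Rearrangement.

(** * The Jacobi identity *)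

Section Final.
Variable R : realType.
Variables (M : frolicher R) (Mexp : weil_exponentiable M).
Local Notation ops := (ops M).
Local Notation tS := (tstarS Mexp).
Local Notation sS := (starS Mexp).
Variables p q r : nat.

Lemma oper_comp m n l (rho : 'I_n -> 'I_m) (rho' : 'I_l -> 'I_n) (eta : ops m) :
  oper M rho' (oper M rho eta) = oper M (rho \o rho') eta.
Proof.
apply: ops_eq => f; rewrite !apE !oper_pi; congr (smap_fun eta (\pi _)).
by apply: smap_eq => x /=; congr (f _); apply/rowP => i; rewrite !mxE /= ?mxE.
Qed.

Variables (e2 : (q + (r + p))%N = (p + (q + r))%N) (e3 : (r + (p + q))%N = ((p + q) + r)%N)
  (e3' : ((p + q) + r)%N = (p + (q + r))%N).
Local Notation O2 := (oper M (rho2 e2)).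
Local Notation O3 := (oper M (rho3 e3 e3')).
Variables (x : ops p) (y : ops q) (z : ops r).

(** The digits list the operations in their order of application.  Each of
    these lemmas identifies two of the twelve composites that occur in the
    identity. *)
Lemma word_231 : O2 (tS _ _ (y, tS _ _ (z, x))) = sS _ _ (x, tS _ _ (y, z)).
Proof.
apply: ops_eq => f; rewrite ap_oper (word_tt Mexp y z x (scomp f (rmap R (rho2 e2)))) word_st.
congr ap; apply/funext => a; congr ap; apply/funext => c; congr ap; apply/funext => b.
by rewrite -(rho2_row e2).
Qed.

Lemma word_132 : O2 (sS _ _ (y, sS _ _ (z, x))) = tS _ _ (x, sS _ _ (y, z)).
Proof.
apply: ops_eq => f; rewrite ap_oper (word_ss Mexp y z x (scomp f (rmap R (rho2 e2)))) word_ts.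
congr ap; apply/funext => b; congr ap; apply/funext => c; congr ap; apply/funext => a.
by rewrite -(rho2_row e2).
Qed.

Lemma word_321 : O3 (tS _ _ (z, sS _ _ (x, y))) = sS _ _ (x, sS _ _ (y, z)).
Proof.
apply: ops_eq => f; rewrite ap_oper (word_ts Mexp z x y (scomp f (rmap R (rho3 e3 e3')))) word_ss.
congr ap; apply/funext => a; congr ap; apply/funext => b; congr ap; apply/funext => c.
by rewrite -(rho3_row e3 e3').
Qed.

Lemma word_123 : O3 (sS _ _ (z, tS _ _ (x, y))) = tS _ _ (x, tS _ _ (y, z)).
Proof.
apply: ops_eq => f; rewrite ap_oper (word_st Mexp z x y (scomp f (rmap R (rho3 e3 e3')))) word_tt.
congr ap; apply/funext => c; congr ap; apply/funext => b; congr ap; apply/funext => a.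
by rewrite -(rho3_row e3 e3').
Qed.

Lemma word_213 : O2 (tS _ _ (y, sS _ _ (z, x))) = O3 (sS _ _ (z, sS _ _ (x, y))).
Proof.
apply: ops_eq => f; rewrite !ap_oper (word_ts Mexp y z x (scomp f (rmap R (rho2 e2)))).
rewrite (word_ss Mexp z x y (scomp f (rmap R (rho3 e3 e3')))).
congr ap; apply/funext => c; congr ap; apply/funext => a; congr ap; apply/funext => b.
exact: (congr1 f (etrans (rho2_row e2 a b c) (esym (rho3_row e3 e3' a b c)))).
Qed.

Lemma word_312 : O2 (sS _ _ (y, tS _ _ (z, x))) = O3 (tS _ _ (z, tS _ _ (x, y))).
Proof.
apply: ops_eq => f; rewrite !ap_oper (word_st Mexp y z x (scomp f (rmap R (rho2 e2)))).
rewrite (word_tt Mexp z x y (scomp f (rmap R (rho3 e3 e3')))).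
congr ap; apply/funext => b; congr ap; apply/funext => a; congr ap; apply/funext => c.
exact: (congr1 f (etrans (rho2_row e2 a b c) (esym (rho3_row e3 e3' a b c)))).
Qed.

End Final.

Lemma D3_rot2 (R : realType) (Q : R -> R -> R -> R) : BS3 Q -> D3 (fun u s t => Q s t u) = D3 Q.
Proof. by move=> H; rewrite -(D3_rot (BS3_rot (BS3_rot H))). Qed.

Lemma D3_ext (R : realType) (P Q : R -> R -> R -> R) :
  (forall s t u, P s t u = Q s t u) -> D3 P = D3 Q.
Proof.
move=> E; rewrite (_ : P = Q) //.
by apply/funext => s; apply/funext => t; apply/funext => u.
Qed.

Local Close Scope ring_scope.

Theorem theorem52 (R : realType) (M : frolicher R)
    (Mmicro : microlinear M) (Mexp : weil_exponentiable M)
    (p q r : nat)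
    (xi1 : prol (ops M p) (WD R 1)) (xi2 : prol (ops M q) (WD R 1))
    (xi3 : prol (ops M r) (WD R 1))
    (icon1 : icon xi1) (icon2 : icon xi2) (icon3 : icon xi3) :
  tadd
    (tadd
       (lie xi1 (lie xi2 xi3))
       (iperm (sigma p (q + r))
          (icast (etrans (addnA q r p) (addnC (q + r) p))
             (lie xi2 (lie xi3 xi1)))))
    (icast (esym (addnA p q r))
       (iperm (sigma (p + q) r)
          (icast (addnC r (p + q)) (lie xi3 (lie xi1 xi2)))))
  = zero_jet (WD R 1) (delta M (p + (q + r))).
Proof.
set e2 := etrans _ _; set e3 := addnC _ _; set e3' := esym (addnA _ _ _).
pose F1 := repr (xi1 : jets (ops M p) (WD R 1)).
pose F2 := repr (xi2 : jets (ops M q) (WD R 1)).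
pose F3 := repr (xi3 : jets (ops M r) (WD R 1)).
have E1 : xi1 = \pi_(jets (ops M p) (WD R 1)) F1 by rewrite reprK.
have E2 : xi2 = \pi_(jets (ops M q) (WD R 1)) F2 by rewrite reprK.
have E3 : xi3 = \pi_(jets (ops M r) (WD R 1)) F3 by rewrite reprK.
have F10 : F1 0%R = delta M p by exact: icon1.
have F20 : F2 0%R = delta M q by exact: icon2.
have F30 : F3 0%R = delta M r by exact: icon3.
have [f1 C1_] := lie_nested Mmicro Mexp F10 F20 F30.
have [f2 C2_] := lie_nested Mmicro Mexp F20 F30 F10.
have [f3 C3_] := lie_nested Mmicro Mexp F30 F10 F20.
rewrite -!E1 -!E2 -!E3 in f1 C1_ f2 C2_ f3 C3_.
set l1 := lie xi1 _ in f1 C1_ *; set l2 := lie xi2 _ in f2 C2_ *; set l3 := lie xi3 _ in f3 C3_ *.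
have -> : iperm (sigma p (q + r)) (icast e2 l2) = prol_map (oper M (rho2 e2)) l2.
  rewrite /iperm opermE icastE prol_map_comp; congr (prol_map _ l2).
  by apply/funext => eta; exact: oper_comp.
have -> : icast e3' (iperm (sigma (p + q) r) (icast e3 l3)) = prol_map (oper M (rho3 e3 e3')) l3.
  rewrite /iperm opermE !icastE !prol_map_comp; congr (prol_map _ l3).
  by apply/funext => eta /=; rewrite -[LHS]/(oper M _ (oper M _ (oper M _ eta))) !oper_comp.
set O2 := oper M (rho2 e2); set O3 := oper M (rho3 e3 e3').
have g2 : foot (prol_map O2 l2) = delta M (p + (q + r)) by rewrite foot_map f2; exact: oper_delta.
have g3 : foot (prol_map O3 l3) = delta M (p + (q + r)) by rewrite foot_map f3; exact: oper_delta.
have [h12 D12] := tadd_spec Mmicro Mexp (etrans f1 (esym g2)).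
have [h D] := tadd_spec Mmicro Mexp (etrans h12 (etrans f1 (esym g3))).
apply: tangent_ext; first by apply: etrans h _; apply: etrans h12 _; rewrite foot_zero.
move=> H; apply: etrans _ (esym (tderiv_zero H _)).
have T2 := etrans (tderiv_map O2 H l2) (C2_ (scomp H O2)).
have T3 := etrans (tderiv_map O3 H l3) (C3_ (scomp H O3)).
have T := etrans (D H) (congr2 +%R (etrans (D12 H) (congr2 +%R (C1_ H) T2)) T3).
apply: etrans T _.
set tS := tstarS Mexp; set sS := starS Mexp.
have W231 : D3 (word F2 F3 F1 (tS _ _) (tS _ _) (scomp H O2)) =
    D3 (word F1 F2 F3 (sS _ _) (tS _ _) H).
  apply: etrans _ (D3_rot (@word_BS3 R M p q r F1 F2 F3 (sS _ _) (tS _ _) H)).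
  by apply: D3_ext => t u s; exact: (congr1 H (word_231 Mexp e2 _ _ _)).
have W132 : D3 (word F2 F3 F1 (sS _ _) (sS _ _) (scomp H O2)) =
    D3 (word F1 F2 F3 (tS _ _) (sS _ _) H).
  apply: etrans _ (D3_rot (@word_BS3 R M p q r F1 F2 F3 (tS _ _) (sS _ _) H)).
  by apply: D3_ext => t u s; exact: (congr1 H (word_132 Mexp e2 _ _ _)).
have W321 : D3 (word F3 F1 F2 (tS _ _) (sS _ _) (scomp H O3)) =
    D3 (word F1 F2 F3 (sS _ _) (sS _ _) H).
  apply: etrans _ (D3_rot2 (@word_BS3 R M p q r F1 F2 F3 (sS _ _) (sS _ _) H)).
  by apply: D3_ext => u s t; exact: (congr1 H (word_321 Mexp e3 e3' _ _ _)).
have W123 : D3 (word F3 F1 F2 (sS _ _) (tS _ _) (scomp H O3)) =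
    D3 (word F1 F2 F3 (tS _ _) (tS _ _) H).
  apply: etrans _ (D3_rot2 (@word_BS3 R M p q r F1 F2 F3 (tS _ _) (tS _ _) H)).
  by apply: D3_ext => u s t; exact: (congr1 H (word_123 Mexp e3 e3' _ _ _)).
have W213 : D3 (word F2 F3 F1 (tS _ _) (sS _ _) (scomp H O2)) =
    D3 (word F3 F1 F2 (sS _ _) (sS _ _) (scomp H O3)).
  apply: etrans _ (D3_rot2 (@word_BS3 R M r p q F3 F1 F2 (sS _ _) (sS _ _) (scomp H O3))).
  by apply: D3_ext => t u s; exact: (congr1 H (word_213 Mexp e2 e3 e3' _ _ _)).
have W312 : D3 (word F2 F3 F1 (sS _ _) (tS _ _) (scomp H O2)) =
    D3 (word F3 F1 F2 (tS _ _) (tS _ _) (scomp H O3)).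
  apply: etrans _ (D3_rot2 (@word_BS3 R M r p q F3 F1 F2 (tS _ _) (tS _ _) (scomp H O3))).
  by apply: D3_ext => t u s; exact: (congr1 H (word_312 Mexp e2 e3 e3' _ _ _)).
(* the six orders of application, each with both signs *)
rewrite W231 W132 W321 W123 W213 W312.
move: (D3 _) (D3 _) (D3 _) (D3 _) (D3 _) (D3 _) => a b c d e f; ring.
Qed.
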